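(* Let $d\ge3$, let $\Omega\subset\mathbb{P}(\mathbb{R}^d)$ be a properly convex domain, and suppose that a sequence $\{\gamma_n\}$ in $\mathrm{Aut}(\Omega)$ $R$-tracks a projective geodesic ray $c:[0,\infty)\to\Omega$ with respect to $x_0\in\Omega$. If $c$ is $M$-Morse for a Morse gauge $M$, then $c(\infty)$ is a $C^\alpha$ point and a $\beta$-convex point for some $\alpha>1$ and $\beta<\infty$ depending only on $M$, $R$ and $x_0$ (for the given domain $\Omega$). Moreover $$\alpha(c(\infty),\Omega)=\liminf_{n\to\infty}\frac{\mu_{1,d}(\gamma_n)}{\mu_{1,d-1}(\gamma_n)}>1\quad\text{and}\quad\beta(c(\infty),\Omega)=\limsup_{n\to\infty}\frac{\mu_{1,d}(\gamma_n)}{\mu_{1,2}(\gamma_n)}<\infty.$$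
   Context: A properly convex domain $\Omega\subset\mathbb{P}(\mathbb{R}^d)$ is a nonempty open convex set whose closure is a bounded convex subset of some affine chart. $\mathrm{Aut}(\Omega)\subset\mathrm{PGL}(d,\mathbb{R})$ is the group of projective transformations preserving $\Omega$. The Hilbert metric is $d_\Omega(x,y)=\frac12\log\frac{|a-y||b-x|}{|a-x||b-y|}$, where $a,b\in\partial\Omega$ are the points where the projective line through $x,y$ meets $\partial\Omega$, ordered $a,x,y,b$. A projective geodesic ray is a unit-speed geodesic ray $c:[0,\infty)\to\Omega$ whose image is a projective line segment $[p,q)$ with $p\in\Omega$, $q\in\partial\Omega$; $c(\infty):=q$. $\{\gamma_n\}$ $R$-tracks $c$ with respect to $x_0$ if $d_\Omega(x_0,\gamma_n^{-1}c(n))<R$ for all $n\in\mathbb{N}$. Morse: a Morse gauge is any function $M:\mathbb{R}_{\ge0}\times\mathbb{R}_{\ge0}\to\mathbb{R}_{\ge0}$; a geodesic $\ell$ is $M$-Morse if every $(\lambda,a)$-quasi-geodesic with endpoints on $\ell$ lies in the $M(\lambda,a)$-neighborhood of $\ell$. For $g$ with singular values $\sigma_1(g)\ge\dots\ge\sigma_d(g)$, $\mu_{i,j}(g)=\log\frac{\sigma_i(g)}{\sigma_j(g)}$, well defined on $\mathrm{PGL}(d,\mathbb{R})$. A quotient with positive numerator and zero denominator is read as $+\infty$. A supporting hyperplane of $\Omega$ is a projective hyperplane meeting $\overline\Omega$ but not $\Omega$. A point $x\in\partial\Omega$ is a $C^1$ point if there is a unique supporting hyperplane of $\Omega$ containing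 $x$. Fix a Euclidean distance $\mathrm{d}$ on an affine chart containing $\overline\Omega$ (the notions below do not depend on it). For $\alpha>1$, $x\in\partial\Omega$ is a $C^\alpha$ point if there are a neighborhood $U$ of $x$ and $C>0$ such that $\mathrm{d}(y,H)\le C\,\mathrm{d}(y,x)^\alpha$ for every supporting hyperplane $H$ of $\Omega$ at $x$ and every $y\in U\cap\partial\Omega$ (such a point is a $C^1$ point). For $\beta<\infty$, a $C^1$ point $x$ with supporting hyperplane $H$ is $\beta$-convex if there are a neighborhood $U$ of $x$ and $C>0$ such that $\mathrm{d}(y,H)\ge C\,\mathrm{d}(y,x)^\beta$ for every $y\in U\cap\partial\Omega$. For a $C^1$ point $x$, set $\alpha(x,\Omega)=\sup\{\alpha>1: x\text{ is a }C^\alpha\text{ point}\}$, with $\alpha(x,\Omega)=1$ if there is no such $\alpha$, and $\beta(x,\Omega)=\inf\{\beta<\infty: x\text{ is }\beta\text{-convex}\}$, with $\beta(x,\Omega)=\infty$ if there is no such $\beta$. *)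

(* Defs.v *)
From HB Require Import structures.
From mathcomp Require Import all_boot all_order all_algebra.
From mathcomp Require Import all_classical all_reals all_analysis.

Set Implicit Arguments.
Unset Strict Implicit.
Unset Printing Implicit Defensive.

Import Order.TTheory GRing.Theory Num.Theory.
Import numFieldNormedType.Exports.

Local Open Scope classical_set_scope.
Local Open Scope ring_scope.
Local Open Scope quotient_scope.

(* P(R^d) is the topological quotient of R^d \ {0}, with R^d the space of
   column vectors, so that matrices act on the left. *)
Section ProjectiveSpace.
Context (R : realType) (d : nat).

Definition nzvec : Type :=
  initial_topology (val : {v : 'cV[R]_d | v != 0} -> 'cV[R]_d).
HB.instance Definition _ := Topological.on nzvec.

Definition nzval (v : nzvec) : 'cV[R]_d := sval v.

Definition same_line (v w : nzvec) : bool :=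
  `[< exists2 a : R, a != 0 & nzval w = a *: nzval v >].

Lemma same_line_refl : reflexive same_line.
Proof. by move=> v; apply/asboolP; exists 1; rewrite ?oner_neq0 ?scale1r. Qed.

Lemma same_line_sym : symmetric same_line.
Proof.
suff imp v w : same_line v w -> same_line w v.
  by move=> v w; apply/idP/idP; apply: imp.
move=> /asboolP[a a0 e]; apply/asboolP; exists a^-1; first by rewrite invr_eq0.
by rewrite e scalerA mulVf// scale1r.
Qed.

Lemma same_line_trans : transitive same_line.
Proof.
move=> w v u /asboolP[a a0 ea] /asboolP[b b0 eb]; apply/asboolP.
by exists (b * a); [rewrite mulf_neq0 | rewrite eb ea scalerA].
Qed.

Canonical same_line_equiv :=
  EquivRel same_line same_line_refl same_line_sym same_line_trans.

Definition projspace : Type := quotient_topology {eq_quot same_line_equiv}.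
HB.instance Definition _ :=
  Topological.copy projspace (quotient_topology {eq_quot same_line_equiv}).

Definition pclass (v : nzvec) : projspace := \pi_{eq_quot same_line_equiv} v.

Definition homog (x : projspace) : 'cV[R]_d :=
  nzval (repr (x : {eq_quot same_line_equiv})).

(* The default value of insubd is only reached when g kills the line x. *)
Definition pact (g : 'M[R]_d) (x : projspace) : projspace :=
  pclass (insubd (repr (x : {eq_quot same_line_equiv}))
                 (g *m homog x)).

End ProjectiveSpace.

Section ConvexProjectiveGeometry.
Context (R : realType) (d : nat).
Local Notation P := (projspace R d).
Implicit Types (Omega H : set P) (f : 'rV[R]_d) (g : 'M[R]_d).
Implicit Types (x y p q : P).

Definition enorm (v : 'cV[R]_d) : R := Num.sqrt (\sum_i v i 0 ^+ 2).

(* The affine chart of a linear form f is the complement of the projective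
   hyperplane f = 0; it is identified with the affine space of the vectors
   on which f takes the value 1. *)
Definition linval f x : R := (f *m homog x) 0 0.
Definition chart f : set P := [set x | linval f x != 0].
Definition affpt f x : 'cV[R]_d := (linval f x)^-1 *: homog x.

Definition bdry Omega : set P := closure Omega `\` interior Omega.

Definition properly_convex Omega : Prop :=
  [/\ Omega !=set0, open Omega &
    exists f : 'rV[R]_d,
      [/\ closure Omega `<=` chart f,
          convex_set (affpt f @` Omega),
          convex_set (affpt f @` closure Omega) &
          exists K : R, forall x, closure Omega x -> enorm (affpt f x) <= K]].

(* Elements of PGL(d,R) are handled through their lifts to GL(d,R). *)
Definition proj_aut Omega g : Prop := g \in unitmx /\ pact g @` Omega = Omega.

(* The cross-ratio does not depend on the chart f, so that the set below is a
   singleton when x <> y are in a properly convex domain. The conditions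
   s < 0 and 1 < t say that a, x, y, b are in this order on the line xy. *)
Definition hilbert Omega x y : R :=
  if x == y then 0 else
  xget 0 [set r : R | exists (f : 'rV[R]_d) (a b : P) (s t : R),
    let A := affpt f a in let B := affpt f b in
    let X := affpt f x in let Y := affpt f y in
    [/\ closure Omega `<=` chart f, bdry Omega a /\ bdry Omega b,
        s < 0 /\ A = X + s *: (Y - X),
        1 < t /\ B = X + t *: (Y - X) &
        r = 2^-1 * ln ((enorm (A - Y) * enorm (B - X)) /
                       (enorm (A - X) * enorm (B - Y)))]].

Definition geodesic_ray Omega (c : R -> P) : Prop :=
  (forall t, 0 <= t -> Omega (c t)) /\
  (forall s t, 0 <= s -> 0 <= t -> hilbert Omega (c s) (c t) = `|s - t|).

Definition ray_image (c : R -> P) : set P := c @` [set t | 0 <= t].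

Definition segment_co f p q : set P :=
  [set x | chart f x /\ exists t : R, [/\ 0 <= t, t < 1 &
     affpt f x = (1 - t) *: affpt f p + t *: affpt f q]].

(* c is a projective geodesic ray with c(oo) = q *)
Definition projective_geodesic_ray Omega (c : R -> P) q : Prop :=
  [/\ geodesic_ray Omega c, bdry Omega q &
    exists (p : P) (f : 'rV[R]_d),
      [/\ Omega p, closure Omega `<=` chart f &
          ray_image c = segment_co f p q]].

Definition tracks Omega (r : R) x (gamma : nat -> 'M[R]_d) (c : R -> P) :=
  forall n : nat, hilbert Omega x (pact (invmx (gamma n)) (c n%:R)) < r.

Definition morse_gauge (M : R -> R -> R) : Prop :=
  forall l a, 0 <= l -> 0 <= a -> 0 <= M l a.

(* a (l, k)-quasi-geodesic of (Omega, hilbert Omega) defined on [s, t] *)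
Definition quasi_geodesic Omega (l k s t : R) (z : R -> P) : Prop :=
  forall u v, s <= u <= t -> s <= v <= t ->
  [/\ Omega (z u), l^-1 * `|u - v| - k <= hilbert Omega (z u) (z v) &
      hilbert Omega (z u) (z v) <= l * `|u - v| + k].

Definition morse Omega (M : R -> R -> R) (ell : set P) : Prop :=
  forall (l k s t : R) (z : R -> P), 1 <= l -> 0 <= k -> s <= t ->
    quasi_geodesic Omega l k s t z -> ell (z s) -> ell (z t) ->
  forall u, s <= u <= t -> exists2 x, ell x & hilbert Omega (z u) x <= M l k.

(* The singular values of g, in nonincreasing order: the square roots of the
   eigenvalues, with multiplicities, of g^T g. *)
Definition singular_values g : seq R :=
  xget [::] [set s : seq R |
    [/\ sorted (fun a b => b <= a) s, all (fun a => 0 <= a) s &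
        char_poly (g^T *m g) = \prod_(a <- s) ('X - (a ^+ 2)%:P)]].

(* i and j are counted from 1 *)
Definition sigma (i : nat) g : R := nth 0 (singular_values g) i.-1.
Definition mu (i j : nat) g : R := ln (sigma i g / sigma j g).

Definition equot (a b : R) : \bar R :=
  if (b == 0) && (0 < a) then +oo%E else (a / b)%:E.

Definition hyperplane H : Prop :=
  exists2 h : 'rV[R]_d, h != 0 & H = [set x | linval h x = 0].

Definition supporting Omega H : Prop :=
  [/\ hyperplane H, H `&` closure Omega !=set0 & H `&` Omega = set0].

Definition C1_point Omega x : Prop :=
  bdry Omega x /\ exists! H : set P, supporting Omega H /\ H x.

(* Every Euclidean distance on the chart of f is of the form edist f g with g
   invertible: it comes from an inner product on the kernel of f, which extends
   to R^d. *)
Definition edist f g x y : R := enorm (g *m (affpt f x - affpt f y)).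
Definition edist_to f g y H : R :=
  inf [set edist f g y z | z in H `&` chart f].

Definition euclidean_chart Omega f g : Prop :=
  closure Omega `<=` chart f /\ g \in unitmx.

Definition C_point f g Omega (alpha : R) x : Prop :=
  bdry Omega x /\
  exists (U : set P) (K : R), [/\ nbhs x U, 0 < K &
    forall H y, supporting Omega H -> H x -> U y -> bdry Omega y ->
      edist_to f g y H <= K * edist f g y x `^ alpha].

Definition convex_point f g Omega (beta : R) x : Prop :=
  C1_point Omega x /\
  exists (U : set P) (K : R), [/\ nbhs x U, 0 < K &
    forall H y, supporting Omega H -> H x -> U y -> bdry Omega y ->
      K * edist f g y x `^ beta <= edist_to f g y H].

Definition alpha_exp f g Omega x : \bar R :=
  let A := [set alpha : R | 1 < alpha /\ C_point f g Omega alpha x] in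
  if `[< A !=set0 >] then ereal_sup [set a%:E | a in A] else 1%E.

(* the infimum of the empty set is +oo *)
Definition beta_exp f g Omega x : \bar R :=
  ereal_inf [set b%:E | b in [set beta : R | convex_point f g Omega beta x]].

End ConvexProjectiveGeometry.

(* Main.v *)
(** Lift Omega to an open convex cone C, and let e1, e2 lift the end point q of
    the ray and the opposite end point of its line, so that the ray is
    e1 + s e2 with s -> 0. Let a and b be supporting forms at e2 and e1, and
    let Omega_s be the slice of the w in ker a /\ ker b with e1 + w + s e2 in C.
    Then q is a C^alpha point iff Omega_s contains a ball of radius of order
    s^(1/alpha), and is beta-convex iff Omega_s lies in a ball of radius of
    order s^(1/beta).

    If e1 + w + s e2 is not too close to the boundary of C, the path which goes
    straight from the ray to that point inside the slice and then straight back
    to the ray at a smaller height is a (5, 1)-quasi-geodesic, so the point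
    stays at distance M 5 1 from the ray. It follows that Omega_s is uniformly
    round around 0, and that (1 + eps)/2 Omega_s lies in Omega_(s/2) and
    (1 + eps) Omega_s in Omega_(2s), with eps depending on M only. Iterating,
    alpha = ln 2 / (ln 2 - ln (1 + eps)) and beta = ln 2 / ln (1 + eps) work.

    By tracking, gamma_n maps the unit ball, up to scaling and to a bounded
    distortion, to the symmetric convex body (C - P) /\ (P - C) where
    P = e1 + s_n e2 and s_n is a constant times exp(-2n). The Courant-Fischer
    principle then shows that, up to bounded factors, s_n, the inner radius
    and the outer radius of Omega_(s_n) are exp(-mu_(1,d)), exp(-mu_(1,d-1))
    and exp(-mu_(1,2)). Hence alpha(q) and beta(q) are the two limits. *)
Require Import Defs.
From HB Require Import structures.
From mathcomp Require Import all_boot all_order all_algebra.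
From mathcomp Require Import all_classical all_reals all_analysis.
From mathcomp Require Import spectral complex.
From mathcomp Require Import ring lra.

Set Implicit Arguments.
Unset Strict Implicit.
Unset Printing Implicit Defensive.

Import Order.TTheory GRing.Theory Num.Theory.
Import numFieldNormedType.Exports.

Local Open Scope classical_set_scope.
Local Open Scope ring_scope.

(** * Open convex cones *)

(** Distances are bounded above by exhibiting vectors [X - k *: Y] and [Y - l *: X] of the closed
    cone, and below by cross ratios of two positive linear forms. This duality turns a bounded
    distance to the axis into a statement about slices. If an expected point is missing from a
    slice, a form [F] separates it from the cone. At an auxiliary point [P] the values of [F] are
    then out of proportion with those on the axis, and [F] paired with [a] or [b] puts [P] farther
    than [M 5 1] from every point of the axis, unless the missing point is there after all. The
    number 20 in [dl / 20] only leaves room for the losses of this argument. Contraction and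
    expansion of the slices are one statement, because a frame is symmetric in its two end points.
    Slices in the common kernel of [a] and [b], rather than the boundary as a graph, make it
    possible to start without a unique supporting hyperplane at the end point: its uniqueness is a
    consequence of the lower bound on the slices. *)

Ltac vec_ring := apply/colP => ?; rewrite !mxE; ring.
Ltac vec_field := apply/colP => ?; rewrite !mxE; field.

Lemma ge0_lim (R : realType) (a b : R) :
  (forall e, 0 < e -> 0 <= a + e * b) -> 0 <= a.
Proof.
move=> h; rewrite leNgt; apply/negP => a0.
have b1 : 0 < 2 * (`|b| + 1) by rewrite mulr_gt0// ltr_wpDl.
pose e := - a / (2 * (`|b| + 1)).
have e0 : 0 < e by rewrite divr_gt0// oppr_gt0.
have ea : e * (2 * (`|b| + 1)) = - a by rewrite divfK ?gt_eqF.
have eb : e * b <= e * `|b| by rewrite ler_wpM2l ?ler_norm// ltW.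
by have := h _ e0; lra.
Qed.

Section Cone.
Context {R : realType} {d : nat}.
Local Notation V := 'cV[R]_d.
Implicit Types (C : set V) (f F : 'rV[R]_d) (u v w x y : V).

Definition ev f v : R := (f *m v) 0 0.

Lemma evD f v w : ev f (v + w) = ev f v + ev f w.
Proof. by rewrite /ev mulmxDr mxE. Qed.
Lemma evZ f k v : ev f (k *: v) = k * ev f v.
Proof. by rewrite /ev -scalemxAr mxE. Qed.
Lemma evN f v : ev f (- v) = - ev f v.
Proof. by rewrite -scaleN1r evZ mulN1r. Qed.
Lemma evB f v w : ev f (v - w) = ev f v - ev f w.
Proof. by rewrite evD evN. Qed.
Lemma ev0 f : ev f 0 = 0.
Proof. by rewrite /ev mulmx0 mxE. Qed.
Lemma evDl f F v : ev (f + F) v = ev f v + ev F v.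
Proof. by rewrite /ev mulmxDl mxE. Qed.
Lemma evZl k f v : ev (k *: f) v = k * ev f v.
Proof. by rewrite /ev -scalemxAl mxE. Qed.

Definition evE := (evD, evN, evZ, ev0).

(** [oc_bnd] says that the section [ev f = 1] is bounded, which makes the closed cone salient
    ([clo_anti]). The norm here is the sup norm. *)
Record open_cone C f : Prop := OpenCone {
  oc_add : forall x y, C x -> C y -> C (x + y);
  oc_scale : forall k x, 0 < k -> C x -> C (k *: x);
  oc_open : forall x, C x -> exists2 e, 0 < e & forall u, `|u| < e -> C (x + u);
  oc_inh : exists x, C x;
  oc_pos : forall x, C x -> 0 < ev f x;
  oc_bnd : exists2 K, 0 < K & forall x, C x -> `|x| <= K * ev f x }.

(* This is the closure of C when C is an open convex cone. *)
Definition clo C : set V := [set v | forall x, C x -> C (v + x)].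

Section Theory.
Context {C : set V} {f0 : 'rV[R]_d} (hC : open_cone C f0).

Lemma ocN0 : ~ C 0.
Proof. by move=> /(oc_pos hC); rewrite ev0 ltxx. Qed.

Lemma oc_move x u : C x -> exists2 t, 0 < t & forall s, `|s| <= t -> C (x + s *: u).
Proof.
move=> /(oc_open hC)[e e0 he]; have u1 : 0 < `|u| + 1 by rewrite ltr_wpDl.
exists (e / 2 / (`|u| + 1)); first by rewrite !divr_gt0.
move=> s; rewrite ler_pdivlMr// => hs; apply: he; rewrite normrZ.
apply: (@le_lt_trans _ _ (`|s| * (`|u| + 1))); first by rewrite ler_wpM2l// lerDl.
by rewrite (le_lt_trans hs)// ltr_pdivrMr// ltr_pMr// ltr1n.
Qed.

Lemma clo_oc x : C x -> clo C x.
Proof. by move=> Cx y; exact: (oc_add hC). Qed.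

Lemma clo0 : clo C 0.
Proof. by move=> x; rewrite add0r. Qed.

Lemma cloD u v : clo C u -> clo C v -> clo C (u + v).
Proof. by move=> hu hv x Cx; rewrite -addrA; apply/hu/hv. Qed.

Lemma cloZ k u : 0 <= k -> clo C u -> clo C (k *: u).
Proof.
rewrite le_eqVlt => /predU1P[<- _|k0 hu x Cx]; first by rewrite scale0r; exact: clo0.
rewrite (_ : _ + x = k *: (u + k^-1 *: x)); last first.
  by rewrite scalerDr scalerA mulfV ?scale1r// gt_eqF.
by apply: (oc_scale hC) => //; apply: hu; apply: (oc_scale hC) => //; rewrite invr_gt0.
Qed.

Lemma cloZ_inv k u : 0 < k -> clo C (k *: u) -> clo C u.
Proof.
move=> k0 /(cloZ (k := k^-1)); rewrite scalerA mulVf ?gt_eqF// scale1r.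
by apply; rewrite invr_ge0 ltW.
Qed.

Lemma ocZ_inv k u : 0 < k -> C (k *: u) -> C u.
Proof.
move=> k0 /(oc_scale hC (k := k^-1)); rewrite scalerA mulVf ?gt_eqF// scale1r.
by apply; rewrite invr_gt0.
Qed.

Lemma clo_comb k l u v : clo C u -> clo C v -> 0 <= k -> 0 <= l ->
  clo C (k *: u + l *: v).
Proof. by move=> hu hv k0 l0; apply: cloD; apply: cloZ. Qed.

Lemma oc_comb k l u v : C u -> clo C v -> 0 < k -> 0 <= l -> C (k *: u + l *: v).
Proof.
by move=> hu hv k0 l0; rewrite addrC; apply: (cloZ l0 hv); apply: (oc_scale hC).
Qed.

(** An interior point [y] absorbs the error: [y - t *: x] is still in [C], and adding it to
    [u + t *: x] gives [u + y]. *)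
Lemma clo_closed u x : C x -> (forall e, 0 < e -> clo C (u + e *: x)) -> clo C u.
Proof.
move=> Cx h y Cy; have [t t0 ht] := oc_move (- x) Cy.
have tt : `|t| <= t by rewrite ger0_norm// ltW.
have := h _ t0 _ (ht t tt); congr C.
by apply/colP=> i; rewrite !mxE; ring.
Qed.

Lemma clo_ge0 F u : (forall x, C x -> 0 <= ev F x) -> clo C u -> 0 <= ev F u.
Proof.
move=> hF hu; have [x Cx] := oc_inh hC.
apply: (@ge0_lim _ _ (ev F x)) => e e0; rewrite -evZ -evD; apply: hF.
by apply: hu; apply: (oc_scale hC).
Qed.

Lemma clo_f0 u : clo C u -> 0 <= ev f0 u.
Proof. by apply: clo_ge0 => x /(oc_pos hC)/ltW. Qed.

Lemma clo_bnd : exists2 K, 0 < K & forall u, clo C u -> `|u| <= K * ev f0 u.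
Proof.
have [K K0 hK] := oc_bnd hC; exists K => // u hu; have [x Cx] := oc_inh hC.
rewrite -subr_ge0; apply: (@ge0_lim _ _ (K * ev f0 x + `|x|)) => e e0.
have := hK _ (hu _ (oc_scale hC e0 Cx)); rewrite evD evZ.
have : `|u| <= `|u + e *: x| + e * `|x|.
  rewrite -[e in e * _]gtr0_norm// -normrZ -[X in `|X| <= _](addrK (e *: x)).
  by rewrite (le_trans (ler_normB _ _)).
by nra.
Qed.

Lemma clo_eq0 u : clo C u -> ev f0 u <= 0 -> u = 0.
Proof.
move=> hu u0; have [K K0 /(_ _ hu) hK] := clo_bnd.
by apply/normr0_eq0/eqP; rewrite eq_le normr_ge0 andbT (le_trans hK)// pmulr_rle0.
Qed.

Lemma clo_pos u : clo C u -> u != 0 -> 0 < ev f0 u.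
Proof. move=> hu u0; rewrite ltNge; apply/negP => /(clo_eq0 hu) uE.
by rewrite uE eqxx in u0. Qed.

Lemma clo_anti u : clo C u -> clo C (- u) -> u = 0.
Proof.
by move=> hu hN; apply: clo_eq0 => //; have := clo_f0 hN; rewrite evN oppr_ge0.
Qed.

Lemma oc_neq0 u : C u -> u != 0.
Proof. by apply: contraPneq => ->; exact: ocN0. Qed.

Lemma oc_gt0 F : F != 0 -> (forall x, C x -> 0 <= ev F x) -> forall x, C x -> 0 < ev F x.
Proof.
move=> F0 hF x Cx; rewrite lt_def hF// andbT; apply/eqP => Fx0.
(* [F^T] is a direction along which [F] increases strictly, its value there being a sum of squares.
   A small step backwards from a zero of [F] would make [F] negative. *)
have [t t0 ht] := oc_move (F^T) Cx.
have tt : `|- t| <= t by rewrite normrN ger0_norm// ltW.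
have := hF _ (ht _ tt); rewrite evD Fx0 evZ add0r mulNr oppr_ge0 pmulr_rle0//.
rewrite /ev mxE leNgt => /negP; apply.
under eq_bigr do rewrite mxE -expr2.
rewrite lt_def sumr_ge0 ?andbT; last by move=> i _; rewrite sqr_ge0.
apply: contra F0; rewrite psumr_eq0 => [|i _]; last by rewrite sqr_ge0.
move=> /allP h; apply/eqP/rowP => i; rewrite mxE.
by have := h i (mem_index_enum _); rewrite /= sqrf_eq0 => /eqP.
Qed.

(** The exit time is the supremum of the times spent in [C]. It is finite: otherwise
    [x + e^-1 *: u], scaled by [e], puts [u + e *: x] in the closed cone for every [e > 0], hence
    also [u]. *)
Lemma oc_exit x u : C x -> ~ clo C u ->
  exists t, [/\ 0 < t, clo C (x + t *: u), ~ C (x + t *: u) &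
    forall s, 0 <= s -> s < t -> C (x + s *: u)].
Proof.
move=> Cx nu.
pose A := [set t : R | 0 <= t /\ C (x + t *: u)].
have A0 : A 0 by split => //; rewrite scale0r addr0.
have Aint s t : A t -> 0 <= s -> s <= t -> C (x + s *: u).
  move=> [t0 Ct] s0 st; have [->|sn0] := eqVneq s 0; first by case: A0.
  have tp : 0 < t by rewrite (lt_le_trans _ st)// lt_def sn0.
  rewrite (_ : _ + _ = (s / t) *: (x + t *: u) + (1 - s / t) *: x).
    apply: oc_comb => //; first exact: clo_oc.
      by rewrite divr_gt0// lt_def sn0.
    by rewrite subr_ge0 ler_pdivrMr// mul1r.
  by apply/colP=> i; rewrite !mxE; field; rewrite gt_eqF.
have ubA : has_ubound A.
  apply: contrapT => nb; apply: nu.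
  apply: (clo_closed Cx) => e e0.
  have [t [[t0 Ct] te]] : exists t, A t /\ e^-1 < t.
    apply: contrapT => h; apply: nb; exists e^-1 => t At.
    by rewrite leNgt; apply/negP => te; apply: h; exists t.
  rewrite (_ : _ + _ = e *: (x + e^-1 *: u)); last first.
    by apply/colP=> i; rewrite !mxE; field; rewrite gt_eqF.
  apply: cloZ; first exact: ltW.
  by apply/clo_oc/(Aint _ t) => //; [rewrite invr_ge0|]; exact: ltW.
have supA : has_sup A by split => //; exists 0.
pose t := sup A.
have lt_t s : 0 <= s -> s < t -> C (x + s *: u).
  move=> s0 st; have ts : 0 < t - s by rewrite subr_gt0.
  have [r Ar] := sup_adherent ts supA; rewrite -/t subKr => sr.
  by apply: (Aint _ r) => //; exact: ltW.
have t0 : 0 < t.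
  have [r r0 hr] := oc_move u Cx.
  by rewrite (lt_le_trans r0)//; apply: (ub_le_sup ubA); split; [exact: ltW|apply: hr; rewrite ger0_norm// ltW].
exists t; split => //.
- have [r r0 hr] := oc_move u Cx.
  apply: (clo_closed Cx) => e e0; have e1 : 0 < 1 + e by lra.
  rewrite (_ : _ + _ = (1 + e) *: (x + (t / (1 + e)) *: u)).
    apply: cloZ; first exact: ltW.
    apply: clo_oc; apply: lt_t; first by rewrite divr_ge0// ltW.
    by rewrite ltr_pdivrMr// ltr_pMr// ltrDl.
  by apply/colP=> i; rewrite !mxE; field; rewrite gt_eqF.
- move=> Ct; have [r r0 hr] := oc_move u Ct.
  have : t + r <= t.
    apply: (ub_le_sup ubA); split; first by rewrite addr_ge0// ltW.
    by rewrite scalerDl addrA; apply: hr; rewrite ger0_norm// ltW.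
  by rewrite gerDl leNgt r0.
Qed.

(** A negative [k] is cancelled by adding [- k] times [E1 + E2], which puts a multiple of [E2] in
    [C]; no sign of that multiple is possible. So the closed cone meets the plane of two boundary
    vectors exactly in their quadrant, which is why the Hilbert metric has the best comparison
    constants. *)
Lemma clo_span E1 E2 k l : clo C E1 -> clo C E2 -> ~ C E1 -> ~ C E2 -> C (E1 + E2) ->
  clo C (k *: E1 + l *: E2) -> 0 <= k.
Proof.
move=> c1 c2 n1 n2 C12 hc; rewrite leNgt; apply/negP => k0.
have : C ((l - k) *: E2).
  have := hc _ (oc_scale hC (_ : 0 < - k) C12); rewrite oppr_gt0 => /(_ k0).
  by congr C; apply/colP=> i; rewrite !mxE; ring.
have [lk|lk|->] := ltgtP l k; last by rewrite subrr scale0r; exact: ocN0.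
- move=> h; apply: ocN0.
  have : C ((k - l) *: E2 + (l - k) *: E2) by apply: cloZ h; rewrite // subr_ge0 ltW.
  by rewrite -scalerDl addrC addrA subrK subrr scale0r.
- by move=> /ocZ_inv h; apply/n2/h; rewrite subr_gt0.
Qed.

Lemma clo_spanP E1 E2 k l : clo C E1 -> clo C E2 -> ~ C E1 -> ~ C E2 -> C (E1 + E2) ->
  clo C (k *: E1 + l *: E2) -> 0 <= k /\ 0 <= l.
Proof.
move=> c1 c2 n1 n2 C12 hc; split; first exact: clo_span hc.
by apply: (@clo_span E2 E1 l k) => //; rewrite addrC.
Qed.

End Theory.
End Cone.

(** * Separating a point from an open convex cone by a linear form *)

Section Separation.
Context {R : realType} {d : nat}.
Local Notation V := 'cV[R]_d.
Context {C : set V} {f0 : 'rV[R]_d} (hC : open_cone C f0).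

Lemma mx_annihilator (E : 'M[R]_d) (y : V) : ~~ (y^T <= E)%MS ->
  exists2 G : 'rV[R]_d, ev G y = 1 & forall e : V, (e^T <= E)%MS -> ev G e = 0.
Proof.
rewrite submxE => /rV0Pn[j hj].
have colE (e : V) : ev (col j (cokermx E))^T e = (e^T *m cokermx E) 0 j.
  by rewrite /ev !mxE; apply: eq_bigr => i _; rewrite !mxE mulrC.
exists (((y^T *m cokermx E) 0 j)^-1 *: (col j (cokermx E))^T).
  by rewrite evZl colE mulVf.
by move=> e; rewrite submxE evZl colE => /eqP ->; rewrite [X in _ * X]mxE mulr0.
Qed.

(* The one-step extension argument of M. Riesz, for the cone spanned by C and
   the direction -v. *)
Lemma oc_separation (v : V) : ~ C v ->
  exists2 F : 'rV[R]_d, (forall x, C x -> 0 < ev F x) & ev F v <= 0.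
Proof.
move=> nv; have [x0 Cx0] := oc_inh hC.
pose K (x : V) := exists2 t, 0 <= t & C (x + t *: v).
have KC x : C x -> K x by move=> Cx; exists 0; rewrite ?scale0r ?addr0.
have KD x y : K x -> K y -> K (x + y).
  move=> [s s0 hs] [t t0 ht]; exists (s + t); first exact: addr_ge0.
  by rewrite scalerDl addrACA; apply: (oc_add hC).
have KZ k x : 0 < k -> K x -> K (k *: x).
  move=> k0 [s s0 hs]; exists (k * s); first by rewrite mulr_ge0// ltW.
  by rewrite -scalerA -scalerDr; apply: (oc_scale hC).
have KN0 : ~ K 0.
  move=> [t]; rewrite add0r le_eqVlt => /predU1P[<-|t0].
    by rewrite scale0r => /(ocN0 hC).
  by move/(ocZ_inv hC t0).
pose good (E : 'M[R]_d) (F : 'rV[R]_d) := [/\ (x0^T <= E)%MS, ev F x0 = 1 &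
   forall e : V, (e^T <= E)%MS -> K e -> 0 <= ev F e].
have step E F : good E F -> (\rank E < d)%N ->
    exists E' F', good E' F' /\ (\rank E < \rank E')%N.
  move=> [xE Fx hF] rE.
  have [y yE] : exists y : V, ~~ (y^T <= E)%MS.
    have : ~~ (1%:M <= E)%MS.
      by rewrite sub1mx /row_full neq_ltn rE.
    move=> /row_subPn[i hi]; exists (row i 1%:M)^T; by rewrite trmxK.
  have [G Gy GE] := mx_annihilator yE.
  (* The value of the extended form at [y] must be above every [- ev F e] with [y + e] in [K] and
     below every [ev F e'] with [e' - y] in [K]. By [AB] the former are at most the latter, so the
     supremum [c] of the former is a possible value. *)
  pose A := [set - ev F e | e in [set e : V | (e^T <= E)%MS /\ K (y + e)]].
  have AB e' : (e'^T <= E)%MS -> K (e' - y) -> ubound A (ev F e').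
    move=> e'E Ke' _ [e [eE Ke] <-]; rewrite -subr_ge0 opprK -evD.
    apply: hF; first by rewrite linearD addmx_sub.
    by have := KD _ _ Ke' Ke; rewrite addrA subrK.
  have [t t0 ht] := oc_move hC y Cx0.
  have tx (s : R) : (((s *: x0)^T : 'rV_d) <= E)%MS by rewrite linearZ scalemx_sub.
  have A0 : A !=set0.
    exists (- ev F (t^-1 *: x0)), (t^-1 *: x0) => //; split => //.
    have -> : y + t^-1 *: x0 = t^-1 *: (x0 + t *: y).
      by rewrite scalerDr scalerA mulVf ?gt_eqF// scale1r addrC.
    by apply: KZ; rewrite ?invr_gt0//; apply/KC/ht; rewrite ger0_norm// ltW.
  have ubA : has_ubound A.
    exists (ev F (t^-1 *: x0)); apply: AB => //.
    have -> : t^-1 *: x0 - y = t^-1 *: (x0 + (- t) *: y).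
      by rewrite scalerDr scalerA mulrN mulVf ?gt_eqF// scaleN1r.
    by apply: KZ; rewrite ?invr_gt0//; apply/KC/ht; rewrite normrN ger0_norm// ltW.
  pose c := sup A.
  exists (E + y^T)%MS, (F + (c - ev F y) *: G); split; last first.
    rewrite ltn_neqAle mxrankS ?addsmxSl// andbT.
    apply: contra yE => /eqP rk.
    have [_] := mxrank_leqif_eq (addsmxSl E y^T).
    rewrite rk eqxx => /esym/andP[_ h].
    by apply: submx_trans h; apply: addsmxSr.
  split.
  - by apply: submx_trans xE _; apply: addsmxSl.
  - by rewrite evDl evZl GE// mulr0 addr0.
  move=> e /sub_addsmxP[[u w]] /= ew Ke.
  pose e1 := (u *m E)^T; pose s := w 0 0.
  have e1E : (e1^T <= E)%MS by rewrite trmxK submxMl.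
  have eE : e = e1 + s *: y.
    rewrite -[e]trmxK ew linearD /=; congr (_ + _).
    by rewrite [w]mx11_scalar mul_scalar_mx linearZ /= trmxK.
  rewrite evDl evZl eE !evD !evZ Gy GE// add0r mulr1.
  suff : 0 <= ev F e1 + s * c by congr (0 <= _); ring.
  have [s0|s0|s0] := ltgtP s 0.
  - have s1 : 0 < (- s)^-1 by rewrite invr_gt0 oppr_gt0.
    have : c <= ev F ((- s)^-1 *: e1).
      apply: ge_sup => //; apply: AB; first by rewrite linearZ scalemx_sub.
      have -> : (- s)^-1 *: e1 - y = (- s)^-1 *: e.
        by rewrite eE scalerDr scalerA invrN mulNr mulVf ?lt_eqF// scaleN1r.
      exact: KZ.
    by rewrite evZ mulrC ler_pdivlMr ?oppr_gt0// => h; nra.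
  - have : - ev F (s^-1 *: e1) <= c.
      apply: (ub_le_sup ubA); exists (s^-1 *: e1) => //; split.
        by rewrite linearZ scalemx_sub.
      have -> : y + s^-1 *: e1 = s^-1 *: e.
        by rewrite eE scalerDr scalerA mulVf ?gt_eqF// scale1r addrC.
      by apply: KZ => //; rewrite invr_gt0.
    rewrite evZ => h; have := ler_wpM2l (ltW s0) h.
    by rewrite mulrN mulrA mulfV ?gt_eqF// mul1r => {}h; lra.
  - rewrite s0 mul0r addr0; apply: hF => //.
    by move: Ke; rewrite eE s0 scale0r addr0.
have [F0 F0x] : exists F0 : 'rV[R]_d, ev F0 x0 = 1.
  have : x0^T != 0 by rewrite trmx_eq0 (oc_neq0 hC).
  by rewrite -submx0 => /mx_annihilator[G Gx _]; exists G.
have base : good <<x0^T>>%MS F0.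
  split => //; first by rewrite genmxE.
  move=> e; rewrite genmxE => /submxP[w ew] Ke; rewrite leNgt; apply/negP => Fe.
  have eE : e = w 0 0 *: x0.
    by rewrite -[e]trmxK ew [w]mx11_scalar mul_scalar_mx linearZ /= trmxK mxE.
  have w0 : w 0 0 < 0 by move: Fe; rewrite eE evZ F0x mulr1.
  apply: KN0; have -> : 0 = e + (- w 0 0) *: x0 by rewrite eE scaleNr subrr.
  by apply: KD => //; apply: KZ; [rewrite oppr_gt0|apply: KC].
have all n : (n <= d)%N -> exists E F, good E F /\ (n <= \rank E)%N.
  elim: n => [_|n IH nd]; first by exists <<x0^T>>%MS, F0; split.
  have [E [F [gE]]] := IH (ltnW nd); rewrite leq_eqVlt => /predU1P[rE|rE].
    have [E' [F' [gE' rE']]] := step _ _ gE (leq_trans (eq_leq (esym (congr1 S rE))) nd).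
    by exists E', F'; split => //; rewrite rE.
  by exists E, F.
have [E [F [[xE Fx hF] rE]]] := all d (leqnn d).
have full (e : V) : (e^T <= E)%MS.
  by apply: submx_full; rewrite /row_full eqn_leq rank_leq_col.
have FK e : K e -> 0 <= ev F e by apply: hF.
exists F.
  apply: (oc_gt0 hC) => [|x /KC/FK//].
  by apply/eqP => F0E; move: Fx; rewrite F0E /ev mul0mx mxE => /eqP; rewrite eq_sym oner_eq0.
(* [- v + e *: x0] is in [K], because adding [1 *: v] leaves [e *: x0]. Letting [e] tend to 0 gives
   the sign of [F] at [v]. *)
rewrite -oppr_ge0 -evN; apply: (@ge0_lim _ _ (ev F x0)) => e e0.
rewrite -evZ -evD; apply: FK; exists 1 => //.
rewrite scale1r addrAC addNr add0r; exact: (oc_scale hC).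
Qed.

End Separation.

(** * The Hilbert metric on a cone *)

Section HilbertLike.
Context {R : realType} {d : nat}.
Local Notation V := 'cV[R]_d.

(* Birkhoff's description of the Hilbert metric of a convex cone, together
   with its straight geodesics u |-> E1 + exp (2 u) E2. *)
Record hilbert_like (C : set V) (D : V -> V -> R) : Prop := HilbertLike {
  hl_ge0 : forall X Y, C X -> C Y -> 0 <= D X Y;
  hl_le : forall X Y k l, C X -> C Y -> 0 < k -> 0 < l ->
    clo C (X - k *: Y) -> clo C (Y - l *: X) -> k * l <= expR (- (2 * D X Y));
  hl_line : forall X Y, C X -> C Y -> exists E1 E2 m, [/\ clo C E1, clo C E2,
    0 < m, X = E1 + E2 & Y = m *: (E1 + expR (2 * D X Y) *: E2)] }.

Context {C : set V} {f0 : 'rV[R]_d} (hC : open_cone C f0).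
Context {D : V -> V -> R} (hD : hilbert_like C D).

(** Sharpness of [hl_le]: the best constants are found on the line through [X] and [Y], where the
    two differences are multiples of the end points [E1] and [E2]. *)
Lemma hl_eq X Y : C X -> C Y -> exists k l, [/\ 0 < k, 0 < l,
  clo C (X - k *: Y), clo C (Y - l *: X) & k * l = expR (- (2 * D X Y))].
Proof.
move=> CX CY; have [E1 [E2 [m [c1 c2 m0 XE YE]]]] := hl_line hD CX CY.
have D0 := hl_ge0 hD CX CY; move: YE; set T := 2 * D X Y => YE.
have T0 : 0 <= T by rewrite mulr_ge0.
have eN : expR (- T) <= 1 by rewrite -expR0 ler_expR oppr_le0.
have e1 : 1 <= expR T by rewrite -expR0 ler_expR.
have eP := expR_gt0 T; have eE : expR (- T) = (expR T)^-1 by rewrite expRN.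
exists (m^-1 * expR (- T)), m; split => //.
- by rewrite mulr_gt0 ?invr_gt0 ?expR_gt0.
- rewrite (_ : _ - _ = (1 - expR (- T)) *: E1).
    by apply: (cloZ hC) => //; rewrite subr_ge0.
  by apply/colP => i; rewrite YE XE !mxE eE; field; rewrite !gt_eqF.
- rewrite (_ : _ - _ = (m * (expR T - 1)) *: E2).
    by apply: (cloZ hC) => //; rewrite mulr_ge0 ?subr_ge0// ltW.
  by apply/colP => i; rewrite YE XE !mxE; ring.
- by rewrite mulrAC mulVf ?mul1r// gt_eqF.
Qed.

Lemma hl_upper X Y k l e : C X -> C Y -> 0 < k -> 0 < l -> expR (- (2 * e)) <= k * l ->
  clo C (X - k *: Y) -> clo C (Y - l *: X) -> D X Y <= e.
Proof.
move=> CX CY k0 l0 h h1 h2.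
have := le_trans h (hl_le hD CX CY k0 l0 h1 h2).
by rewrite ler_expR lerN2 ler_pM2l.
Qed.

Lemma hl_sym X Y : C X -> C Y -> D X Y = D Y X.
Proof.
suff le A B : C A -> C B -> D A B <= D B A.
  by move=> CX CY; apply/eqP; rewrite eq_le !le.
move=> CA CB; have [k [l [k0 l0 h1 h2 kl]]] := hl_eq CB CA.
by apply: (@hl_upper _ _ l k) => //; rewrite -kl mulrC.
Qed.

(** Positive forms are monotone for the order of the closed cone, so they can be applied to the
    sharp comparisons of [hl_eq]. This is the lower estimate that matches [hl_upper]. *)
Lemma hl_lower X Y (F G : 'rV[R]_d) : C X -> C Y ->
  (forall x, C x -> 0 < ev F x) -> (forall x, C x -> 0 < ev G x) ->
  ev F X * ev G Y <= expR (2 * D X Y) * (ev F Y * ev G X).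
Proof.
move=> CX CY hF hG; have [k [l [k0 l0 h1 h2 kl]]] := hl_eq CY CX.
have Fp : 0 < ev F X := hF _ CX; have Gp := hG _ CY.
have F1 : 0 <= ev F Y - k * ev F X.
  by rewrite -evZ -evB; apply: (clo_ge0 hC) h1 => x /hF/ltW.
have G1 : 0 <= ev G X - l * ev G Y.
  by rewrite -evZ -evB; apply: (clo_ge0 hC) h2 => x /hG/ltW.
have h : (k * ev F X) * (l * ev G Y) <= ev F Y * ev G X.
  rewrite subr_ge0 in F1; rewrite subr_ge0 in G1.
  by apply: ler_pM => //; apply: mulr_ge0; exact: ltW.
rewrite mulrACA kl expRN (hl_sym CY CX) in h.
by rewrite -ler_pdivrMl ?expR_gt0.
Qed.

Lemma hl_triangle X Y Z : C X -> C Y -> C Z -> D X Z <= D X Y + D Y Z.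
Proof.
move=> CX CY CZ; have [k [l [k0 l0 h1 h2 kl]]] := hl_eq CX CY.
have [k' [l' [k0' l0' h1' h2' kl']]] := hl_eq CY CZ.
apply: (hl_upper (k := k * k') (l := l' * l)) => //; rewrite ?mulr_gt0//.
- have -> : k * k' * (l' * l) = (k * l) * (k' * l') by ring.
  by rewrite mulrDr opprD expRD -kl -kl'.
- rewrite (_ : _ - _ = (X - k *: Y) + k *: (Y - k' *: Z)).
    by apply: cloD => //; apply: (cloZ hC) => //; exact: ltW.
  by vec_ring.
- rewrite (_ : _ - _ = (Z - l' *: Y) + l' *: (Y - l *: X)).
    by apply: cloD => //; apply: (cloZ hC) => //; exact: ltW.
  by vec_ring.
Qed.

Lemma hl_scale X Y k : 0 < k -> C X -> C Y -> D X (k *: Y) = D X Y.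
Proof.
move=> k0 CX CY; have CkY := oc_scale hC k0 CY.
have DkY : D Y (k *: Y) <= 0.
  apply: (hl_upper (k := k^-1) (l := k)) => //; rewrite ?invr_gt0//.
  - by rewrite mulr0 oppr0 expR0 mulVf// gt_eqF.
  - by rewrite scalerA mulVf ?gt_eqF// scale1r subrr; exact: clo0.
  - by rewrite subrr; exact: clo0.
apply/eqP; rewrite eq_le; apply/andP; split.
  by apply: (le_trans (hl_triangle CX CY CkY)); rewrite gerDl.
by apply: (le_trans (hl_triangle CX CkY CY)); rewrite (hl_sym CkY)// gerDl.
Qed.

Lemma hl_geodesic X Y : C X -> C Y -> exists z : R -> V, [/\ z 0 = X,
  exists2 m, 0 < m & z (D X Y) = m *: Y,
  forall u, 0 <= u <= D X Y -> exists s t, [/\ 0 <= s, 0 <= t, 0 < s + t & z u = s *: X + t *: Y],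
  forall u, 0 <= u <= D X Y -> C (z u) &
  forall u v, 0 <= u <= D X Y -> 0 <= v <= D X Y -> D (z u) (z v) = `|u - v| ].
Proof.
move=> CX CY; have [E1 [E2 [m [c1 c2 m0 XE YE]]]] := hl_line hD CX CY.
have D0 := hl_ge0 hD CX CY; move: YE; set T := D X Y => YE.
pose z (u : R) := E1 + expR (2 * u) *: E2.
have zT : z T = m^-1 *: Y.
  by rewrite YE scalerA mulVf ?gt_eqF// scale1r.
have z0 : z 0 = X by rewrite /z mulr0 expR0 scale1r XE.
have comb u : 0 <= u <= T -> exists s t, [/\ 0 <= s, 0 <= t, 0 < s + t & z u = s *: X + t *: Y].
  move=> /andP[u0 uT]; have [T0|Tn0] := eqVneq T 0.
    exists 1, 0; rewrite addr0; split => //.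
    by rewrite scale1r scale0r addr0 -z0; congr z; apply/eqP; rewrite eq_le u0 -T0 uT.
  have eT : 1 < expR (2 * T).
    by rewrite -[ltLHS]expR0 ltr_expR mulr_gt0// lt_def Tn0.
  have eu : 1 <= expR (2 * u) by rewrite -[leLHS]expR0 ler_expR mulr_ge0.
  have euT : expR (2 * u) <= expR (2 * T) by rewrite ler_expR ler_pM2l.
  pose t := (expR (2 * u) - 1) / (expR (2 * T) - 1).
  have t0 : 0 <= t by rewrite divr_ge0// subr_ge0// ltW.
  have t1 : t <= 1 by rewrite ler_pdivrMr ?subr_gt0// mul1r lerB.
  exists (1 - t), (t * m^-1); split; rewrite ?subr_ge0//.
  - by rewrite mulr_ge0// invr_ge0 ltW.
  - have [->|tn] := eqVneq t 0; first by rewrite mul0r; lra.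
    by rewrite ltr_wpDl ?subr_ge0// mulr_gt0 ?invr_gt0// lt_def tn.
  - rewrite -scalerA -zT XE /z; apply/colP => i; rewrite !mxE.
    by rewrite /t; field; rewrite gt_eqF// subr_gt0.
have Cz u : 0 <= u <= T -> C (z u).
  move=> /comb[s [t [s0 t0 st ->]]]; move: s0; rewrite le_eqVlt => /predU1P[s0|s0].
    by rewrite -s0 scale0r add0r; apply: (oc_scale hC) => //; lra.
  by apply: (oc_comb hC) => //; exact: (clo_oc hC).
have Dle u v : 0 <= u -> u <= v -> v <= T -> D (z u) (z v) <= v - u.
  move=> u0 uv vT.
  have e1 : expR (2 * u) <= expR (2 * v) by rewrite ler_expR ler_pM2l.
  have ep := expR_gt0 (2 * u); have ev0 := expR_gt0 (2 * v).
  have eE : expR (- (2 * (v - u))) = expR (2 * u) / expR (2 * v).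
    by rewrite mulrBr opprB expRD expRN.
  apply: (hl_upper (k := expR (- (2 * (v - u)))) (l := 1)); rewrite ?mulr1 ?expR_gt0//.
  - by apply: Cz; rewrite u0 (le_trans uv).
  - by apply: Cz; rewrite vT (le_trans u0).
  - rewrite (_ : _ - _ = (1 - expR (2 * u) / expR (2 * v)) *: E1).
      by apply: (cloZ hC) => //; rewrite subr_ge0 ler_pdivrMr// mul1r.
    by rewrite eE /z; vec_field; rewrite gt_eqF.
  - rewrite (_ : _ - _ = (expR (2 * v) - expR (2 * u)) *: E2).
      by apply: (cloZ hC) => //; rewrite subr_ge0.
    by rewrite /z; vec_ring.
(* The upper bounds suffice: the pieces from 0 to [u], from [u] to [v] and from [v] to [T] have
   lengths at most [u], [v - u] and [T - v], and at least [T] in total. *)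
have Deq u v : 0 <= u -> u <= v -> v <= T -> D (z u) (z v) = v - u.
  move=> u0 uv vT; apply/eqP; rewrite eq_le Dle//=.
  have Cu : C (z u) by apply: Cz; rewrite u0 (le_trans uv).
  have Cv : C (z v) by apply: Cz; rewrite vT (le_trans u0).
  have CT : C (z T) by apply: Cz; rewrite D0 lexx.
  have XT : D X (z T) = T by rewrite zT hl_scale ?invr_gt0.
  have := hl_triangle CX Cu CT; have := hl_triangle Cu Cv CT; rewrite XT.
  have := Dle 0 u (lexx _) u0 (le_trans uv vT); rewrite z0.
  have := Dle v T (le_trans u0 uv) vT (lexx _).
  lra.
exists z; split => //; first by exists m^-1; rewrite ?invr_gt0.
move=> u v /andP[u0 uT] /andP[v0 vT]; have [uv|/ltW vu] := leP u v.
  by rewrite Deq// ler0_norm ?opprB// subr_le0.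
by rewrite hl_sym ?Deq ?ger0_norm ?subr_ge0//; apply: Cz; rewrite ?u0 ?v0.
Qed.

End HilbertLike.

(** * Slices along a Morse axis *)

Section Morse.
Context {R : realType} {d : nat}.
Local Notation V := 'cV[R]_d.

Definition cone_morse (C : set V) (D : V -> V -> R) (M : R -> R -> R) (ell : set V) :=
  forall (l k T : R) (z : R -> V), 1 <= l -> 0 <= k -> 0 <= T ->
  (forall u v, 0 <= u <= T -> 0 <= v <= T -> C (z u) /\
     l^-1 * `|u - v| - k <= D (z u) (z v) <= l * `|u - v| + k) ->
  ell (z 0) -> ell (z T) ->
  forall u, 0 <= u <= T -> exists2 x, ell x & D (z u) x <= M l k.

(* e1 and e2 lift the two endpoints of a projective line through C; a = 0 and
   b = 0 are supporting hyperplanes at e2 and e1. *)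
Record frame (C : set V) (e1 e2 : V) (a b : 'rV[R]_d) : Prop := Frame {
  fr1 : clo C e1; fr2 : clo C e2; fr12 : C (e1 + e2);
  fra : forall x, C x -> 0 < ev a x; frb : forall x, C x -> 0 < ev b x;
  fra1 : ev a e1 = 1; fra2 : ev a e2 = 0; frb1 : ev b e1 = 0; frb2 : ev b e2 = 1 }.

Lemma frame_sym C e1 e2 a b : frame C e1 e2 a b -> frame C e2 e1 b a.
Proof. by case=> *; split => //; rewrite addrC. Qed.

(** Only one inclusion is required: [ell] lies over the open line from [e1] to [e2]. Which heights
    [s] occur is a separate hypothesis each time, since a ray covers only part of the line. *)
Record axis (ell : set V) (e1 e2 : V) : Prop := Axis {
  ax_scale : forall k x, 0 < k -> ell x -> ell (k *: x);
  ax_line : forall x, ell x -> exists k s, [/\ 0 < k, 0 < s & x = k *: (e1 + s *: e2)] }.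

Lemma axis_sym ell e1 e2 : axis ell e1 e2 -> axis ell e2 e1.
Proof.
case=> h1 h2; split => // x /h2[k [s [k0 s0 ->]]].
exists (k * s), s^-1; rewrite mulr_gt0 ?invr_gt0//; split => //.
by vec_field; rewrite gt_eqF.
Qed.

Context {C : set V} {f0 : 'rV[R]_d} (hC : open_cone C f0).
Context {D : V -> V -> R} (hD : hilbert_like C D).
Context {M : R -> R -> R} {ell : set V} (hM : cone_morse C D M ell).

Lemma frame_axis e1 e2 a b s : frame C e1 e2 a b -> 0 < s -> C (e1 + s *: e2).
Proof.
move=> fr s0; have [h|h] := leP s 1.
  rewrite (_ : _ + _ = s *: (e1 + e2) + (1 - s) *: e1).
    by apply: (oc_comb hC) => //; [exact: (fr12 fr)|exact: (fr1 fr)|rewrite subr_ge0].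
  by vec_ring.
rewrite (_ : _ + _ = 1 *: (e1 + e2) + (s - 1) *: e2).
  by apply: (oc_comb hC) => //; [exact: (fr12 fr)|exact: (fr2 fr)|rewrite subr_ge0 ltW].
by vec_ring.
Qed.

(** By Cauchy-Schwarz [(x + y * q) ^+ 2] is at most [(x + y) * (x + y * q ^+ 2)]. The factor
    [expR (- 2)], which is at most 1/4, pays for the two factors 2 and becomes the additive 1 in the
    distance estimate of [morse_bent]. *)
Lemma bent_estimate (E x y q n : R) : 0 <= x -> 0 <= y -> 0 < q -> q <= 1 -> 0 <= E ->
  n = x + y -> 0 < n -> E * n <= x + y * q ->
  E ^+ 2 * expR (- 2) <= (2 * n)^-1 * (x + y * (q ^+ 2 / 2)).
Proof.
move=> x0 y0 q0 q1 E0 nE n0 h.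
have e2 : expR (- 2 : R) <= 4^-1.
  rewrite expRN lef_pV2 ?posrE ?expR_gt0//.
  have := expR_ge1Dx (1 : R); rewrite (_ : 2 = 1 + 1 :> R)// expRD; have := expR_gt0 (1 : R); nra.
have h2 : (E * n) ^+ 2 <= 2 * n * (x + y * (q ^+ 2 / 2)).
  have : (E * n) ^+ 2 <= (x + y * q) ^+ 2.
    by rewrite ler_sqr ?nnegrE// ?mulr_ge0 ?addr_ge0// ?mulr_ge0// ltW.
  move/le_trans; apply; rewrite nE.
  have : 0 <= x * y * ((q - 1) ^+ 2 + 1) by rewrite !mulr_ge0// addr_ge0// sqr_ge0.
  have : 0 <= x ^+ 2 by rewrite sqr_ge0.
  by nra.
rewrite ler_pdivlMl ?mulr_gt0//.
have h3 : E ^+ 2 * n <= 2 * (x + y * (q ^+ 2 / 2)).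
  rewrite -(ler_pM2r n0); apply: le_trans (le_trans h2 _); last by nra.
  by nra.
have p : 0 <= E ^+ 2 * n by rewrite mulr_ge0 ?sqr_ge0 ?(ltW n0).
have := ler_pM p (expR_ge0 _) h3 e2; lra.
Qed.

(* The Morse property is applied to the path A -> P -> B made of two straight
   segments, A and P having the same height (b / a) and B being lower.  The
   height controls the length of the second segment, which makes the path
   a (5, 1)-quasi-geodesic whatever the length of the first one. *)
Lemma morse_bent e1 e2 a b w s q : frame C e1 e2 a b -> axis ell e1 e2 ->
  ev a w = 0 -> ev b w = 0 -> 0 < s -> 0 < q -> q <= 1 ->
  ell (e1 + s *: e2) -> ell (e1 + (s * q) *: e2) -> C (e1 + w + s *: e2) ->
  clo C (e1 + 2 *: w + ((2 - q) * s) *: e2) -> clo C (e1 - q *: w + s *: e2) ->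
  exists2 t, 0 < t & D (e1 + w + s *: e2) (e1 + t *: e2) <= M 5 1.
Proof.
move=> fr ax aw bw s0 q0 q1 ellA ellB; set P := e1 + w + s *: e2 => CP h1 h2.
set A := e1 + s *: e2 in ellA; set B := e1 + (s * q) *: e2 in ellB.
have CA : C A := frame_axis fr s0.
have CB : C B := frame_axis fr (mulr_gt0 s0 q0).
(* [B] is at most [2 *: P] and at least [(q ^+ 2 / 2) *: P] in the order of the cone. These two
   comparisons, which come from [h1] and [h2], control the distances from [P] along the second
   segment. *)
have PB : clo C (2 *: P - B).
  by move: h1; congr (clo C); vec_ring.
have BP : clo C (B - (q ^+ 2 / 2) *: P).
  rewrite (_ : _ - _ = (q / 2) *: (e1 - q *: w + s *: e2) +
     ((1 - q ^+ 2 / 2 - q / 2) *: e1 + (s * (q / 2) * (1 - q)) *: e2)).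
    apply: cloD; first by apply: (cloZ hC) => //; lra.
    apply: (clo_comb hC); [exact: (fr1 fr)|exact: (fr2 fr)|nra|].
    by apply: mulr_ge0; [apply: mulr_ge0; lra|lra].
  by vec_field.
have [z1 [z10 [m1 m1p z1T] z1c z1C z1D]] := hl_geodesic hC hD CA CP.
have [z2 [z20 [m2 m2p z2T] z2c z2C z2D]] := hl_geodesic hC hD CP CB.
set T1 := D A P in z1T z1c z1C z1D; set T2 := D P B in z2T z2c z2C z2D.
have T10 : 0 <= T1 := hl_ge0 hD CA CP; have T20 : 0 <= T2 := hl_ge0 hD CP CB.
pose z u := if u <= T1 then z1 u else z2 (u - T1).
have zC u : 0 <= u <= T1 + T2 -> C (z u).
  move=> /andP[u0 uT]; rewrite /z; case: leP => h; first by apply: z1C; rewrite u0.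
  by apply: z2C; rewrite subr_ge0 (ltW h) lerBlDl.
have zle u v : 0 <= u -> u <= v -> v <= T1 + T2 ->
    5^-1 * (v - u) - 1 <= D (z u) (z v) <= v - u.
  move=> u0 uv vT; rewrite /z; case: (leP v T1) => hv.
    rewrite (le_trans uv hv) z1D ?u0 ?hv ?(le_trans uv)//; last by rewrite (le_trans u0).
    rewrite ler0_norm ?subr_le0// opprB lexx andbT; lra.
  case: (leP u T1) => hu; last first.
    rewrite z2D; last 2 first.
    - by rewrite subr_ge0 (ltW hu) lerBlDl (le_trans uv).
    - by rewrite subr_ge0 (ltW hv) lerBlDl.
    rewrite (_ : u - T1 - (v - T1) = u - v); last by ring.
    rewrite ler0_norm ?subr_le0// opprB lexx andbT; lra.
  have uI : 0 <= u <= T1 by rewrite u0.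
  have vI : 0 <= v - T1 <= T2 by rewrite subr_ge0 (ltW hv) lerBlDl.
  have CX := z1C _ uI; have CY := z2C _ vI.
  have XP : D (z1 u) P = T1 - u.
    rewrite -(hl_scale hC hD m1p CX CP) -z1T z1D ?T10 ?lexx//.
    by rewrite ler0_norm ?opprB ?subr_le0.
  have PY : D P (z2 (v - T1)) = v - T1.
    rewrite -z20 z2D ?T20 ?lexx// sub0r normrN ger0_norm// subr_ge0; exact: ltW.
  have tr1 := hl_triangle hC hD CX CP CY.
  have tr2 := hl_triangle hC hD CX CY CP.
  rewrite (hl_sym hC hD CY CP) in tr2.
  have [x1 [y1 [x10 y10 xy1 XE]]] := z1c _ uI.
  have [x2 [y2 [x20 y20 xy2 YE]]] := z2c _ vI.
  set X := z1 u in CX XP tr1 tr2 XE *; set Y := z2 (v - T1) in CY PY tr1 tr2 YE *.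
  have aX : ev a X = x1 + y1.
    by rewrite XE !evE aw (fra1 fr) (fra2 fr); ring.
  have bX : ev b X = (x1 + y1) * s.
    by rewrite XE !evE bw (frb1 fr) (frb2 fr); ring.
  have aY : ev a Y = x2 + y2.
    by rewrite YE !evE aw (fra1 fr) (fra2 fr); ring.
  have bY : ev b Y = (x2 + y2 * q) * s.
    by rewrite YE !evE bw (frb1 fr) (frb2 fr); ring.
  have hgt : expR (- (2 * D X Y)) * (x2 + y2) <= x2 + y2 * q.
    have := hl_lower hC hD CX CY (frb fr) (fra fr).
    rewrite aX bX aY bY expRN [_^-1 * _]mulrC ler_pdivrMr ?expR_gt0// => h.
    have c0 : 0 < (x1 + y1) * s by rewrite mulr_gt0.
    rewrite -(ler_pM2l c0); apply: le_trans h _.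
    by rewrite le_eqVlt; apply/orP; left; apply/eqP; ring.
  (* This is the source of the constants 5 and 1. By the triangle inequality the length
     [D X P + D P Y] of the path from [X] to [Y] is at most [D X Y + 2 * D P Y], hence at most
     [5 * D X Y + 2]. *)
  have PY2 : D P Y <= 2 * D X Y + 1.
    apply: (hl_upper hD (k := (2 * (x2 + y2))^-1) (l := x2 + y2 * (q ^+ 2 / 2))) => //.
    - by rewrite invr_gt0 mulr_gt0.
    - have [y2E|y2n] := eqVneq y2 0; first by rewrite y2E mul0r; move: xy2; rewrite y2E.
      by rewrite ltr_wpDl// mulr_gt0 ?divr_gt0 ?exprn_gt0// lt_def y2n.
    - have -> : - (2 * (2 * D X Y + 1)) = - (2 * D X Y) + - (2 * D X Y) + - 2 by ring.
      by rewrite !expRD -expr2; apply: bent_estimate; rewrite ?expR_ge0.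
    - rewrite (_ : _ - _ = (2 * (x2 + y2))^-1 *: (x2 *: P + y2 *: (2 *: P - B))).
        apply: (cloZ hC); first by rewrite invr_ge0 mulr_ge0// ltW.
        by apply: (clo_comb hC) => //; exact: (clo_oc hC).
      by rewrite YE; vec_field; rewrite gt_eqF.
    - rewrite (_ : _ - _ = y2 *: (B - (q ^+ 2 / 2) *: P)).
        exact: (cloZ hC).
      by rewrite YE; vec_ring.
  by apply/andP; split; lra.
have T0 : 0 <= T1 <= T1 + T2 by rewrite T10 lerDl.
have z0 : z 0 = A by rewrite /z T10.
have zT : ell (z (T1 + T2)).
  (* If [T2 = 0], the end of the path falls in the first branch of [z], at a multiple of [P], which
     is then proportional to [B]. *)
  rewrite /z; case: leP => [h|_].
    have T2E : T2 = 0 by apply/eqP; rewrite eq_le T20 -(lerD2l T1) addr0 h.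
    rewrite T2E addr0 z1T -z20 -[X in z2 X]T2E z2T scalerA.
    by apply: (ax_scale ax) => //; rewrite mulr_gt0.
  by rewrite addrAC subrr add0r z2T; exact: (ax_scale ax).
have zq u v : 0 <= u <= T1 + T2 -> 0 <= v <= T1 + T2 -> C (z u) /\
     5^-1 * `|u - v| - 1 <= D (z u) (z v) <= 5 * `|u - v| + 1.
  move=> hu hv; split; first exact: zC.
  case/andP: (hu) => u0 uT; case/andP: (hv) => v0 vT.
  have [uv|/ltW vu] := leP u v.
    rewrite ler0_norm ?subr_le0// opprB.
    by case/andP: (zle _ _ u0 uv vT) => -> h /=; lra.
  rewrite ger0_norm ?subr_ge0// (hl_sym hC hD (zC _ hu) (zC _ hv)).
  by case/andP: (zle _ _ v0 vu uT) => -> h /=; lra.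
have l5 : 1 <= 5 :> R by lra.
rewrite -z0 in ellA.
have [x ellx] := hM l5 ler01 (addr_ge0 T10 T20) zq ellA zT T0.
have [k [t [k0 t0 xE]]] := ax_line ax ellx.
have Ct := frame_axis fr t0; have Ckt := oc_scale hC k0 Ct.
have Cm := oc_scale hC m1p CP.
rewrite /z lexx z1T xE (hl_sym hC hD)// (hl_scale hC hD m1p)// (hl_sym hC hD)//.
by rewrite (hl_scale hC hD k0)//; exists t.
Qed.

End Morse.

(** * Roundness and growth of the slices of a Morse axis *)

Section Claims.
Context {R : realType} {d : nat}.
Local Notation V := 'cV[R]_d.
Context {C : set V} {f0 : 'rV[R]_d} (hC : open_cone C f0).
Context {D : V -> V -> R} (hD : hilbert_like C D).
Context {M : R -> R -> R} {ell : set V} (hM : cone_morse C D M ell).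
Context {dl : R} (dl0 : 0 < dl) (dl1 : dl <= 1) (dlM : expR (2 * M 5 1) ^+ 2 * dl < 1).

(** For [morse_C1], with [x = ev F e1], [y = ev F w], [k = s * ev F e2] and [e = dl]. The two sign
    conditions force [x] to be at most about [e / 19 * k], so that [F] is carried by [e2] and almost
    vanishes slightly inside [w / 2]. *)
Lemma flat_estimate (e x k y : R) : 0 < e -> e <= 1 -> 0 <= x -> 0 <= k ->
  x + (1 + e / 20) / 2 * y + k / 2 <= 0 -> 0 < x + y + k ->
  0 < k /\ x + k / 2 + (1 - e / 4) / 2 * y <= e / 4 * k.
Proof.
move=> e0 e1 x0 k0 h1 h2.
have h3 : x * (1 - e / 20) < e / 20 * k by nra.
have k1 : 0 < k by nra.
split => //.
have h4 : x <= e / 19 * k by nra.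
have y1 : (2 * x + k) * (1 - e / 20) <= - y by nra.
have : (1 - e / 4) * ((2 * x + k) * (1 - e / 20)) <= (1 - e / 4) * (- y).
  by rewrite ler_wpM2l//; lra.
have : (2 * x + k) * (1 - e / 4 - e / 20) <= (2 * x + k) * ((1 - e / 4) * (1 - e / 20)).
  by rewrite ler_wpM2l; nra.
nra.
Qed.

(** If the slice ended too early on the side of [- w], a form [F] separating the exit point would be
    at least [dl^-1] times larger at [w'] than at the axis point of height [s]. The point over [w']
    is however at distance at most [M 5 1] from some axis point of height [u]. One factor [E] is
    lost in comparing the values of [F] and one in comparing [u] with [s], hence the square in
    [dlM]. *)
Lemma morse_round e1 e2 a b w s : frame C e1 e2 a b -> axis ell e1 e2 ->
  ev a w = 0 -> ev b w = 0 -> 0 < s ->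
  ell (e1 + s *: e2) -> ell (e1 + (s * dl) *: e2) ->
  clo C (e1 + 2 *: w + s *: e2) -> C (e1 - dl *: w + s *: e2).
Proof.
move=> fr ax aw bw s0 ellA ellB h; have CA := frame_axis hC fr s0.
have [cN|ncN] := pselect (clo C (- w)).
  rewrite (_ : _ + _ = dl *: (- w) + (e1 + s *: e2)).
    by apply: (cloZ hC) => //; exact: ltW.
  by vec_ring.
have [t [t0 cZ nZ hlt]] := oc_exit hC CA ncN.
have [dt|td] := ltP dl t.
  by have := hlt _ (ltW dl0) dt; congr C; vec_ring.
exfalso; have [F hF FZ] := oc_separation hC nZ.
(* With this scaling the exit point lies exactly over [- dl *: w'], so that [h2] is the closure
   statement [cZ]. *)
pose w' := (t / dl) *: w.
have r0 : 0 < t / dl by rewrite divr_gt0.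
have r1 : t / dl <= 1 by rewrite ler_pdivrMr// mul1r.
have CP : C (e1 + w' + s *: e2).
  rewrite (_ : _ + _ = (1 - t / dl / 2) *: (e1 + s *: e2) + (t / dl / 2) *: (e1 + 2 *: w + s *: e2)).
    by apply: (oc_comb hC) => //; lra.
  by vec_field; rewrite gt_eqF.
have h1 : clo C (e1 + 2 *: w' + ((2 - dl) * s) *: e2).
  rewrite (_ : _ + _ = ((t / dl) *: (e1 + 2 *: w + s *: e2) + (1 - t / dl) *: (e1 + s *: e2))
     + ((1 - dl) * s) *: e2).
    apply: cloD.
      by apply: (clo_comb hC) => //; [exact: (clo_oc hC)|lra|lra].
    apply: (cloZ hC); last exact: (fr2 fr).
    by rewrite mulr_ge0 ?subr_ge0// ltW.
  by vec_field; rewrite gt_eqF.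
have h2 : clo C (e1 - dl *: w' + s *: e2).
  by move: cZ; congr clo; vec_field; rewrite gt_eqF.
have aw' : ev a w' = 0 by rewrite evZ aw mulr0.
have bw' : ev b w' = 0 by rewrite evZ bw mulr0.
have [u u0 Du] := morse_bent hC hD hM fr ax aw' bw' s0 dl0 dl1 ellA ellB CP h1 h2.
have CQ := frame_axis hC fr u0.
have F1 : 0 <= ev F e1 by apply: (clo_ge0 hC) (fr1 fr) => x /hF/ltW.
have F2 : 0 <= ev F e2 by apply: (clo_ge0 hC) (fr2 fr) => x /hF/ltW.
have FA := hF _ CA; rewrite !evE in FA.
have Fw : ev F e1 + s * ev F e2 <= dl * ev F w'.
  have -> : dl * ev F w' = t * ev F w by rewrite /w' evZ; field; rewrite gt_eqF.
  by move: FZ; rewrite !evE; lra.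
have Fw0 : 0 < ev F w' by rewrite -(pmulr_rgt0 _ dl0) (lt_le_trans FA).
have eD : expR (2 * D (e1 + w' + s *: e2) (e1 + u *: e2)) <= expR (2 * M 5 1).
  by rewrite ler_expR ler_pM2l.
set Q := e1 + u *: e2 in CQ Du eD *; set P := e1 + w' + s *: e2 in CP Du eD *.
have dlM' := dlM; set E := expR (2 * M 5 1) in eD dlM' *.
have E0 : 0 < E := expR_gt0 _.
have low (G H : 'rV[R]_d) : (forall x, C x -> 0 < ev G x) -> (forall x, C x -> 0 < ev H x) ->
  ev G P * ev H Q <= E * (ev G Q * ev H P).
  move=> hG hH; apply: (le_trans (hl_lower hC hD CP CQ hG hH)).
  by rewrite ler_wpM2r// mulr_ge0// ltW// ?hG ?hH.
have aP : ev a P = 1 by rewrite !evE aw (fra1 fr) (fra2 fr); ring.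
have bP : ev b P = s by rewrite !evE bw (frb1 fr) (frb2 fr); ring.
have aQ : ev a Q = 1 by rewrite !evE (fra1 fr) (fra2 fr); ring.
have bQ : ev b Q = u by rewrite !evE (frb1 fr) (frb2 fr); ring.
have FP : ev F w' <= ev F P by rewrite !evE; lra.
have FQ : ev F Q = ev F e1 + u * ev F e2 by rewrite !evE.
(* Between the heights [s] and [u], the form [F] on the axis grows at most by the factor [u / s] if
   [s <= u], and does not grow if [u < s]. Accordingly [F] is paired with [a] in the first case and
   with [b] in the second. *)
have [su|us] := leP s u.
  have := low _ _ hF (fra fr); have := low _ _ (fra fr) (frb fr).
  rewrite aP aQ bP bQ !mul1r !mulr1 => h3 h4.
  have h5 : s * ev F Q <= u * (dl * ev F w') by rewrite FQ; nra.
  have h6 : s * ev F w' <= E * u * dl * ev F w'.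
    have : s * ev F w' <= s * (E * ev F Q) by rewrite ler_pM2l//; lra.
    move/le_trans; apply; rewrite mulrCA -!mulrA ler_pM2l//; lra.
  rewrite ler_pM2r// in h6.
  have : s <= E ^+ 2 * dl * s.
    apply: (le_trans h6).
    have := ler_wpM2l (mulr_ge0 (ltW E0) (ltW dl0)) h3; lra.
  by rewrite ler_pMl// leNgt dlM'.
have := low _ _ hF (frb fr); have := low _ _ (frb fr) (fra fr).
rewrite aP aQ bP bQ !mulr1 => h3 h4.
have h5 : ev F Q <= dl * ev F w' by rewrite FQ; nra.
have h6 : ev F w' * u <= ev F w' * (E * dl * s).
  have : ev F w' * u <= ev F P * u by rewrite ler_wpM2r// ltW.
  move/le_trans; apply; apply: (le_trans h4).
  have := ler_wpM2l (mulr_ge0 (ltW E0) (ltW s0)) h5; lra.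
rewrite ler_pM2l// in h6.
have : s <= E ^+ 2 * dl * s.
  apply: (le_trans h3).
  have := ler_wpM2l (ltW E0) h6; lra.
by rewrite ler_pMl// leNgt dlM'.
Qed.

Context (M0 : 0 <= M 5 1).

(** Convexity with [e1] alone puts [w / 2] in the slice at height [s / 2]; the gain [dl / 20] is due
    to the Morse property. Without it, some [F] would be at most [dl / 4 * (s * ev F e2)] at a point
    [P] slightly inside [w / 2], while it is at least [u * ev F e2] at height [u] on the axis. The
    pair [F], [b] then contradicts [dlM]. *)
Lemma morse_C1 e1 e2 a b w s : frame C e1 e2 a b -> axis ell e1 e2 ->
  ev a w = 0 -> ev b w = 0 -> 0 < s ->
  (forall t, s * (dl / 4) <= t -> t <= s -> ell (e1 + t *: e2)) ->
  C (e1 + w + s *: e2) -> C (e1 + ((1 + dl / 20) / 2) *: w + (s / 2) *: e2).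
Proof.
move=> fr ax aw bw s0 ells Cw; have d0 := dl0; have d1 := dl1.
have aw2 : ev a (2^-1 *: w) = 0 by rewrite evZ aw mulr0.
have bw2 : ev b (2^-1 *: w) = 0 by rewrite evZ bw mulr0.
have sd0 : 0 < s * dl by rewrite mulr_gt0.
have sd1 : s * dl <= s by rewrite ger_pMr.
have Rd : C (e1 - dl *: (2^-1 *: w) + s *: e2).
  apply: (morse_round fr ax) => //; [apply: ells; lra|apply: ells; lra|].
  by rewrite scalerA divff ?gt_eqF// scale1r; exact: (clo_oc hC).
apply: contrapT => nZ; have [F hF FZ] := oc_separation hC nZ.
(* [th] equals [(2 - q) / 2], which makes [h1] a convex combination of the given point and of [e1].
   The value [dl / 2] of [q] is the roundness available in [Rd], so that [h2] follows from [Rd]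
   scaled by [th / 2]. *)
pose q := dl / 2; pose th := 1 - q / 2.
have th0 : 0 < th by rewrite /th /q; lra.
have th1 : th <= 1 by rewrite /th /q; lra.
have s2 : 0 < s / 2 by lra.
pose W := (th / 2) *: w.
have CA2 := frame_axis hC fr s2.
have res : clo C ((1 - th / 2) *: e1 + (q / 4 * s) *: e2).
  apply: (clo_comb hC); [exact: (fr1 fr)|exact: (fr2 fr)|lra|].
  by rewrite mulr_ge0 ?ltW// /q; lra.
have CP : C (e1 + W + (s / 2) *: e2).
  rewrite (_ : _ + _ = (th / 2) *: (e1 + w + s *: e2) + 1 *: ((1 - th / 2) *: e1 + (q / 4 * s) *: e2)).
    by apply: (oc_comb hC) => //; rewrite divr_gt0.
  by rewrite /W /th; vec_field.
have h1 : clo C (e1 + 2 *: W + ((2 - q) * (s / 2)) *: e2).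
  rewrite (_ : _ + _ = th *: (e1 + w + s *: e2) + (1 - th) *: e1).
    by apply: (clo_comb hC); [exact: (clo_oc hC)|exact: (fr1 fr)|exact: ltW|lra].
  by rewrite /W /th; vec_field.
have h2 : clo C (e1 - q *: W + (s / 2) *: e2).
  rewrite (_ : _ + _ = (th / 2) *: (e1 - dl *: (2^-1 *: w) + s *: e2) + 1 *: ((1 - th / 2) *: e1 + (q / 4 * s) *: e2)).
    by apply: (clo_comb hC) => //; [exact: (clo_oc hC)|lra].
  by rewrite /W /th /q; vec_field.
have aW : ev a W = 0 by rewrite evZ aw mulr0.
have bW : ev b W = 0 by rewrite evZ bw mulr0.
have q0 : 0 < q by rewrite /q; lra.
have q1 : q <= 1 by rewrite /q; lra.
have ellA : ell (e1 + (s / 2) *: e2) by apply: ells; lra.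
have ellB : ell (e1 + (s / 2 * q) *: e2) by apply: ells; rewrite /q; lra.
have [u u0 Du] := morse_bent hC hD hM fr ax aW bW s2 q0 q1 ellA ellB CP h1 h2.
have CQ := frame_axis hC fr u0.
have F1 : 0 <= ev F e1 by apply: (clo_ge0 hC) (fr1 fr) => x /hF/ltW.
have F2 : 0 <= ev F e2 by apply: (clo_ge0 hC) (fr2 fr) => x /hF/ltW.
have := hl_lower hC hD CQ CP hF (frb fr); rewrite (hl_sym hC hD CQ CP).
have eD : expR (2 * D (e1 + W + (s / 2) *: e2) (e1 + u *: e2)) <= expR (2 * M 5 1).
  by rewrite ler_expR ler_pM2l.
have E1 : 1 <= expR (2 * M 5 1) by rewrite -[leLHS]expR0 ler_expR mulr_ge0.
set Q := e1 + u *: e2 in CQ Du eD *; set P := e1 + W + _ in CP Du eD *.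
move=> low.
have bP : ev b P = s / 2 by rewrite !evE bw (frb1 fr) (frb2 fr); ring.
have bQ : ev b Q = u by rewrite !evE (frb1 fr) (frb2 fr); ring.
have FQ : ev F Q = ev F e1 + u * ev F e2 by rewrite !evE.
have [f2 FP] : 0 < s * ev F e2 /\ ev F P <= dl / 4 * (s * ev F e2).
  have := hF _ Cw; move: FZ; rewrite !evE => g1 g2.
  have -> : ev F e1 + th / 2 * ev F w + s / 2 * ev F e2 =
    ev F e1 + (s * ev F e2) / 2 + (1 - dl / 4) / 2 * ev F w by rewrite /th /q; field.
  by apply: flat_estimate; rewrite ?mulr_ge0//; lra.
have FP0 := hF _ CP.
have low2 : ev F Q * (s / 2) <= expR (2 * M 5 1) * (ev F P * u).
  rewrite -bP -[in leRHS]bQ; apply: (le_trans low); rewrite ler_wpM2r//.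
  by apply: mulr_ge0; [exact: ltW|rewrite bQ; exact: ltW].
have dlM' := dlM; set E := expR (2 * M 5 1) in eD E1 low2 dlM' *.
have : s * ev F e2 * u <= E * dl / 2 * (s * ev F e2 * u).
  have i1 : u * ev F e2 * (s / 2) <= ev F Q * (s / 2) by rewrite ler_wpM2r ?(ltW s2)// FQ lerDr.
  have i2 : E * (ev F P * u) <= E * (dl / 4 * (s * ev F e2) * u).
    by rewrite ler_wpM2l ?(le_trans ler01 E1)// ler_wpM2r// ltW.
  by lra.
have fu := mulr_gt0 f2 u0; rewrite ler_pMl// => h.
suff : E * dl <= E ^+ 2 * dl by lra.
by rewrite ler_wpM2r ?(ltW dl0)// expr2 ler_peMr// (le_trans ler01 E1).
Qed.

(** This is [morse_C1] with [e1] and [e2] exchanged: dividing by [s] turns height [s] into height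
    [s^-1], and halving the latter doubles the former. The range of heights needed on the axis is
    inverted too, and now reaches up to [s * (4 / dl)]. *)
Lemma morse_convex e1 e2 a b w s : frame C e1 e2 a b -> axis ell e1 e2 ->
  ev a w = 0 -> ev b w = 0 -> 0 < s ->
  (forall t, s <= t -> t <= s * (4 / dl) -> ell (e1 + t *: e2)) ->
  C (e1 + w + s *: e2) -> C (e1 + (1 + dl / 20) *: w + (2 * s) *: e2).
Proof.
move=> fr ax aw bw s0 ells Cw; have d0 := dl0; have d1 := dl1.
have si : 0 < s^-1 by rewrite invr_gt0.
have ew : C (e2 + s^-1 *: w + s^-1 *: e1).
  rewrite (_ : _ + _ = s^-1 *: (e1 + w + s *: e2)); first exact: (oc_scale hC).
  by vec_field; rewrite gt_eqF.
have ells' t : s^-1 * (dl / 4) <= t -> t <= s^-1 -> ell (e2 + t *: e1).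
  move=> t1 t2; have t0 : 0 < t by apply: lt_le_trans t1; rewrite mulr_gt0//; lra.
  rewrite (_ : _ + _ = t *: (e1 + t^-1 *: e2)).
    apply: (ax_scale ax) => //; apply: ells.
      by rewrite -[leLHS]invrK lef_pV2.
    rewrite -[leRHS]invrK lef_pV2 ?posrE ?invr_gt0//.
      by rewrite invfM invf_div.
    by rewrite mulr_gt0// divr_gt0.
  by vec_field; rewrite gt_eqF.
have := morse_C1 (frame_sym fr) (axis_sym ax) _ _ si ells' ew.
rewrite !evZ aw bw mulr0 => /(_ erefl erefl) h.
have s2 : 0 < 2 * s by lra.
have := oc_scale hC s2 h; congr C.
by vec_field; rewrite gt_eqF.
Qed.

End Claims.

(** * Lifts of projective points *)

Section Projection.
Local Open Scope quotient_scope.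
Context {R : realType} {d : nat}.
Local Notation V := 'cV[R]_d.
Local Notation P := (projspace R d).
Context (x0 : P).

(** [x0] only supplies the default value, so that [prj 0] is [x0]. *)
Definition prj (v : V) : P :=
  pclass (insubd (repr (x0 : {eq_quot (same_line_equiv R d)})) v).

Lemma homog_neq0 (x : P) : homog x != 0.
Proof. exact: (svalP (repr (x : {eq_quot (same_line_equiv R d)}))). Qed.

Lemma nzval_insubd (r : nzvec R d) (v : V) : v != 0 -> nzval (insubd r v) = v.
Proof. by move=> v0; exact: (insubdK r v0). Qed.

Lemma pclass_eqP (v w : nzvec R d) :
  pclass v = pclass w <-> exists2 k : R, k != 0 & nzval w = k *: nzval v.
Proof.
split; first by move=> /eqmodP/asboolP.
by move=> h; apply/eqmodP/asboolP.
Qed.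

Lemma prj_eq (v w : V) : v != 0 -> w != 0 ->
  prj v = prj w <-> exists2 k : R, k != 0 & w = k *: v.
Proof. by move=> v0 w0; rewrite /prj pclass_eqP !nzval_insubd. Qed.

Lemma prjK (x : P) : prj (homog x) = x.
Proof.
rewrite -[RHS](@reprK _ {eq_quot (same_line_equiv R d)}); apply/pclass_eqP.
exists 1; rewrite ?oner_neq0// scale1r nzval_insubd//; exact: homog_neq0.
Qed.

Lemma prjZ k v : k != 0 -> prj (k *: v) = prj v.
Proof.
move=> k0; have [->|v0] := eqVneq v 0; first by rewrite scaler0.
by symmetry; apply/prj_eq => //; [rewrite scaler_eq0 negb_or k0|exists k].
Qed.

Lemma homog_prj v : v != 0 -> exists2 k, k != 0 & homog (prj v) = k *: v.
Proof. by move=> v0; apply/prj_eq => //; [exact: homog_neq0|rewrite prjK]. Qed.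

Lemma linvalE f (x : P) : linval f x = ev f (homog x).
Proof. by []. Qed.

Lemma chart_prj f v : v != 0 -> chart f (prj v) <-> ev f v != 0.
Proof.
move=> v0; rewrite /chart /= linvalE; have [k k0 ->] := homog_prj v0.
by rewrite evZ mulf_eq0 (negbTE k0).
Qed.

Lemma affpt_prj f v : v != 0 -> affpt f (prj v) = (ev f v)^-1 *: v.
Proof.
move=> v0; rewrite /affpt linvalE; have [k k0 ->] := homog_prj v0.
by rewrite evZ scalerA invfM mulrAC mulVf// mul1r.
Qed.

Lemma pact_prj g v : g \in unitmx -> v != 0 -> pact g (prj v) = prj (g *m v).
Proof.
move=> gu v0; have [k k0 hk] := homog_prj v0.
have gv (w : V) : w != 0 -> g *m w != 0.
  by move=> w0; apply: contra w0 => /eqP h; rewrite -(mulKmx gu w) h mulmx0.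
rewrite /pact hk; apply/pclass_eqP.
rewrite !nzval_insubd ?gv//; first by exists k^-1; rewrite ?invr_eq0// -scalemxAr scalerA mulVf// scale1r.
by rewrite scaler_eq0 negb_or k0.
Qed.

(** An open set of the quotient pulls back to an open set of [nzvec], which is the trace of an open
    set of vectors. The radius is capped by the norm of [v] so that [v + u] stays nonzero. *)
Lemma prj_nbhs (U : set P) v : v != 0 -> nbhs (prj v) U ->
  exists2 e, 0 < e & forall u, `|u| < e -> v + u != 0 /\ U (prj (v + u)).
Proof.
move=> v0; rewrite nbhsE; case=> U1 [oO Ov] OU.
have [A oA AE] : open ((@pclass R d) @^-1` U1) := oO.
have AO (w : V) : w != 0 -> A w -> U1 (prj w).
  move=> w0 Aw; rewrite -[U1 _]/((@pclass R d @^-1` U1) _) -AE /=.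
  by rewrite -/(nzval _) nzval_insubd.
have Av : A v.
  have : (@pclass R d @^-1` U1) (insubd (repr (x0 : {eq_quot (same_line_equiv R d)})) v).
    exact: Ov.
  by rewrite -AE /= -/(nzval _) nzval_insubd.
have /nbhs_ballP[e /= e0 he] : nbhs v A by apply: open_nbhs_nbhs.
exists (Num.min e `|v|); first by rewrite lt_min e0 normr_gt0.
move=> u; rewrite lt_min => /andP[ue uv].
have vu : v + u != 0.
  by apply: contraTneq uv => /eqP; rewrite addrC addr_eq0 => /eqP ->; rewrite normrN ltxx.
split => //; apply/OU/AO => //; apply: he.
by rewrite -ball_normE /= opprD addNKr normrN.
Qed.

Lemma open_prj (A : set V) :
  (forall k v, k != 0 -> A v -> A (k *: v)) ->
  (forall v, v != 0 -> A v -> exists2 e, 0 < e & forall u, `|u| < e -> A (v + u)) ->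
  open [set x : P | A (homog x)].
Proof.
move=> Ak Ao; pose B := [set v : V | v != 0 /\ A v].
have oB : open B.
  rewrite openE => v [v0 Av]; have [e e0 he] := Ao _ v0 Av.
  apply/nbhs_ballP; exists (Num.min e `|v|); first by rewrite /= lt_min e0 normr_gt0.
  move=> w; rewrite -ball_normE /= lt_min => /andP[ue uv].
  have wE : w = v + (w - v) by rewrite addrC subrK.
  split; last by rewrite wE; apply: he; rewrite distrC.
  by apply: contraTneq uv => ->; rewrite subr0 ltxx.
exists B => //; apply/seteqP; split => w /=.
  move=> [w0 Aw]; have [k k0 hk] : exists2 k, k != 0 & homog (pclass w) = k *: nzval w.
    apply/pclass_eqP; rewrite -[LHS](@reprK _ {eq_quot (same_line_equiv R d)}).
    by [].
  by rewrite hk; exact: Ak.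
move=> Aw; split; first exact: (svalP w).
have [k k0 hk] : exists2 k, k != 0 & nzval w = k *: homog (pclass w).
  apply/pclass_eqP; rewrite -[RHS](@reprK _ {eq_quot (same_line_equiv R d)}).
  by [].
by rewrite -/(nzval w) hk; exact: Ak.
Qed.

End Projection.

(** * Comparison of the Euclidean norm with the sup norm *)

Section Norms.
Context {R : realType}.

Lemma enormZ d (k : R) (v : 'cV[R]_d) : enorm (k *: v) = `|k| * enorm v.
Proof.
rewrite /enorm -sqrtr_sqr -sqrtrM ?sqr_ge0//; congr Num.sqrt.
by rewrite mulr_sumr; apply: eq_bigr => i _; rewrite mxE exprMn.
Qed.

Lemma enorm_ge0 d (v : 'cV[R]_d) : 0 <= enorm v.
Proof. exact: sqrtr_ge0. Qed.

Lemma enorm_sqr d (v : 'cV[R]_d) : enorm v ^+ 2 = \sum_i v i 0 ^+ 2.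
Proof. by rewrite sqr_sqrtr// sumr_ge0// => i _; rewrite sqr_ge0. Qed.

Lemma mx_entry_le m n (v : 'M[R]_(m, n)) i j : `|v i j| <= `|v|.
Proof. by rewrite [leRHS]mx_normrE; apply: (@le_bigmax _ _ _ 0 (fun p => `|v p.1 p.2|) (i, j)). Qed.

Lemma mx_norm_leP m n (v : 'M[R]_(m, n)) K : 0 <= K ->
  (forall i j, `|v i j| <= K) -> `|v| <= K.
Proof.
by move=> K0 h; rewrite [leLHS]mx_normrE; apply/bigmax_leP; split => // -[i j] _; exact: h.
Qed.

Lemma norm_le_enorm d (v : 'cV[R]_d) : `|v| <= enorm v.
Proof.
apply: mx_norm_leP => [|i j]; first exact: enorm_ge0.
rewrite ord1 -sqrtr_sqr; apply: ler_wsqrtr.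
by rewrite (bigD1 i)//= lerDl sumr_ge0// => k _; rewrite sqr_ge0.
Qed.

Lemma enorm_le_norm d (v : 'cV[R]_d) : enorm v <= d%:R * `|v|.
Proof.
rewrite -(@ler_sqr _ (enorm v)) ?nnegrE ?enorm_ge0 ?mulr_ge0//.
rewrite enorm_sqr exprMn; apply: (@le_trans _ _ (\sum_(i < d) `|v| ^+ 2)).
  by apply: ler_sum => i _; rewrite -[leLHS]real_normK ?num_real// lerXn2r ?nnegrE// mx_entry_le.
rewrite sumr_const card_ord -[leLHS]mulr_natl ler_wpM2r ?sqr_ge0//.
by rewrite -natrX ler_nat; case: d {v} => // d; rewrite leq_pmulr.
Qed.

Lemma enorm_eq0 d (v : 'cV[R]_d) : (enorm v == 0) = (v == 0).
Proof.
apply/eqP/eqP => [h|->]; last first.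
  by rewrite -(scale0r (0 : 'cV[R]_d)) enormZ normr0 mul0r.
by apply/normr0_eq0/eqP; rewrite eq_le normr_ge0 andbT -h norm_le_enorm.
Qed.

Lemma mulmx_bound m d (g : 'M[R]_(m, d)) : exists2 K, 0 < K & forall v : 'cV[R]_d, `|g *m v| <= K * `|v|.
Proof.
exists (1 + d%:R * `|g|); first by rewrite ltr_pwDl// mulr_ge0.
move=> v; apply: mx_norm_leP => [|i j]; first by rewrite mulr_ge0// addr_ge0// mulr_ge0.
rewrite mxE; apply: (le_trans (ler_norm_sum _ _ _)).
apply: (@le_trans _ _ (\sum_(k < d) `|g| * `|v|)).
  by apply: ler_sum => k _; rewrite normrM ler_pM// mx_entry_le.
by rewrite sumr_const card_ord -[leLHS]mulr_natl mulrDl mul1r mulrA lerDr.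
Qed.

Lemma ev_bound d (f : 'rV[R]_d) : exists2 K, 0 < K & forall v, `|ev f v| <= K * `|v|.
Proof.
have [K K0 hK] := mulmx_bound f; exists K => // v.
by apply: le_trans (hK v); exact: mx_entry_le.
Qed.

End Norms.

(** * Singular values *)

Section SpectralTheory.
Local Open Scope sesquilinear_scope.
Local Open Scope set_scope.

Lemma char_poly_similar (F : fieldType) n (A U : 'M[F]_n) : U \in unitmx ->
  char_poly (invmx U *m A *m U) = char_poly A.
Proof.
move=> Uu; rewrite /char_poly.
have -> : char_poly_mx (invmx U *m A *m U) =
    map_mx polyC (invmx U) *m char_poly_mx A *m map_mx polyC U.
  rewrite /char_poly_mx mulmxBr mulmxBl -!map_mxM; congr (_ - _).
  by rewrite scalar_mxC -mulmxA -map_mxM mulVmx// map_mx1 mulmx1.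
by rewrite !det_mulmx mulrAC -det_mulmx -map_mxM mulVmx// map_mx1 det1 mul1r.
Qed.

Section Spectral.
Context {R : realType} {d : nat}.
Local Notation toC := (real_complex R).
Local Notation C := R[i].

Definition sqnorm n (z : 'rV[C]_n) : C := (z *m z ^t*) 0 0.

Lemma sqnormE n (z : 'rV[C]_n) : sqnorm z = \sum_k `|z 0 k| ^+ 2.
Proof. by rewrite /sqnorm mxE; apply: eq_bigr => k _; rewrite !mxE normCK. Qed.

Lemma sqnorm_unitary n (z : 'rV[C]_n) (U : 'M[C]_n) : U \is unitarymx ->
  sqnorm (z *m U) = sqnorm z.
Proof.
move=> /unitarymxP h; rewrite /sqnorm trmx_mul map_mxM mulmxA -(mulmxA z) h mulmx1//.
Qed.

Lemma toC_real (x : R) : toC x \is Num.real.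
Proof. by rewrite realE !ler0c -oppr_ge0 -rmorphN ler0c oppr_ge0 le_total. Qed.

Lemma sqnorm_rect n (x y : 'rV[R]_n) :
  sqnorm (map_mx toC x + 'i *: map_mx toC y) = toC (\sum_k x 0 k ^+ 2 + \sum_k y 0 k ^+ 2).
Proof.
rewrite sqnormE -big_split /= rmorph_sum; apply: eq_bigr => k _.
by rewrite !mxE normC2_rect ?toC_real// rmorphD !rmorphXn.
Qed.

Context (g : 'M[R]_d).

(** The spectral theorem is applied over [R[i]] to the complexified Gram matrix. Its eigenvalues are
    the values of the form [sqnorm] on the images of the rows of [U], hence nonnegative, so they
    come from reals [e k]. *)
Lemma gram_diag : exists (U : 'M[C]_d) (e : 'I_d -> R), [/\ U \is unitarymx,
  (forall k, 0 <= e k),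
  (forall z, sqnorm (z *m map_mx toC g^T) = \sum_k toC (e k) * `|(z *m U ^t*) 0 k| ^+ 2) &
  char_poly (g^T *m g) = \prod_k ('X - (e k)%:P)].
Proof.
pose G := map_mx toC g^T; pose A := map_mx toC (g^T *m g).
have GC : G ^t* = map_mx toC g.
  by apply/matrixP => i j; rewrite !mxE conj_Creal// toC_real.
have AE : A = G *m G ^t* by rewrite GC -map_mxM.
have AC : A ^t* = A.
  by apply/matrixP => i j; rewrite !mxE conj_Creal ?toC_real//; congr toC; apply: eq_bigr => k _; rewrite !mxE mulrC.
have Anormal : A \is normalmx by apply/normalmxP; rewrite AC.
have /orthomx_spectralP := Anormal.
set U := spectralmx A; set D := spectral_diag A => UD.
have Uu : U \is unitarymx by exact: spectral_unitarymx.
have form (z : 'rV[C]_d) : sqnorm (z *m G) = \sum_k D 0 k * `|(z *m U ^t*) 0 k| ^+ 2.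
  rewrite /sqnorm trmx_mul map_mxM mulmxA -(mulmxA z) -AE UD invmx_unitary//.
  rewrite !mulmxA; set y := z *m U ^t*.
  have -> : y *m diag_mx D *m U *m z ^t* = y *m diag_mx D *m y ^t*.
    by rewrite /y trmx_mul map_mxM trmxCK mulmxA.
  rewrite mxE; apply: eq_bigr => k _; rewrite mul_mx_diag !mxE normCK.
  by rewrite mulrAC [LHS]mulrC; congr (_ * _); rewrite mulrC.
have D_ge0 k : 0 <= D 0 k.
  have := form (row k U); rewrite -!row_mul; move/unitarymxP: (Uu) => ->; rewrite (bigD1 k)//= big1 => [|j jk].
    rewrite !mxE eqxx normr1 expr1n mulr1 addr0 => <-.
    by rewrite sqnormE sumr_ge0// => i _; rewrite exprn_ge0.
  by rewrite !mxE eq_sym (negbTE jk) normr0 expr0n mulr0.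
pose e k := complex.Re (D 0 k).
have De k : D 0 k = toC (e k).
  by rewrite [LHS]complexE (ger0_Im (D_ge0 k)) rmorph0 mulr0 addr0.
exists U, e; split => //.
- by move=> k; rewrite -ler0c -De.
- by move=> z; rewrite form; apply: eq_bigr => k _; rewrite De.
apply: (map_poly_inj toC); rewrite map_char_poly -/A rmorph_prod /=.
under eq_bigr do rewrite map_polyXsubC /= -De.
rewrite UD char_poly_similar ?unitarymx_unit// char_poly_trig ?diag_mx_is_trig//.
by apply: eq_bigr => k _; rewrite mxE eqxx mulr1n.
Qed.

(** A dimension count: the row space of [U] and the span of the eigenvectors with index in [I] have
    ranks of sum greater than [d], so they share a nonzero vector, possibly a complex one. *)
Lemma eigenspace_meet m (U : 'M[R]_(m, d)) (P : 'M[C]_d) (I : {set 'I_d}) :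
  P \is unitarymx -> (d < \rank U + #|I|)%N ->
  exists2 w : 'rV[C]_m, w *m map_mx toC U != 0 &
    forall k, k \notin I -> (w *m map_mx toC U *m P ^t*) 0 k = 0.
Proof.
move=> Pu rk; set UC := map_mx toC U.
pose E : 'M[C]_(#|I|, d) := rowsub enum_val P.
have EP : E *m P ^t* = rowsub enum_val 1%:M.
  by rewrite /E mul_rowsub_mx; move/unitarymxP: Pu => ->.
have Eu : E \is unitarymx.
  apply/unitarymxP/matrixP => i j.
  have -> : (E *m E ^t*) i j = (E *m P ^t*) i (enum_val j).
    by rewrite !mxE; apply: eq_bigr => k _; rewrite !mxE.
  by rewrite EP !mxE (inj_eq enum_val_inj).
have rE := mxrank_unitary Eu.
have rUC : \rank UC = \rank U := mxrank_map _ _.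
have cap : (UC :&: E)%MS != 0.
  rewrite -mxrank_eq0 -lt0n -(ltn_add2l (\rank (UC + E)%MS)) addn0 mxrank_sum_cap rUC rE.
  by apply: leq_ltn_trans rk; apply: rank_leq_col.
have [z zcap z0] := rowV0Pn cap.
have [/submxP[w zw] /submxP[y zy]] : (z <= UC)%MS /\ (z <= E)%MS.
  by apply/andP; rewrite -sub_capmx.
exists w; first by rewrite -zw.
move=> k kI; rewrite -zw zy -mulmxA EP mxE big1// => j _; rewrite !mxE.
case: eqP => [jk|_]; last by rewrite mulr0.
by move: kI; rewrite -jk enum_valP.
Qed.

Lemma enorm_row (x : 'rV[R]_d) : enorm x^T ^+ 2 = \sum_k x 0 k ^+ 2.
Proof. by rewrite enorm_sqr; apply: eq_bigr => k _; rewrite mxE. Qed.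

(** Splitting [w] into real and imaginary parts turns norms of complex vectors into sums of two real
    ones. An inequality known for real vectors thus passes to the complex vector of
    [eigenspace_meet]. *)
Lemma sqnorm_lift m (U : 'M[R]_(m, d)) (w : 'rV[C]_m) :
  exists x y : 'rV[R]_m,
    sqnorm (w *m map_mx toC U) = toC (enorm (x *m U)^T ^+ 2 + enorm (y *m U)^T ^+ 2) /\
    sqnorm (w *m map_mx toC U *m map_mx toC g^T) =
      toC (enorm (g *m (x *m U)^T) ^+ 2 + enorm (g *m (y *m U)^T) ^+ 2).
Proof.
pose x := map_mx (@complex.Re R) w; pose y := map_mx (@complex.Im R) w.
have wE : w = map_mx toC x + 'i *: map_mx toC y.
  by apply/matrixP => i j; rewrite !mxE [LHS]complexE.
exists x, y; split.
  by rewrite wE mulmxDl -scalemxAl -!map_mxM sqnorm_rect !enorm_row.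
rewrite wE !mulmxDl -!scalemxAl -!map_mxM sqnorm_rect -!enorm_row.
by rewrite !trmx_mul trmxK.
Qed.

Lemma singular_valuesP (e : 'I_d -> R) : (forall k, 0 <= e k) ->
  char_poly (g^T *m g) = \prod_k ('X - (e k)%:P) ->
  [/\ sorted (fun a b : R => b <= a) (singular_values g),
    all (fun a => 0 <= a) (singular_values g) &
    perm_eq [seq a ^+ 2 | a <- singular_values g] [seq e k | k <- enum 'I_d]].
Proof.
move=> e0 pE; rewrite /singular_values; set S := (S in xget _ S).
have [s1 s2 s3] : S (xget [::] S).
  (* The sorted square roots of the eigenvalues are a witness, so the default [[::]] of
     [singular_values] is not reached. *)
  apply: xgetPex; exists (sort (fun a b : R => b <= a) [seq Num.sqrt (e k) | k <- enum 'I_d]).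
  have total : total (fun a b : R => b <= a) by move=> a b; exact: le_total.
  split; first exact: sort_sorted.
    by rewrite all_sort; apply/allP => a /mapP[k _ ->]; exact: sqrtr_ge0.
  rewrite pE (perm_big _ (permEl (perm_sort _ _))) big_map big_enum /=.
  by apply: eq_bigr => k _; rewrite sqr_sqrtr.
split => //; apply: prod_XsubC_eq; rewrite big_map -s3 pE big_map big_enum//.
Qed.

Lemma count_sorted_ge (s : seq R) i : sorted (fun a b : R => b <= a) s -> (i < size s)%N ->
  (size s - i <= count (fun a : R => (a <= nth 0 s i)%R) s)%N /\
  (i < count (fun a : R => (nth 0 s i <= a)%R) s)%N.
Proof.
move=> ss is_; have tr : transitive (fun a b : R => b <= a) by move=> a b c h1 h2; exact: le_trans h1.
have nthP j k : (j <= k)%N -> (k < size s)%N -> nth 0 s k <= nth 0 s j.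
  move=> jk ks; apply: (sorted_leq_nth tr (@lexx _ R)) => //; rewrite inE//.
  exact: leq_ltn_trans ks.
split.
  set p := (X in count X _); rewrite -{2}(cat_take_drop i s) count_cat.
  apply: leq_trans (leq_addl _ _); rewrite -size_drop.
  suff : all p (drop i s) by rewrite all_count => /eqP ->.
  apply/(all_nthP 0) => j; rewrite size_drop => js; rewrite nth_drop.
  by apply: nthP; [exact: leq_addr|rewrite -ltn_subRL].
set p := (X in count X _); rewrite -(cat_take_drop i.+1 s) count_cat.
apply: leq_trans (leq_addr _ _).
have sz : size (take i.+1 s) = i.+1 by rewrite size_takel.
suff : all p (take i.+1 s) by rewrite all_count => /eqP ->; rewrite sz.
apply/(all_nthP 0) => j; rewrite sz => js; rewrite nth_take//.
exact: nthP.
Qed.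

Lemma sigma_eigen (e : 'I_d -> R) i : (forall k, 0 <= e k) ->
  char_poly (g^T *m g) = \prod_k ('X - (e k)%:P) -> (0 < i <= d)%N ->
  [/\ 0 <= sigma i g, (d - i < #|[set k | (e k <= sigma i g ^+ 2)%R]|)%N &
    (i <= #|[set k | (sigma i g ^+ 2 <= e k)%R]|)%N].
Proof.
move=> e0 pE /andP[i0 id].
have [ss sp sperm] := singular_valuesP e0 pE.
have szs : size (singular_values g) = d.
  by rewrite -(size_map (fun a => a ^+ 2)) (perm_size sperm) size_map -cardE card_ord.
have is_ : (i.-1 < size (singular_values g))%N by rewrite szs prednK.
have s0 : 0 <= sigma i g by rewrite /sigma; move/all_nthP: sp; apply.
have [h1 h2] := count_sorted_ge ss is_; rewrite -/(sigma i g) szs in h1 h2.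
have card_I (p : pred R) : #|[set k | p (e k)]| = count (fun a => p (a ^+ 2)) (singular_values g).
  transitivity (count p [seq a ^+ 2 | a <- singular_values g]); last by rewrite count_map.
  rewrite (permP sperm) count_map -sum1_card -sum1_count big_enum_cond.
  by apply: eq_bigl => k; rewrite inE.
have sq a : a \in singular_values g -> 0 <= a by move/allP: sp; apply.
split => //.
  rewrite (card_I (fun x => x <= sigma i g ^+ 2)).
  rewrite (eq_in_count (a2 := fun a => a <= sigma i g)).
    by apply: leq_trans h1; rewrite -{1}(prednK i0) subnSK ?prednK.
  by move=> a /sq a0 /=; rewrite ler_sqr.
rewrite (card_I (fun x => sigma i g ^+ 2 <= x)).
rewrite (eq_in_count (a2 := fun a => sigma i g <= a)); first by rewrite -{1}(prednK i0).
by move=> a /sq a0 /=; rewrite ler_sqr.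
Qed.

(* The two halves of the Courant-Fischer minimax principle. *)
Lemma sigma_ge i m (U : 'M[R]_(m, d)) c : (0 < i <= \rank U)%N -> 0 <= c ->
  (forall x : 'rV[R]_m, c * enorm (x *m U)^T <= enorm (g *m (x *m U)^T)) ->
  c <= sigma i g.
Proof.
move=> /andP[i0 iU] c0 hc; have [P [e [Pu e0 form pE]]] := gram_diag.
have id : (i <= d)%N := leq_trans iU (rank_leq_col _).
have [s0 cI _] := sigma_eigen e0 pE (introT andP (conj i0 id)).
set I := [set k | _] in cI.
have rk : (d < \rank U + #|I|)%N.
  have : (i + (d - i) < i + #|I|)%N by rewrite ltn_add2l.
  by rewrite subnKC// => /leq_trans; apply; rewrite leq_add2r.
have [w wn0 wI] := eigenspace_meet Pu rk.
have [x [y [nE gE]]] := sqnorm_lift U w.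
have le : sqnorm (w *m map_mx toC U *m map_mx toC g^T) <=
    toC (sigma i g ^+ 2) * sqnorm (w *m map_mx toC U).
  rewrite form -[in leRHS](@sqnorm_unitary _ _ (P ^t*)) ?trmxC_unitary// sqnormE mulr_sumr.
  apply: ler_sum => k _; have [kI|kI] := boolP (k \in I).
    by rewrite ler_wpM2r ?exprn_ge0// lecR; move: kI; rewrite inE.
  by rewrite wI// normr0 expr0n !mulr0.
rewrite nE gE -rmorphM lecR in le.
have np : 0 < enorm (x *m U)^T ^+ 2 + enorm (y *m U)^T ^+ 2.
  rewrite -ltcR -nE sqnormE rmorph0 lt_def sumr_ge0 ?andbT => [|k _]; last by rewrite exprn_ge0.
  rewrite psumr_eq0 => [|k _]; last by rewrite exprn_ge0.
  apply: contra wn0 => /allP h; apply/eqP/rowP => k; rewrite [RHS]mxE.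
  by apply/eqP; have := h k (mem_index_enum _); rewrite /= sqrf_eq0 normr_eq0.
rewrite -ler_sqr ?nnegrE// -(ler_pM2r np); apply: le_trans le.
by rewrite mulrDr -!exprMn lerD// ler_sqr ?nnegrE ?mulr_ge0 ?enorm_ge0.
Qed.

Lemma sigma_le i m (U : 'M[R]_(m, d)) c : (0 < i <= d)%N -> (d < \rank U + i)%N -> 0 <= c ->
  (forall x : 'rV[R]_m, enorm (g *m (x *m U)^T) <= c * enorm (x *m U)^T) ->
  sigma i g <= c.
Proof.
move=> /andP[i0 id] iU c0 hc; have [P [e [Pu e0 form pE]]] := gram_diag.
have [s0 _ cI] := sigma_eigen e0 pE (introT andP (conj i0 id)).
set I := [set k | _] in cI.
have rk : (d < \rank U + #|I|)%N by apply: leq_trans iU _; rewrite leq_add2l.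
have [w wn0 wI] := eigenspace_meet Pu rk.
have [x [y [nE gE]]] := sqnorm_lift U w.
have le : toC (sigma i g ^+ 2) * sqnorm (w *m map_mx toC U) <=
    sqnorm (w *m map_mx toC U *m map_mx toC g^T).
  rewrite form -[in leLHS](@sqnorm_unitary _ _ (P ^t*)) ?trmxC_unitary// sqnormE mulr_sumr.
  apply: ler_sum => k _; have [kI|kI] := boolP (k \in I).
    by rewrite ler_wpM2r ?exprn_ge0// lecR; move: kI; rewrite inE.
  by rewrite wI// normr0 expr0n !mulr0.
rewrite nE gE -rmorphM lecR in le.
have np : 0 < enorm (x *m U)^T ^+ 2 + enorm (y *m U)^T ^+ 2.
  rewrite -ltcR -nE sqnormE rmorph0 lt_def sumr_ge0 ?andbT => [|k _]; last by rewrite exprn_ge0.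
  rewrite psumr_eq0 => [|k _]; last by rewrite exprn_ge0.
  apply: contra wn0 => /allP h; apply/eqP/rowP => k; rewrite [RHS]mxE.
  by apply/eqP; have := h k (mem_index_enum _); rewrite /= sqrf_eq0 normr_eq0.
rewrite -ler_sqr ?nnegrE// -(ler_pM2r np); apply: (le_trans le).
by rewrite mulrDr -!exprMn lerD// ler_sqr ?nnegrE ?mulr_ge0 ?enorm_ge0.
Qed.

End Spectral.

End SpectralTheory.

Section Enorm.
Context {R : realType} {d : nat}.
Implicit Types (v w : 'cV[R]_d).

Definition edot v w : R := \sum_i v i 0 * w i 0.

Lemma cauchy_schwarz v w : edot v w <= enorm v * enorm w.
Proof.
have [->|w0] := eqVneq w 0.
  rewrite /edot big1 => [|i _]; last by rewrite mxE mulr0.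
  by rewrite mulr_ge0// enorm_ge0.
have n0 : 0 < enorm w by rewrite lt_def enorm_ge0 enorm_eq0 w0.
have sqE k : enorm (v - k *: w) ^+ 2 = enorm v ^+ 2 - 2 * k * edot v w + k ^+ 2 * enorm w ^+ 2.
  rewrite !enorm_sqr /edot !mulr_sumr -sumrN -!big_split /=; apply: eq_bigr => i _.
  by rewrite !mxE; ring.
have := sqE (edot v w / enorm w ^+ 2); have := sqr_ge0 (enorm (v - (edot v w / enorm w ^+ 2) *: w)).
move=> h1 h2; rewrite h2 in h1.
have h3 : edot v w ^+ 2 <= (enorm v * enorm w) ^+ 2.
  rewrite exprMn -ler_pdivrMr ?exprn_gt0//.
  have e : enorm v ^+ 2 - 2 * (edot v w / enorm w ^+ 2) * edot v w +
     (edot v w / enorm w ^+ 2) ^+ 2 * enorm w ^+ 2 = enorm v ^+ 2 - edot v w ^+ 2 / enorm w ^+ 2.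
    by field; rewrite gt_eqF.
  by rewrite e subr_ge0 in h1.
have [e0|e0] := ltP (edot v w) 0.
  by apply: (le_trans (ltW e0)); rewrite mulr_ge0// enorm_ge0.
by rewrite -ler_sqr ?nnegrE// mulr_ge0// enorm_ge0.
Qed.

Lemma enormD v w : enorm (v + w) <= enorm v + enorm w.
Proof.
rewrite -ler_sqr ?nnegrE ?addr_ge0 ?enorm_ge0// sqrrD !enorm_sqr.
have := cauchy_schwarz v w; rewrite -(ler_pM2r (ltr0n R 2)) => h.
have -> : \sum_i (v + w) i 0 ^+ 2 = \sum_i v i 0 ^+ 2 + edot v w * 2 + \sum_i w i 0 ^+ 2.
  rewrite /edot mulr_suml -!big_split /=; apply: eq_bigr => i _; rewrite mxE; ring.
by rewrite -mulr_natr; lra.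
Qed.

Lemma enormN v : enorm (- v) = enorm v.
Proof. by rewrite -scaleN1r enormZ normrN normr1 mul1r. Qed.

Lemma enormB v w : enorm (v - w) <= enorm v + enorm w.
Proof. by rewrite -(enormN w); exact: enormD. Qed.

Lemma ev_ebound (f : 'rV[R]_d) : exists2 K, 0 < K & forall v, `|ev f v| <= K * enorm v.
Proof.
have [K K0 hK] := ev_bound f; exists K => // v.
by apply: (le_trans (hK v)); rewrite ler_wpM2l ?norm_le_enorm// ltW.
Qed.

Lemma enorm0 : enorm (0 : 'cV[R]_d) = 0.
Proof. by apply/eqP; rewrite enorm_eq0. Qed.

Lemma enorm_gt0 v : v != 0 -> 0 < enorm v.
Proof. by move=> v0; rewrite lt_def enorm_ge0 enorm_eq0 v0. Qed.
End Enorm.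

(** * Singular values from the sections of a convex body *)

Section Distortion.
Context {R : realType} {d : nat}.
Local Notation V := 'cV[R]_d.
Context {C : set V} {f0 : 'rV[R]_d} (hC : open_cone C f0).

(* Up to the factor kap, the symmetric convex body (C - P) /\ (P - C) is
   uniformly comparable with the image of the unit ball under g. *)
Record distortion (c K kap : R) (g : 'M[R]_d) (P : V) : Prop := Distortion {
  ds_unit : g \in unitmx; ds_c : 0 < c; ds_K : 0 < K; ds_kap : 0 < kap;
  ds_le : forall z, clo C (P + g *m z) -> clo C (P - g *m z) -> enorm z <= K * kap;
  ds_ge : forall z, enorm z <= c * kap -> clo C (P + g *m z) /\ clo C (P - g *m z) }.

Context {c K kap : R} {g : 'M[R]_d} {P : V} (ds : distortion c K kap g P).

Lemma mulmx_row_col m (U : 'M[R]_(m, d)) (x : 'rV[R]_m) :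
  (x *m (U *m (invmx g)^T))^T = invmx g *m (x *m U)^T.
Proof. by rewrite mulmxA trmx_mul trmxK. Qed.

Lemma rank_invg m (U : 'M[R]_(m, d)) : \rank (U *m (invmx g)^T) = \rank U.
Proof. by rewrite mxrankMfree// row_free_unit unitmx_tr unitmx_inv (ds_unit ds). Qed.

(** Courant-Fischer on the preimage of [U] under [g]: vectors of norm [B] in [U] belong to the body,
    so their preimages have norm at most [K * kap]. The rows of [U] span the subspace, whence the
    transpose in [U *m (invmx g)^T]. *)
Lemma sigma_lower i m (U : 'M[R]_(m, d)) B : (0 < i <= \rank U)%N -> 0 < B ->
  (forall v, (v^T <= U)%MS -> enorm v <= B -> clo C (P + v) /\ clo C (P - v)) ->
  B / (K * kap) <= sigma i g.
Proof.
move=> iU B0 h; have gu := ds_unit ds; have Kk := mulr_gt0 (ds_K ds) (ds_kap ds).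
apply: (@sigma_ge _ _ _ _ _ (U *m (invmx g)^T)); rewrite ?rank_invg//.
  by rewrite divr_ge0// ltW.
move=> x; rewrite mulmx_row_col mulKVmx//; set v := (x *m U)^T.
have [v0|v0] := eqVneq v 0; first by rewrite v0 mulmx0 !enorm0 mulr0.
have nv := enorm_gt0 v0.
have vU : (((B / enorm v) *: v)^T <= U)%MS by rewrite linearZ /= trmxK scalemx_sub// submxMl.
have [|h1 h2] := h _ vU.
  by rewrite enormZ gtr0_norm ?divr_gt0// divfK// gt_eqF.
have := ds_le ds (z := invmx g *m ((B / enorm v) *: v)); rewrite mulKVmx//.
move=> /(_ h1 h2); rewrite -scalemxAr enormZ gtr0_norm ?divr_gt0// => h3.
rewrite mulrAC ler_pdivrMr// [leRHS]mulrC.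
by rewrite mulrAC ler_pdivrMr// in h3.
Qed.

Lemma sigma_upper i m (U : 'M[R]_(m, d)) B : (0 < i <= d)%N -> (d < \rank U + i)%N -> 0 <= B ->
  (forall v, (v^T <= U)%MS -> clo C (P + v) -> clo C (P - v) -> enorm v <= B) ->
  sigma i g <= B / (c * kap).
Proof.
move=> id iU B0 h; have gu := ds_unit ds; have ck := mulr_gt0 (ds_c ds) (ds_kap ds).
apply: (@sigma_le _ _ _ _ _ (U *m (invmx g)^T)); rewrite ?rank_invg//.
  by rewrite divr_ge0// ltW.
move=> x; rewrite mulmx_row_col mulKVmx//; set v := (x *m U)^T; set z := invmx g *m v.
have [z0|z0] := eqVneq z 0.
  have -> : v = g *m z by rewrite /z mulKVmx.
  by rewrite z0 mulmx0 !enorm0 mulr0.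
have nz := enorm_gt0 z0.
have vU : (((c * kap / enorm z) *: v)^T <= U)%MS by rewrite linearZ /= trmxK scalemx_sub// submxMl.
have [] := ds_ge ds (z := (c * kap / enorm z) *: z).
  by rewrite enormZ gtr0_norm ?divr_gt0// divfK// gt_eqF.
rewrite -scalemxAr /z mulKVmx// -/z => h1 h2.
have := h _ vU h1 h2; rewrite enormZ gtr0_norm ?divr_gt0// => h3.
rewrite mulrAC ler_pdivlMr// [leLHS]mulrC.
by rewrite mulrAC ler_pdivrMr// in h3.
Qed.

End Distortion.

Lemma pred_bounds (d : nat) : (3 <= d)%N -> (0 < d.-1 <= d)%N /\ (d < 2 + d.-1)%N.
Proof. by case: d => [|[|d]]//= _; rewrite leqnSn !addSn add0n. Qed.

(** * Singular values and the inner and outer radii of the slices *)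

Section Shape.
Context {R : realType} {d : nat} (hd : (3 <= d)%N).
Local Notation V := 'cV[R]_d.
Context {C : set V} {f0 : 'rV[R]_d} (hC : open_cone C f0).
Context {e1 e2 : V} {a b : 'rV[R]_d} (fr : frame C e1 e2 a b).

Lemma frame_neq1 : e1 != 0.
Proof. by apply/eqP => h; have := fra1 fr; rewrite h ev0 => /eqP; rewrite eq_sym oner_eq0. Qed.
Lemma frame_neq2 : e2 != 0.
Proof. by apply/eqP => h; have := frb2 fr; rewrite h ev0 => /eqP; rewrite eq_sym oner_eq0. Qed.

(** Shrink a ball around [e1 + e2] by [s] and add [(1 - s) *: e1]. *)
Lemma frame_ball : exists2 c1, 0 < c1 & forall s u, 0 < s -> s <= 1 -> enorm u <= c1 * s ->
  C (e1 + s *: e2 + u).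
Proof.
have [e e0 he] := oc_open hC (fr12 fr); exists (e / 2); first by rewrite divr_gt0.
move=> s u s0 s1 us.
rewrite (_ : _ + _ = s *: (e1 + e2 + s^-1 *: u) + (1 - s) *: e1).
  apply: (oc_comb hC) => //; [|exact: (fr1 fr)|by rewrite subr_ge0].
  apply: he; apply: (le_lt_trans (norm_le_enorm _)).
  rewrite enormZ gtr0_norm ?invr_gt0// mulrC ltr_pdivrMr//; apply: (le_lt_trans us).
  by rewrite ltr_pM2r// ltr_pdivrMr// ltr_pMr// ltr1n.
by vec_field; rewrite gt_eqF.
Qed.

Lemma rank_span2 (e v : V) (F : 'rV[R]_d) : ev F v = 0 -> ev F e != 0 -> v != 0 ->
  (1 < \rank (e^T + v^T)%MS)%N.
Proof.
move=> Fv Fe v0; rewrite ltnNge; apply: contra Fe => rk.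
have [r1] := mxrank_leqif_eq (addsmxSr e^T v^T).
rewrite eqn_leq r1 rank_rV trmx_eq0 v0 rk => /esym/andP[_ h].
have /submxP[k ek] : (e^T <= v^T)%MS := submx_trans (addsmxSl _ _) h.
have -> : e = k 0 0 *: v.
  by rewrite -[e]trmxK ek [k]mx11_scalar mul_scalar_mx linearZ /= trmxK mxE.
by rewrite evZ Fv mulr0.
Qed.

Lemma span2P (e v x : V) : (x^T <= e^T + v^T)%MS -> exists s t, x = s *: e + t *: v.
Proof.
move=> /sub_addsmxP[[u w]] /= xE; exists (u 0 0), (w 0 0).
rewrite -[x]trmxK xE linearD /= [u]mx11_scalar [w]mx11_scalar !mul_scalar_mx !linearZ /= !trmxK.
by rewrite !mxE.
Qed.

Lemma kerP (F : 'rV[R]_d) (x : V) : (x^T <= kermx F^T)%MS -> ev F x = 0.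
Proof. by move=> /sub_kermxP; rewrite -trmx_mul => /matrixP/(_ 0 0); rewrite !mxE /ev mxE. Qed.

Lemma rank_ker (F : 'rV[R]_d) : (d <= (\rank (kermx F^T)).+1)%N.
Proof.
rewrite mxrank_ker; have := rank_leq_col F^T.
by case: (\rank F^T) => [|[|//]] _; rewrite ?subn0 ?leqnSn// subn1 leqSpred.
Qed.

Context (c K : R) (c0 : 0 < c) (K0 : 0 < K).
Local Notation ds s g kap := (@distortion R d C c K kap g (e1 + s *: e2)).

(** The constant [A] is chosen before [s], [g] and [kap], hence serves all elements of the tracking
    sequence at once. *)
Definition uniformly (Q : R -> 'M[R]_d -> R -> R -> Prop) :=
  exists2 A, 0 < A & forall s g kap, 0 < s -> s <= 1 -> ds s g kap -> Q s g kap A.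

Lemma sigma1_lower : uniformly (fun s g kap A => A / kap <= sigma 1 g).
Proof.
have n1 := enorm_gt0 frame_neq1.
exists (enorm e1 / K); first by rewrite divr_gt0.
move=> s g kap s0 s1 h; have k0 := ds_kap h.
rewrite -mulrA -invfM; apply: (sigma_lower h (U := e1^T)) => //.
  by rewrite rank_rV trmx_eq0 frame_neq1.
move=> v /submxP[k]; rewrite [k]mx11_scalar mul_scalar_mx => vE.
have -> : v = k 0 0 *: e1 by rewrite -[v]trmxK vE linearZ /= trmxK.
rewrite enormZ -[leRHS]mul1r ler_pM2r// ler_norml => /andP[k1 k2].
rewrite (_ : _ + _ = (1 + k 0 0) *: e1 + s *: e2); last by vec_ring.
rewrite (_ : _ - _ = (1 - k 0 0) *: e1 + s *: e2); last by vec_ring.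
have c1 := fr1 fr; have c2 := fr2 fr.
by split; apply: (clo_comb hC) => //; lra.
Qed.

Lemma sigma1_upper : uniformly (fun s g kap A => sigma 1 g <= A / kap).
Proof.
have [L L0 hL] := clo_bnd hC.
have f1 := clo_pos hC (fr1 fr) frame_neq1; have f2 := clo_pos hC (fr2 fr) frame_neq2.
have d0 : 0 < d%:R :> R by rewrite ltr0n (leq_trans _ hd).
pose B := d%:R * (L * (ev f0 e1 + ev f0 e2)).
have B0 : 0 < B by rewrite !mulr_gt0// addr_gt0.
exists (B / c); first by rewrite divr_gt0.
move=> s g kap s0 s1 h; have k0 := ds_kap h.
rewrite -mulrA -invfM; apply: (sigma_upper h (U := 1%:M)); rewrite ?mxrank1 ?addn1 ?(ltW B0)//.
  by rewrite (leq_trans _ hd).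
move=> v _ h1 h2; apply: (le_trans (enorm_le_norm _)); rewrite ler_wpM2l//.
have := hL _ h1; have := hL _ h2; rewrite !evE => g1 g2.
have : `|v| <= (`|e1 + s *: e2 + v| + `|e1 + s *: e2 - v|) / 2.
  rewrite ler_pdivlMr// mulrC -[2]ger0_norm// -normrZ.
  rewrite (_ : 2 *: v = (e1 + s *: e2 + v) - (e1 + s *: e2 - v)); first exact: ler_normB.
  by vec_ring.
have : L * (s * ev f0 e2) <= L * ev f0 e2.
  by rewrite ler_pM2l// ger_pMl.
lra.
Qed.

Lemma sigmad_lower : uniformly (fun s g kap A => A * s / kap <= sigma d g).
Proof.
have [c1 c10 hc1] := frame_ball.
exists (c1 / K); first by rewrite divr_gt0.
move=> s g kap s0 s1 h; have k0 := ds_kap h.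
have -> : c1 / K * s / kap = c1 * s / (K * kap) by rewrite invfM; ring.
apply: (sigma_lower h (U := 1%:M)).
- by rewrite mxrank1 leqnn (leq_trans _ hd).
- by rewrite mulr_gt0.
move=> v _ vs; split; apply: (clo_oc hC); apply: hc1 => //; by rewrite ?enormN.
Qed.

Lemma sigmad_upper : uniformly (fun s g kap A => sigma d g <= A * s / kap).
Proof.
have n2 := enorm_gt0 frame_neq2.
exists (enorm e2 / c); first by rewrite divr_gt0.
move=> s g kap s0 s1 h; have k0 := ds_kap h.
have -> : enorm e2 / c * s / kap = s * enorm e2 / (c * kap) by rewrite invfM; ring.
apply: (sigma_upper h (U := e2^T)).
- by rewrite leqnn (leq_trans _ hd).
- by rewrite rank_rV trmx_eq0 frame_neq2 add1n.
- by rewrite mulr_ge0 ?enorm_ge0// ltW.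
move=> v /submxP[k]; rewrite [k]mx11_scalar mul_scalar_mx => vE.
have -> : v = k 0 0 *: e2 by rewrite -[v]trmxK vE linearZ /= trmxK.
have hb u : clo C u -> 0 <= ev b u by apply: (clo_ge0 hC) => x /(frb fr)/ltW.
move=> /hb h1 /hb h2; move: h1 h2; rewrite !evE (frb1 fr) (frb2 fr) => h1 h2.
by rewrite enormZ ler_pM2r// ler_norml; apply/andP; split; lra.
Qed.

Lemma clo_frame s t w : 0 <= s -> 0 <= t -> clo C w -> clo C (w + (s *: e1 + t *: e2)).
Proof.
by move=> s0 t0 cw; apply: cloD => //; apply: (clo_comb hC); [exact: (fr1 fr)|exact: (fr2 fr)| |].
Qed.

(** The form [b] bounds the [e2] component by the height. Weights [(1 / 2 + z) / 2] and
    [(1 / 2 - z) / 2] on the two given points leave enough of [e1] and [e2] to cancel that component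
    and return to the slice at height [s]. *)
Lemma clo_height s x w y : clo C (e1 + s *: e2 + (x *: w + y *: e2)) ->
  clo C (e1 + s *: e2 - (x *: w + y *: e2)) -> ev b w = 0 ->
  `|y| <= s /\ forall z, `|z| <= 1 / 2 -> clo C (e1 + (z * x) *: w + s *: e2).
Proof.
have hb u : clo C u -> 0 <= ev b u by apply: (clo_ge0 hC) => v /(frb fr)/ltW.
move=> h1 h2 bw.
have ys : `|y| <= s.
  have := hb _ h1; have := hb _ h2; rewrite !evE (frb1 fr) (frb2 fr) bw => g1 g2.
  by rewrite ler_norml; apply/andP; split; lra.
split => // z; rewrite ler_norml => /andP[z1 z2].
move: ys; rewrite ler_norml => /andP[y1 y2].
rewrite (_ : _ + _ = ((1 / 2 + z) / 2 *: (e1 + s *: e2 + (x *: w + y *: e2)) +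
   (1 / 2 - z) / 2 *: (e1 + s *: e2 - (x *: w + y *: e2))) + ((1 / 2) *: e1 + (s / 2 - z * y) *: e2)).
  apply: clo_frame; [lra|nra|].
  by apply: (clo_comb hC) => //; lra.
by vec_field.
Qed.

(** The test plane is spanned by [e2] and [w]. In the body the [w] component is at most 2, because
    [w] is outside the slice. The [e2] component is at most [s], which is itself at most
    [enorm w / c1], because the slice contains the ball of radius [c1 * s]. *)
Lemma sigma_dm1_upper : uniformly (fun s g kap A => forall w, ev a w = 0 -> ev b w = 0 ->
  ~ C (e1 + w + s *: e2) -> sigma d.-1 g <= A * enorm w / kap).
Proof.
have [c1 c10 hc1] := frame_ball.
have n2 := enorm_gt0 frame_neq2.
exists ((2 + enorm e2 / c1) / c); first by rewrite divr_gt0// addr_gt0// divr_gt0.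
move=> s g kap s0 s1 h w aw bw nw; have k0 := ds_kap h.
have CA := frame_axis hC fr s0.
have w0 : w != 0 by apply/eqP => w0; apply: nw; rewrite w0 addr0.
have nw0 := enorm_gt0 w0.
have sw : s <= enorm w / c1.
  rewrite ler_pdivlMr// mulrC leNgt; apply/negP => /ltW /(hc1 _ _ s0 s1).
  by rewrite addrAC.
have -> : (2 + enorm e2 / c1) / c * enorm w / kap = (2 * enorm w + enorm w / c1 * enorm e2) / (c * kap).
  by rewrite invfM; ring.
apply: (sigma_upper h (U := (e2^T + w^T)%MS)).
- by have [] := pred_bounds hd.
- have e20 : ev b e2 != 0 by rewrite (frb2 fr) oner_neq0.
  have [_ d2] := pred_bounds hd; apply: (leq_trans d2).
  by rewrite leq_add2r (rank_span2 bw).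
- by rewrite addr_ge0// mulr_ge0// ?divr_ge0// ltW.
move=> v /span2P[y [x ->]]; rewrite [y *: e2 + _]addrC => g1 g2.
have [ys hz] := clo_height g1 g2 bw.
have x2 : `|x| <= 2.
  rewrite leNgt; apply/negP => x2; apply: nw.
  have x0 : x != 0 by apply: contraTneq x2 => ->; rewrite normr0 -leNgt.
  have nx : 0 < `|x| by rewrite normr_gt0.
  have : clo C (e1 + (`|x| / (2 * x) * x) *: w + s *: e2).
    apply: hz; rewrite normf_div normr_id normrM ger0_norm//.
    by rewrite le_eqVlt; apply/orP; left; apply/eqP; field; rewrite gt_eqF.
  have -> : `|x| / (2 * x) * x = `|x| / 2 by field.
  move=> cx; rewrite (_ : _ + _ = (1 - 2 / `|x|) *: (e1 + s *: e2) +
     (2 / `|x|) *: (e1 + (`|x| / 2) *: w + s *: e2)).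
    apply: (oc_comb hC) => //.
    by rewrite subr_gt0 ltr_pdivrMr// mul1r.
  by vec_field; rewrite normr_eq0.
apply: (le_trans (enormD _ _)); rewrite !enormZ.
have g3 := ler_wpM2r (ltW nw0) x2.
have g4 := ler_wpM2r (ltW n2) (le_trans ys sw).
lra.
Qed.

Lemma a_split v : ev b v = 0 -> ev a (v - ev a v *: e1) = 0 /\ ev b (v - ev a v *: e1) = 0.
Proof. by move=> bv; rewrite !evE (fra1 fr) (frb1 fr) bv; split; ring. Qed.

Lemma clo_half s x w : 0 < s -> `|x| <= 1 / 2 ->
  clo C (e1 + 2 *: w + s *: e2) -> clo C (e1 + s *: e2 + (x *: e1 + w)).
Proof.
move=> s0; rewrite ler_norml => /andP[x1 x2] h.
rewrite (_ : _ + _ = (1 / 2) *: (e1 + 2 *: w + s *: e2) + ((1 / 2 + x) *: e1 + (s / 2) *: e2)).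
  apply: clo_frame; [lra|lra|]; apply: (cloZ hC) => //; lra.
by vec_field.
Qed.

(** The test space is the hyperplane [b = 0]. The constant [B] is so small that a vector of norm at
    most [B * rho] has [e1] component at most 1/2 and twice its transverse part in the ball of
    radius [rho], as [clo_half] requires. *)
Lemma sigma_dm1_lower : uniformly (fun s g kap A => forall rho, 0 < rho -> rho <= 1 ->
  (forall w, ev a w = 0 -> ev b w = 0 -> enorm w <= rho -> clo C (e1 + w + s *: e2)) ->
  A * rho / kap <= sigma d.-1 g).
Proof.
have [Ka Ka0 hKa] := ev_ebound a.
have n1 := enorm_gt0 frame_neq1.
pose B := (2 * (1 + Ka + Ka * enorm e1))^-1.
have D0 : 0 < 2 * (1 + Ka + Ka * enorm e1).
  by rewrite mulr_gt0// addr_gt0 ?mulr_gt0// addr_gt0.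
have B0 : 0 < B by rewrite invr_gt0.
have BE : B * (2 * (1 + Ka + Ka * enorm e1)) = 1 by rewrite mulVf// gt_eqF.
have BKa : 0 < B * Ka by rewrite mulr_gt0.
have BKe : 0 < B * Ka * enorm e1 by rewrite mulr_gt0.
exists (B / K); first by rewrite divr_gt0.
move=> s g kap s0 s1 h rho r0 r1 hr; have k0 := ds_kap h.
have -> : B / K * rho / kap = B * rho / (K * kap) by rewrite invfM; ring.
apply: (sigma_lower h (U := kermx b^T)).
- have [/andP[-> _] _] := pred_bounds hd.
  by rewrite -ltnS prednK ?rank_ker// (leq_trans _ hd).
- by rewrite mulr_gt0.
move=> v /kerP bv vB; have [aw bw] := a_split bv.
set w := v - ev a v *: e1 in aw bw.
have av : `|ev a v| <= B * Ka * rho.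
  by apply: (le_trans (hKa v)); rewrite -mulrA mulrCA ler_pM2l.
have av2 : `|ev a v| <= 1 / 2 by apply: (le_trans av); nra.
have wB : enorm (2 *: w) <= rho.
  rewrite enormZ ger0_norm//; have : enorm w <= enorm v + `|ev a v| * enorm e1.
    by rewrite -enormZ; exact: enormB.
  have := ler_wpM2r (ltW n1) av; nra.
have vE : v = ev a v *: e1 + w by rewrite addrC subrK.
split.
  rewrite vE; apply: clo_half => //; apply: hr => //; by rewrite evZ ?aw ?bw mulr0.
have -> : - v = (- ev a v) *: e1 + - w by rewrite {1}vE opprD scaleNr.
apply: clo_half => //; first by rewrite normrN.
rewrite scalerN; apply: hr; rewrite ?evN ?evZ ?aw ?bw ?mulr0 ?oppr0//.
by rewrite enormN.
Qed.

Lemma clo_between dl s w y : 0 < s -> 0 < dl -> dl <= 1 -> clo C (e1 + w + s *: e2) ->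
  clo C (e1 - dl *: w + s *: e2) -> `|y| <= dl -> clo C (e1 + y *: w + s *: e2).
Proof.
move=> s0 d0 d1 h1 h2; have CA := clo_oc hC (frame_axis hC fr s0).
have [y0|y0] := leP 0 y; [rewrite ger0_norm|rewrite ltr0_norm] => // yd.
  rewrite (_ : _ + _ = y *: (e1 + w + s *: e2) + (1 - y) *: (e1 + s *: e2)).
    by apply: (clo_comb hC) => //; lra.
  by vec_ring.
rewrite (_ : _ + _ = (- y / dl) *: (e1 - dl *: w + s *: e2) + (1 - - y / dl) *: (e1 + s *: e2)).
  apply: (clo_comb hC) => //; first by rewrite divr_ge0 ?ltW// oppr_gt0.
  by rewrite subr_ge0 ler_pdivrMr// mul1r.
by vec_field; rewrite gt_eqF.
Qed.

(** Membership of [w] alone leaves [ev f0 w] unbounded above. The opposite point over [- dl *: w]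
    bounds it, since [f0] is nonnegative there, and [clo_bnd] then bounds the norm. *)
Lemma slice_bounded dl : 0 < dl -> dl <= 1 -> exists2 W, 0 < W & forall s w, 0 < s -> s <= 1 ->
  clo C (e1 + w + s *: e2) -> clo C (e1 - dl *: w + s *: e2) -> enorm w <= W.
Proof.
move=> d0 d1; have [L L0 hL] := clo_bnd hC.
have f1 := clo_pos hC (fr1 fr) frame_neq1; have f2 := clo_pos hC (fr2 fr) frame_neq2.
have n1 := enorm_gt0 frame_neq1; have n2 := enorm_gt0 frame_neq2.
have dp : 0 < d%:R :> R by rewrite ltr0n (leq_trans _ hd).
set F := ev f0 e1 + ev f0 e2; have F0 : 0 < F by rewrite addr_gt0.
exists (d%:R * (L * (F + F / dl)) + enorm e1 + enorm e2).
  by rewrite !addr_gt0// !mulr_gt0// addr_gt0// divr_gt0.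
move=> s w s0 s1 h1 h2.
have g2 := clo_f0 hC h2; rewrite !evE in g2.
have sf : s * ev f0 e2 <= ev f0 e2 by rewrite ger_pMl.
have fw : ev f0 w <= F / dl by rewrite ler_pdivlMr// mulrC /F; lra.
have k1 := hL _ h1; rewrite !evE in k1.
have -> : w = (e1 + w + s *: e2) - e1 - s *: e2 by vec_ring.
apply: (le_trans (enormB _ _)); apply: lerD; last first.
  by rewrite enormZ gtr0_norm// ger_pMl.
apply: (le_trans (enormB _ _)); rewrite lerD2r.
apply: (le_trans (enorm_le_norm _)); rewrite ler_wpM2l ?(ltW dp)//.
have FE : F = ev f0 e1 + ev f0 e2 by [].
by apply: (le_trans k1); rewrite ler_wpM2l ?(ltW L0)//; lra.
Qed.

(** The test plane is spanned by [e1] and [w]; roundness allows both signs of the [w] component. The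
    two summands of [D] below make the [e1] component at most 1/2 and the [w] component at most
    [dl / 2]. *)
Lemma sigma2_lower dl : 0 < dl -> dl <= 1 -> uniformly (fun s g kap A => forall w,
  ev a w = 0 -> ev b w = 0 -> C (e1 + w + s *: e2) -> clo C (e1 - dl *: w + s *: e2) ->
  A * enorm w / kap <= sigma 2 g).
Proof.
move=> d0 d1.
have [Ka Ka0 hKa] := ev_ebound a; have [W W0 hW] := slice_bounded d0 d1.
have n1 := enorm_gt0 frame_neq1.
have Q0 : 0 < (1 + Ka * enorm e1) / dl by rewrite divr_gt0// addr_gt0// mulr_gt0.
have KW : 0 < Ka * W by rewrite mulr_gt0.
pose D := 2 * (Ka * W + (1 + Ka * enorm e1) / dl).
have D0 : 0 < D by rewrite mulr_gt0// addr_gt0.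
have BD : D^-1 * D = 1 by rewrite mulVf// gt_eqF.
have B0 : 0 < D^-1 by rewrite invr_gt0.
set B := D^-1 in BD B0.
have b1 : B * (Ka * W) <= 1 / 2.
  have : 0 <= B * ((1 + Ka * enorm e1) / dl) by rewrite mulr_ge0// ltW.
  by rewrite /D in BD; lra.
have b2 : B * (1 + Ka * enorm e1) <= dl / 2.
  have : B * ((1 + Ka * enorm e1) / dl) <= 1 / 2.
    have : 0 <= B * (Ka * W) by rewrite mulr_ge0// ltW.
    by rewrite /D in BD; lra.
  by rewrite mulrA ler_pdivrMr//; lra.
exists (B / K); first by rewrite divr_gt0.
move=> s g kap s0 s1 h w aw bw Cw cw; have k0 := ds_kap h.
have [w0|w0] := eqVneq w 0.
  rewrite w0 enorm0 mulr0 mul0r; apply: (@sigma_ge _ _ _ _ _ 1%:M) => //.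
    by rewrite mxrank1 (leq_trans _ hd).
  by move=> x; rewrite mul0r enorm_ge0.
have nw := enorm_gt0 w0.
have -> : B / K * enorm w / kap = B * enorm w / (K * kap) by rewrite invfM; ring.
have ae1 : ev a e1 != 0 by rewrite (fra1 fr) oner_neq0.
apply: (sigma_lower h (U := (e1^T + w^T)%MS)).
- exact: (rank_span2 aw).
- by rewrite mulr_gt0.
move=> v /span2P[x [y vE]] vB.
have av : ev a v = x by rewrite vE !evE aw (fra1 fr); ring.
have x1 : `|x| <= Ka * (B * enorm w).
  by rewrite -av; apply: (le_trans (hKa v)); rewrite ler_wpM2l// ltW.
have x2 : `|x| <= 1 / 2.
  apply: (le_trans x1); apply: le_trans b1; rewrite mulrCA ler_wpM2l ?(ltW B0)//.
  by rewrite ler_wpM2l ?(ltW Ka0)// (hW s)//; exact: (clo_oc hC).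
have y2 : `|y| <= dl / 2.
  rewrite -(ler_pM2r nw) -enormZ.
  have -> : y *: w = v - x *: e1 by rewrite vE addrC addKr.
  apply: (le_trans (enormB _ _)); rewrite enormZ.
  have := ler_wpM2r (ltW n1) x1; have := ler_wpM2r (ltW nw) b2; lra.
have y3 : `|2 * y| <= dl by rewrite normrM ger0_norm//; lra.
have y4 : `|- (2 * y)| <= dl by rewrite normrN.
split.
  rewrite vE; apply: clo_half => //; rewrite scalerA.
  by apply: (clo_between s0 d0 d1) => //; exact: (clo_oc hC).
have -> : - v = (- x) *: e1 + (- y) *: w by rewrite vE opprD !scaleNr.
apply: clo_half => //; first by rewrite normrN.
rewrite scalerA mulrN; apply: (clo_between s0 d0 d1) => //; exact: (clo_oc hC).
Qed.

(** Two forms have a common zero because [d] is at least 3. The vector [s *: w] in the slice at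
    height [s] shows that the slices have size at least of order [s]. *)
Lemma frame_transverse : exists w, [/\ w != 0, ev a w = 0, ev b w = 0 &
  forall s, 0 < s -> s <= 1 -> C (e1 + s *: w + s *: e2)].
Proof.
pose A := col_mx a b.
have rA : (0 < \rank (kermx A^T))%N.
  rewrite mxrank_ker subn_gt0; apply: leq_ltn_trans hd.
  by rewrite rank_leq_col.
have [|x xA x0] := @rowV0Pn _ _ _ (kermx A^T) _; first by rewrite -mxrank_eq0 -lt0n.
have : A *m x^T = 0 by rewrite -[A]trmxK -trmx_mul (sub_kermxP xA) trmx0.
rewrite mul_col_mx => /eqP; rewrite col_mx_eq0 => /andP[/eqP ax /eqP bx].
have [c1 c10 hc1] := frame_ball.
have xt : x^T != 0 by rewrite trmx_eq0.
have nx := enorm_gt0 xt.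
exists ((c1 / enorm x^T) *: x^T); rewrite !evZ /ev ax bx !mxE mulr0; split => //.
  by rewrite scaler_eq0 negb_or xt andbT gt_eqF// divr_gt0.
move=> s s0 s1; rewrite addrAC; apply: hc1 => //.
by rewrite !enormZ !gtr0_norm ?divr_gt0// divfK 1?mulrC// gt_eqF.
Qed.

(** The test hyperplane is [a = 0]. A transverse vector shows that [rho] is at least [s * enorm w0],
    so the [e2] component, which is at most [s], is also of order [rho]. *)
Lemma sigma2_upper : uniformly (fun s g kap A => forall rho,
  (forall w, ev a w = 0 -> ev b w = 0 -> C (e1 + w + s *: e2) -> enorm w <= rho) ->
  sigma 2 g <= A * rho / kap).
Proof.
have [w0 [w0n aw0 bw0 Cw0]] := frame_transverse.
have n2 := enorm_gt0 frame_neq2; have nw0 := enorm_gt0 w0n.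
exists ((4 + enorm e2 / enorm w0) / c); first by rewrite divr_gt0// addr_gt0// divr_gt0.
move=> s g kap s0 s1 h rho hr; have k0 := ds_kap h.
have CA := frame_axis hC fr s0.
have srho : s * enorm w0 <= rho.
  rewrite -[s in s * _]gtr0_norm// -enormZ; apply: hr; rewrite ?evZ ?aw0 ?bw0 ?mulr0//.
  exact: Cw0.
have rho0 : 0 <= rho by apply: le_trans srho; rewrite mulr_ge0// ltW.
have -> : (4 + enorm e2 / enorm w0) / c * rho / kap = (4 * rho + rho / enorm w0 * enorm e2) / (c * kap).
  by rewrite invfM; ring.
apply: (sigma_upper h (U := kermx a^T)).
- by rewrite (leq_trans _ hd).
- by rewrite addn2 !ltnS rank_ker.
- apply: addr_ge0; first by rewrite mulr_ge0.
  by apply: mulr_ge0; [apply: divr_ge0 => //|]; exact: ltW.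
move=> v /kerP av.
pose w := v - ev b v *: e2.
have aw : ev a w = 0 by rewrite !evE av (fra2 fr); ring.
have bw : ev b w = 0 by rewrite !evE (frb2 fr); ring.
have vE : v = 1 *: w + ev b v *: e2 by rewrite scale1r subrK.
rewrite {1 2}vE => g1 g2; have [ys hz] := clo_height g1 g2 bw.
have w4 : enorm w <= 4 * rho.
  rewrite -ler_pdivrMl// -[4^-1]gtr0_norm ?invr_gt0// -enormZ.
  apply: hr; rewrite ?evZ ?aw ?bw ?mulr0//.
  rewrite (_ : _ + _ = (1 / 2) *: (e1 + s *: e2) + (1 / 2) *: (e1 + (1 / 2 * 1) *: w + s *: e2)).
    have h2 : clo C (e1 + (1 / 2 * 1) *: w + s *: e2) by apply: hz; rewrite ger0_norm//; lra.
    by apply: (oc_comb hC) => //; lra.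
  by vec_field.
rewrite vE scale1r; apply: (le_trans (enormD _ _)); rewrite enormZ lerD//.
by apply: (ler_wpM2r (ltW n2)); apply: (le_trans ys); rewrite ler_pdivlMr.
Qed.

End Shape.

(** * The cone over a properly convex domain *)

Section AxisDist.
Context {R : realType} {d : nat}.
Local Notation V := 'cV[R]_d.
Context {C : set V} {f0 : 'rV[R]_d} (hC : open_cone C f0).
Context {D : V -> V -> R} (hD : hilbert_like C D).

Lemma axis_dist e1 e2 a b s t : frame C e1 e2 a b -> 0 < s -> s <= t ->
  2 * D (e1 + s *: e2) (e1 + t *: e2) = ln t - ln s.
Proof.
move=> fr s0 st; have t0 := lt_le_trans s0 st.
have Cs := frame_axis hC fr s0; have Ct := frame_axis hC fr t0.
apply/eqP; rewrite eq_le; apply/andP; split.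
  rewrite mulrC -ler_pdivlMr//; apply: (hl_upper hD (k := s / t) (l := 1)) => //.
  - by rewrite divr_gt0.
  - rewrite mulrC divfK// opprB -lnV ?posrE// -lnM ?posrE ?invr_gt0//.
    by rewrite lnK ?posrE ?divr_gt0// mulr1.
  - rewrite (_ : _ - _ = (1 - s / t) *: e1).
      by apply: (cloZ hC) (fr1 fr); rewrite subr_ge0 ler_pdivrMr// mul1r.
    by vec_field; rewrite gt_eqF.
  - rewrite (_ : _ - _ = (t - s) *: e2).
      by apply: (cloZ hC) (fr2 fr); rewrite subr_ge0.
    by vec_ring.
have := hl_lower hC hD Cs Ct (fra fr) (frb fr).
rewrite !evE (fra1 fr) (fra2 fr) (frb1 fr) (frb2 fr) !mulr0 !addr0 !add0r !mulr1 !mul1r => h.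
rewrite -ler_expR expRD expRN !lnK ?posrE//.
by rewrite ler_pdivrMr.
Qed.
End AxisDist.

Lemma le_log_contra (R : realType) (a b n u : R) :
  2 * u = a - b -> a <= 0 -> - b <= n -> n + 1 <= u -> 0 <= u -> False.
Proof. by move=> *; lra. Qed.

Section Powers.
Context {R : realType}.
Implicit Types p x y c : R.

Lemma le_powR p x y : 0 <= p -> 0 <= x -> x <= y -> x `^ p <= y `^ p.
Proof. by move=> p0 x0 xy; apply: ge0_ler_powR => //; rewrite nnegrE// (le_trans x0). Qed.

Lemma powRK p x : 0 < p -> 0 <= x -> (x `^ p) `^ p^-1 = x.
Proof. by move=> p0 x0; rewrite -powRrM mulfV ?gt_eqF// powRr1. Qed.

Lemma powRVK p x : 0 < p -> 0 <= x -> (x `^ p^-1) `^ p = x.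
Proof. by move=> p0 x0; rewrite -powRrM mulVf ?gt_eqF// powRr1. Qed.

Lemma small_powR p c : 0 < p -> 0 < c ->
  exists2 x1, 0 < x1 & forall x, 0 <= x -> x <= x1 -> x `^ p <= c.
Proof.
move=> p0 c0; exists (c `^ p^-1); first exact: powR_gt0.
by move=> x x0 xx; rewrite -[leRHS](powRVK p0 (ltW c0)) le_powR// ltW.
Qed.

Lemma small_le_powR p c : 0 < p -> p < 1 -> 0 < c ->
  exists2 x1, 0 < x1 & forall x, 0 < x -> x <= x1 -> x <= c * x `^ p.
Proof.
move=> p0 p1 c0; have q0 : 0 < 1 - p by rewrite subr_gt0.
have [x1 x10 hx] := small_powR q0 c0; exists x1 => // x x0 xx.
have xE : x = x `^ (1 - p) * x `^ p.
  rewrite -powRD ?subrK ?powRr1 ?(ltW x0)//.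
  by apply/implyP => _; rewrite gt_eqF.
by rewrite {1}xE ler_wpM2r ?powR_ge0// hx// ltW.
Qed.

End Powers.

Section Domain.
Context {R : realType} {d : nat}.
Local Notation V := 'cV[R]_d.
Local Notation P := (projspace R d).
Context {Omega : set P} {x0 : P} {f0 : 'rV[R]_d} (Ox0 : Omega x0)
  (oO : open Omega) (hch : closure Omega `<=` chart f0)
  (hcv : convex_set (affpt f0 @` Omega))
  (hbd : exists K : R, forall x, closure Omega x -> enorm (affpt f0 x) <= K).
Local Notation prj := (prj x0).

Definition cone : set V := [set v | 0 < ev f0 v /\ Omega (prj v)].

Lemma ev_neq0 (f : 'rV[R]_d) v : ev f v != 0 -> v != 0.
Proof. by apply: contraNneq => ->; rewrite ev0. Qed.

Lemma cone_neq0 v : cone v -> v != 0.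
Proof. by move=> [v0 _]; apply: (@ev_neq0 f0); rewrite gt_eqF. Qed.

Lemma Omega_lift x : Omega x -> exists2 v, cone v & x = prj v.
Proof.
move=> Ox; have /= h := hch (subset_closure Ox).
have xE := prjK x0 x.
have [v0|v0] := ltP 0 (ev f0 (homog x)).
  by exists (homog x) => //; split => //; rewrite xE.
exists ((-1) *: homog x); last by rewrite prjZ// oppr_eq0 oner_neq0.
split; last by rewrite prjZ ?xE// oppr_eq0 oner_neq0.
by rewrite evZ mulN1r oppr_gt0 lt_def v0 andbT eq_sym; exact: h.
Qed.

Lemma cone_scale k v : 0 < k -> cone v -> cone (k *: v).
Proof. by move=> k0 [v0 Ov]; split; rewrite ?evZ ?mulr_gt0// prjZ// gt_eqF. Qed.

Lemma cone_convex v w : cone v -> cone w -> cone (v + w).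
Proof.
move=> Cv Cw; have [v0 Ov] := Cv; have [w0 Ow] := Cw.
have vw0 : 0 < ev f0 v + ev f0 w by rewrite addr_gt0.
split; first by rewrite evD.
(* The normalized sum [v + w] is the barycenter of the normalized vectors with weights proportional
   to [ev f0 v] and [ev f0 w]. *)
pose k := ev f0 v / (ev f0 v + ev f0 w).
have k0 : 0 <= k by rewrite divr_ge0// ltW.
have k1 : k <= 1 by rewrite ler_pdivrMr// mul1r lerDl ltW.
have m1 : affpt f0 (prj v) \in (affpt f0 @` Omega : set (convex_lmodType V)).
  by apply/mem_set; exists (prj v).
have m2 : affpt f0 (prj w) \in (affpt f0 @` Omega : set (convex_lmodType V)).
  by apply/mem_set; exists (prj w).
have /set_mem [y Oy] := hcv (Itv01 k0 k1) m1 m2.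
have [u Cu ->] := Omega_lift Oy; have [u0 Ou] := Cu.
rewrite !affpt_prj ?cone_neq0// => h.
have -> : v + w = ((ev f0 v + ev f0 w) / ev f0 u) *: u.
  rewrite -scalerA h /conv /= /unstable.onem.
  by apply/colP => i; rewrite !mxE /k; field; rewrite !gt_eqF.
by rewrite prjZ// mulf_neq0 ?invr_eq0// gt_eqF.
Qed.

Lemma cone_open_cone : open_cone cone f0.
Proof.
split.
- exact: cone_convex.
- exact: cone_scale.
- move=> v Cv; have [v0 Ov] := Cv.
  have [e e0 he] := prj_nbhs (cone_neq0 Cv) (open_nbhs_nbhs (conj oO Ov)).
  have [K K0 hK] := ev_bound f0.
  exists (Num.min e (ev f0 v / K)); first by rewrite lt_min e0 divr_gt0.
  move=> u; rewrite lt_min ltr_pdivlMr// => /andP[ue uK]; split; last by case: (he u ue).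
  rewrite evD; have := hK u; have := ler_norm (- ev f0 u); rewrite normrN.
  by rewrite mulrC in uK; lra.
- by have [v Cv _] := Omega_lift Ox0; exists v.
- by move=> v [].
- have [K hK] := hbd; exists (`|K| + 1); first by rewrite ltr_wpDl.
  move=> v Cv; have [v0 Ov] := Cv.
  have := hK _ (subset_closure Ov); rewrite affpt_prj ?cone_neq0// enormZ.
  rewrite gtr0_norm ?invr_gt0// mulrC ler_pdivrMr// => h.
  apply: (le_trans (norm_le_enorm v)); apply: (le_trans h).
  apply: ler_wpM2r; first exact: ltW.
  by rewrite (le_trans (ler_norm _))// lerDl.
Qed.
Let hC : open_cone cone f0 := cone_open_cone.
Local Notation C := cone.

Lemma Omega_prj v : v != 0 -> Omega (prj v) <-> cone v \/ cone (- v).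
Proof.
move=> v0; split=> [Ov|[[]//|[_]]]; last by rewrite -scaleN1r prjZ// oppr_eq0 oner_neq0.
have : ev f0 v != 0 by apply/(chart_prj x0 _ v0)/hch/subset_closure.
rewrite neq_lt => /orP[h|h]; [right|left] => //; split; rewrite ?evN ?oppr_gt0//.
by rewrite -scaleN1r prjZ// oppr_eq0 oner_neq0.
Qed.

Lemma clo_openN u x : cone x -> ~ cone (u + x) -> exists2 e, 0 < e &
  forall w, `|w| < e -> ~ clo cone (u + w).
Proof.
move=> Cx nC; have [e e0 he] := oc_open hC Cx; exists e => // w we cw; apply: nC.
have -> : u + x = (u + w) + (x + - w) by rewrite addrACA subrr addr0.
by apply: cw; apply: he; rewrite normrN.
Qed.

(** The vectors [u] with neither [u] nor [- u] in the closed cone form an open set invariant under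
    nonzero scalars. It therefore defines an open set of the projective space, and that set misses
    [Omega]. *)
Lemma closure_prj v : v != 0 -> closure Omega (prj v) <-> clo cone v \/ clo cone (- v).
Proof.
move=> v0; split; last first.
  have imp (w : V) : w != 0 -> clo cone w -> closure Omega (prj w).
    move=> w0 cw U hU; have [e e0 he] := prj_nbhs w0 hU.
    have [x Cx] := oc_inh hC.
    have x1 : 0 < `|x| + 1 by rewrite ltr_wpDl.
    pose t := e / 2 / (`|x| + 1); have t0 : 0 < t by rewrite !divr_gt0.
    have tx : `|t *: x| < e.
      have tE : t * (`|x| + 1) = e / 2 by rewrite /t divfK// gt_eqF.
      by rewrite normrZ gtr0_norm//; lra.
    exists (prj (w + t *: x)); split; last by case: (he _ tx).
    by have [] : cone (w + t *: x) by apply/cw/cone_scale.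
  move=> [h|h]; first exact: imp.
  by rewrite -[v]opprK -scaleN1r prjZ ?oppr_eq0 ?oner_neq0//; apply: imp; rewrite ?oppr_eq0.
move=> cv; apply: contrapT => /not_orP[n1 n2].
pose A := [set u : V | ~ clo cone u /\ ~ clo cone (- u)].
have Ak k u : k != 0 -> A u -> A (k *: u).
  rewrite neq_lt => /orP[k0|k0] [a1 a2]; last first.
    split=> h; [apply: a1|apply: a2]; apply: (cloZ_inv hC k0) => //.
    by rewrite scalerN.
  have kN : 0 < - k by rewrite oppr_gt0.
  split=> h; [apply: a2|apply: a1]; apply: (cloZ_inv hC kN).
    by rewrite scalerN scaleNr opprK.
  by rewrite scaleNr.
have Ao u : u != 0 -> A u -> exists2 e, 0 < e & forall w, `|w| < e -> A (u + w).
  move=> _ [a1 a2].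
  have nclo (y : V) : ~ clo cone y -> exists2 e, 0 < e & forall w, `|w| < e -> ~ clo cone (y + w).
    by move=> /existsNP[x /not_implyP[Cx nCx]]; exact: clo_openN nCx.
  have [e e0 he] := nclo _ a1; have [e' e'0 he'] := nclo _ a2.
  exists (Num.min e e'); first by rewrite lt_min e0.
  by move=> w; rewrite lt_min => /andP[we we']; split; [exact: he|rewrite opprD; apply: he'; rewrite normrN].
have oA := open_prj Ak Ao.
have Av : [set x : P | A (homog x)] (prj v).
  by have [k k0 /= ->] := homog_prj x0 v0; apply: Ak.
have [y [Oy]] := cv _ (open_nbhs_nbhs (conj oA Av)).
have [u Cu ->] := Omega_lift Oy.
have [k k0 /= ->] := homog_prj x0 (cone_neq0 Cu).
have ki : k^-1 != 0 by rewrite invr_eq0.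
by move=> /(Ak _ _ ki); rewrite scalerA mulVf// scale1r => -[h _]; apply/h/(clo_oc hC).
Qed.

Lemma interior_Omega : interior Omega = Omega.
Proof. exact/interior_id. Qed.

Lemma bdry_prj v : v != 0 -> clo cone v -> bdry Omega (prj v) <-> ~ cone v.
Proof.
move=> v0 cv; rewrite /bdry interior_Omega; split=> [[_ nO] Cv|nC].
  by apply: nO; case: Cv.
split; first by apply/closure_prj => //; left.
move=> /(Omega_prj v0)[//|CN]; apply: (ocN0 hC).
by rewrite -(subrr v); exact: cv.
Qed.

Lemma bdry_lift x : bdry Omega x -> exists v, [/\ v != 0, clo cone v, ~ cone v & x = prj v].
Proof.
move=> bx; have := bx; rewrite -(prjK x0 x); set v := homog x => bv.
have v0 : v != 0 := homog_neq0 x.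
have [cv|cv] : clo cone v \/ clo cone (- v) by apply/closure_prj => //; case: bv.
  by exists v; split => //; apply/bdry_prj.
have vN : - v != 0 by rewrite oppr_eq0.
have vE : prj v = prj (- v) by rewrite -scaleN1r prjZ// oppr_eq0 oner_neq0.
by exists (- v); split => //; rewrite vE in bv; apply/bdry_prj.
Qed.

(* Every affine chart around the closure of Omega is given, up to sign, by a
   linear form which is positive on the cone. *)
Lemma chart_sign f : closure Omega `<=` chart f ->
  exists2 s : R, s ^+ 2 = 1 & forall v, v != 0 -> clo cone v -> 0 < s * ev f v.
Proof.
move=> hf; have [x Cx] := oc_inh hC.
have fn0 v : v != 0 -> clo cone v -> ev f v != 0.
  by move=> v0 cv; apply/(chart_prj x0 _ v0)/hf/closure_prj => //; left.
pose s : R := if 0 < ev f x then 1 else -1.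
have s2 : s ^+ 2 = 1 by rewrite /s; case: ifP; rewrite ?expr1n ?sqrrN ?expr1n.
have sx : 0 < s * ev f x.
  have := fn0 x (cone_neq0 Cx) (clo_oc hC Cx); rewrite /s neq_lt.
  case: ifP => [h _|h]; first by rewrite mul1r.
  by rewrite orbF mulN1r oppr_gt0.
exists s => // v v0 cv; rewrite ltNge; apply/negP => h.
have Cu : cone ((- (s * ev f v)) *: x + (s * ev f x) *: v).
  have [h0|hn] := eqVneq (s * ev f v) 0.
    move: h0 => /eqP; rewrite mulf_eq0 (negbTE (fn0 _ v0 cv)) orbF => /eqP s0.
    by move: s2; rewrite s0 expr0n => /eqP; rewrite eq_sym oner_eq0.
  apply: (oc_comb hC) => //; last exact: ltW.
  by rewrite oppr_gt0 lt_def h andbT eq_sym.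
have /eqP := fn0 _ (cone_neq0 Cu) (clo_oc hC Cu); apply.
by rewrite !evE; ring.
Qed.

(** [E1] and [E2] are lifts of the boundary points [a] and [b] scaled so that [X = E1 + E2]. Leaving
    the cone in both directions shows that the set in [hilbert] is not empty. An arbitrary element
    of it is then analysed, with a chart [f] which may be negative on the cone; [sg] corrects the
    sign. *)
Lemma hilbert_line X Y : C X -> C Y -> prj X <> prj Y ->
  exists E1 E2 m, [/\ clo C E1, clo C E2, ~ C E1, ~ C E2 &
   [/\ 0 < m, X = E1 + E2, Y = m *: (E1 + expR (2 * hilbert Omega (prj X) (prj Y)) *: E2) &
    0 < hilbert Omega (prj X) (prj Y)]].
Proof.
move=> CX CY XY; rewrite /hilbert; have /negPf -> : prj X != prj Y by apply/eqP.
have X0 := cone_neq0 CX; have Y0 := cone_neq0 CY.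
set S := [set r | _].
have : S (xget 0 S).
  apply: xgetPex; rewrite /S /=.
  have fX := oc_pos hC CX; have fY := oc_pos hC CY.
  pose X' := (ev f0 X)^-1 *: X; pose Y' := (ev f0 Y)^-1 *: Y; pose U := Y' - X'.
  have CX' : C X' by apply: cone_scale => //; rewrite invr_gt0.
  have CY' : C Y' by apply: cone_scale => //; rewrite invr_gt0.
  have fX' : ev f0 X' = 1 by rewrite evZ mulVf// gt_eqF.
  have fY' : ev f0 Y' = 1 by rewrite evZ mulVf// gt_eqF.
  have fU : ev f0 U = 0 by rewrite evB fX' fY' subrr.
  have Un0 : U != 0.
    apply/eqP => /subr0_eq h; apply: XY; rewrite -(prjZ x0 X (k := (ev f0 X)^-1)).
      by rewrite -/X' -h prjZ// invr_eq0 gt_eqF.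
    by rewrite invr_eq0 gt_eqF.
  have nU : ~ clo C U by move=> /(clo_eq0 hC); rewrite fU lexx => /(_ isT)/eqP; exact/negP.
  have nNU : ~ clo C (- U).
    by move=> /(clo_eq0 hC); rewrite evN fU oppr0 lexx => /(_ isT)/eqP; rewrite oppr_eq0; exact/negP.
  have [t [t0 ct nt _]] := oc_exit hC CY' nU.
  have [s [s0 cs ns _]] := oc_exit hC CX' nNU.
  have fB : ev f0 (Y' + t *: U) = 1 by rewrite evD fY' (evZ _ t) fU mulr0 addr0.
  have fA : ev f0 (X' + s *: - U) = 1 by rewrite evD fX' (evZ _ s) evN fU oppr0 mulr0 addr0.
  have nA : X' + s *: - U != 0 by apply: (@ev_neq0 f0); rewrite fA oner_neq0.
  have nB : Y' + t *: U != 0 by apply: (@ev_neq0 f0); rewrite fB oner_neq0.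
  eexists; exists f0, (prj (X' + s *: - U)), (prj (Y' + t *: U)), (- s), (1 + t).
  rewrite !affpt_prj// fA fB invr1 !scale1r -/X' -/Y'; split.
  - exact: hch.
  - by split; apply/(bdry_prj).
  - split; first by rewrite oppr_lt0.
    by vec_ring.
  - split; first by rewrite ltrDl.
    by vec_ring.
  - by [].
case=> f [a [b [s [t]]]] /= [hf [ba bb] [s0 AE] [t1 BE] rE].
have [sg sg2 hsg] := chart_sign hf.
have [va [va0 cva nva aE]] := bdry_lift ba.
have [vb [vb0 cvb nvb bE]] := bdry_lift bb.
set r := xget 0 S in rE *; clearbody r; clear S.
rewrite aE bE !affpt_prj// in AE BE rE.
have fX := hsg _ X0 (clo_oc hC CX); have fY := hsg _ Y0 (clo_oc hC CY).
have fa := hsg _ va0 cva; have fb := hsg _ vb0 cvb.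
have nz (v : V) : 0 < sg * ev f v -> ev f v != 0.
  by apply: contraTneq => ->; rewrite mulr0 ltxx.
have iE (v : V) : 0 < sg * ev f v -> (ev f v)^-1 = sg * (sg * ev f v)^-1.
  move=> h; have sn0 : sg != 0 by apply: contraTneq h => ->; rewrite mul0r ltxx.
  by rewrite invfM mulrA mulfV// mul1r.
have sn0 : sg != 0 by apply: contraTneq fX => ->; rewrite mul0r ltxx.
set A := (ev f va)^-1 *: va in AE rE; set B := (ev f vb)^-1 *: vb in BE rE.
set X' := (ev f X)^-1 *: X in AE BE rE; set Y' := (ev f Y)^-1 *: Y in AE BE rE.
pose x := sg * ev f X; pose y := sg * ev f Y.
have XX : X = (x * sg) *: X'.
  have e : x * sg * (ev f X)^-1 = sg ^+ 2 by rewrite /x; field; exact: nz.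
  by rewrite /X' scalerA e sg2 scale1r.
have YY : Y = (y * sg) *: Y'.
  have e : y * sg * (ev f Y)^-1 = sg ^+ 2 by rewrite /y; field; exact: nz.
  by rewrite /Y' scalerA e sg2 scale1r.
have clA : clo C (sg *: A).
  by rewrite /A iE// !scalerA mulrA -expr2 sg2 mul1r; apply: (cloZ hC) => //; rewrite invr_ge0 ltW.
have clB : clo C (sg *: B).
  by rewrite /B iE// !scalerA mulrA -expr2 sg2 mul1r; apply: (cloZ hC) => //; rewrite invr_ge0 ltW.
have nA : ~ C (sg *: A).
  by rewrite /A iE// !scalerA mulrA -expr2 sg2 mul1r => /(ocZ_inv hC); rewrite invr_gt0 => /(_ fa).
have nB : ~ C (sg *: B).
  by rewrite /B iE// !scalerA mulrA -expr2 sg2 mul1r => /(ocZ_inv hC); rewrite invr_gt0 => /(_ fb).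
have U0 : 0 < enorm (Y' - X').
  rewrite lt_def enorm_ge0 andbT enorm_eq0; apply/eqP => /subr0_eq h; apply: XY.
  rewrite -(prjZ x0 X (k := (ev f X)^-1)) ?invr_eq0 ?nz// -/X' -h /Y' prjZ//.
  by rewrite invr_eq0 nz.
have ts : 0 < t - s by lra.
have dn : 0 < - s * (t - 1) by apply: mulr_gt0; lra.
have nm : 0 < (1 - s) * t by apply: mulr_gt0; lra.
have rat : expR (2 * r) = ((1 - s) * t) / (- s * (t - 1)).
  have e1 : A - Y' = (s - 1) *: (Y' - X') by rewrite AE; vec_ring.
  have e2 : B - X' = t *: (Y' - X') by rewrite BE; vec_ring.
  have e3 : A - X' = s *: (Y' - X') by rewrite AE; vec_ring.
  have e4 : B - Y' = (t - 1) *: (Y' - X') by rewrite BE; vec_ring.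
  rewrite rE e1 e2 e3 e4 !enormZ mulrA mulfV// mul1r.
  have -> : `|s - 1| = 1 - s by rewrite ltr0_norm; lra.
  have -> : `|t| = t by rewrite gtr0_norm; lra.
  have -> : `|s| = - s by rewrite ltr0_norm.
  have -> : `|t - 1| = t - 1 by rewrite gtr0_norm; lra.
  set N := enorm _ in U0 *.
  have -> : (1 - s) * N * (t * N) / (- s * N * ((t - 1) * N)) = ((1 - s) * t) / (- s * (t - 1)).
    field; apply/and3P; split; [rewrite gt_eqF//|rewrite lt_eqF//|rewrite gt_eqF//]; lra.
  by rewrite lnK// posrE divr_gt0.
have x_gt0 : 0 < x := fX; have y_gt0 : 0 < y := fY.
have r0 : 0 < r.
  rewrite -(@pmulr_rgt0 _ 2)// -(@ltr_expR R) expR0 rat ltr_pdivlMr// mul1r; lra.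
clearbody A B X' Y' x y.
(* Solving for [X'] and [Y'] gives [(t - s) *: X' = t *: A - s *: B] and [(t - s) *: Y' = (t - 1) *:
   A + (1 - s) *: B]. *)
exists ((x * t / (t - s)) *: (sg *: A)), ((x * (- s) / (t - s)) *: (sg *: B)), (y * (t - 1) / (x * t)).
have t_gt0 : 0 < t by lra.
have c1 : 0 < x * t / (t - s) by rewrite divr_gt0// mulr_gt0.
have c2 : 0 < x * (- s) / (t - s) by rewrite divr_gt0// mulr_gt0// oppr_gt0.
split.
- by apply: (cloZ hC) => //; exact: ltW.
- by apply: (cloZ hC) => //; exact: ltW.
- by move/(ocZ_inv hC c1).
- by move/(ocZ_inv hC c2).
split => //.
- by rewrite divr_gt0 ?mulr_gt0// subr_gt0.
- by rewrite [LHS]XX AE BE; vec_field; rewrite gt_eqF.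
- rewrite rat [LHS]YY AE BE; vec_field.
  have n1 := lt0r_neq0 t_gt0; have n2 := lt0r_neq0 x_gt0; have n3 := lt0r_neq0 ts.
  have n4 := ltr0_neq0 s0; have n5 : t - 1 != 0 by rewrite subr_eq0 gt_eqF.
  by do ?[apply/andP; split]; rewrite ?oppr_eq0//.
Qed.

Lemma hilbert_refl X : hilbert Omega X X = 0.
Proof. by rewrite /hilbert eqxx. Qed.

Lemma cone_hilbert_like : hilbert_like C (fun X Y => hilbert Omega (prj X) (prj Y)).
Proof.
split => [X Y CX CY|X Y k l CX CY k0 l0 h1 h2|X Y CX CY].
- have [->|XY] := pselect (prj X = prj Y); first by rewrite hilbert_refl.
  by have [E1 [E2 [m [_ _ _ _ [_ _ _ /ltW]]]]] := hilbert_line CX CY XY.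
- have [XY|XY] := pselect (prj X = prj Y).
    rewrite XY hilbert_refl mulr0 oppr0 expR0.
    have [c c0 YE] : exists2 c : R, c != 0 & Y = c *: X.
      by apply/(prj_eq x0 (cone_neq0 CX) (cone_neq0 CY)).
    have fX := oc_pos hC CX; have fY := oc_pos hC CY.
    have := clo_f0 hC h1; have := clo_f0 hC h2.
    rewrite !evB !evZ YE evZ => g1 g2.
    have g3 : k * c <= 1 by rewrite -(ler_pM2r fX); lra.
    have g4 : l <= c by rewrite -(ler_pM2r fX); lra.
    by apply: le_trans g3; rewrite ler_pM2l.
  have [E1 [E2 [m [c1 c2 n1 n2 [m0 XE YE T0]]]]] := hilbert_line CX CY XY.
  move: YE T0; set T := 2 * _ => YE T0.
  have TT : 1 <= expR T by rewrite -[leLHS]expR0 ler_expR mulr_ge0// ltW.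
  have C12 : C (E1 + E2) by rewrite -XE.
  have [_ g1] : 0 <= 1 - k * m /\ 0 <= 1 - k * m * expR T.
    apply: (clo_spanP hC c1 c2 n1 n2 C12); move: h1; congr clo; rewrite XE YE.
    by vec_ring.
  have [g2 _] : 0 <= m - l /\ 0 <= m * expR T - l.
    apply: (clo_spanP hC c1 c2 n1 n2 C12); move: h2; congr clo; rewrite XE YE.
    by vec_ring.
  rewrite expRN -[_^-1]mul1r ler_pdivlMr ?expR_gt0//.
  apply: le_trans (_ : k * m * expR T <= 1); last by rewrite -subr_ge0.
  by rewrite ler_pM2r ?expR_gt0// ler_pM2l// -subr_ge0.
- have [XY|XY] := pselect (prj X = prj Y).
    have [c c0 YE] : exists2 c : R, c != 0 & Y = c *: X.
      by apply/(prj_eq x0 (cone_neq0 CX) (cone_neq0 CY)).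
    have fX := oc_pos hC CX; have := oc_pos hC CY; rewrite YE evZ pmulr_lgt0// => c1.
    exists X, 0, c; split; rewrite ?scaler0 ?addr0//; [exact: (clo_oc hC)|exact: clo0].
  have [E1 [E2 [m [c1 c2 _ _ [m0 XE YE T0]]]]] := hilbert_line CX CY XY.
  by exists E1, E2, m.
Qed.

Local Notation D := (fun X Y => hilbert Omega (prj X) (prj Y)).
Let hD : hilbert_like C D := cone_hilbert_like.

Definition ray_lift (c : R -> P) : set V := [set x | C x /\ ray_image c (prj x)].

Lemma ray_lift_morse M c : geodesic_ray Omega c ->
  morse Omega M (ray_image c) -> cone_morse C D M (ray_lift c).
Proof.
move=> [cO _] hM l k T z l1 k0 T0 hz [_ z0] [_ zT] u hu.
have qg : quasi_geodesic Omega l k 0 T (prj \o z).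
  move=> v w hv hw; have [[_ Oz] /andP[h1 h2]] := hz v w hv hw.
  by split.
have [x [t t0 xE] hx] := hM _ _ _ _ _ l1 k0 T0 qg z0 zT _ hu.
have [v Cv vE] : exists2 v, C v & x = prj v.
  by apply: Omega_lift; rewrite -xE; exact: cO.
by exists v; [split => //; rewrite -vE; exists t|rewrite -vE].
Qed.

(** [X] lifts the starting point [p]. Subtracting from it the lift [Q] of [q] until the boundary is
    reached gives [X = e1 + e2], so that [p] has height 1 and the ray has heights at most 1.
    Separating forms at [e2] and [e1], normalized, are [a] and [b]. *)
Lemma ray_frame c q : projective_geodesic_ray Omega c q ->
  exists e1 e2 a b, [/\ frame C e1 e2 a b, axis (ray_lift c) e1 e2,
    q = prj e1,
    (forall s, 0 < s -> s <= 1 -> ray_lift c (e1 + s *: e2)) &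
    exists T h0, 0 < h0 /\ forall t, T <= t ->
      c t = prj (e1 + (h0 * expR (- (2 * t))) *: e2)].
Proof.
move=> [[cO cD] bq [p [f [Op hf imE]]]].
have [X CX pE] := Omega_lift Op.
have [Q [Q0 cQ nQ qE]] := bdry_lift bq.
have nNQ : ~ clo C (- Q) by move=> h; move/eqP: Q0; apply; exact: (clo_anti hC).
have [t [t0 cE nE _]] := oc_exit hC CX nNQ.
pose e1 := t *: Q; pose e2 := X + t *: - Q.
have XE : e1 + e2 = X by rewrite /e1 /e2 scalerN addrC subrK.
have ce1 : clo C e1 by apply: (cloZ hC) => //; exact: ltW.
have ce2 : clo C e2 by [].
have ne1 : ~ C e1 by move/(ocZ_inv hC t0).
have e10 : e1 != 0 by rewrite scaler_eq0 negb_or Q0 gt_eqF.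
have [a0 ha0 ae2] := oc_separation hC nE; rewrite -/e2 in ae2.
have [b0 hb0 be1] := oc_separation hC ne1.
have a0e2 : ev a0 e2 = 0.
  by apply/eqP; rewrite eq_le ae2; apply: (clo_ge0 hC) ce2 => x /ha0/ltW.
have b0e1 : ev b0 e1 = 0.
  by apply/eqP; rewrite eq_le be1; apply: (clo_ge0 hC) ce1 => x /hb0/ltW.
have a0e1 : 0 < ev a0 e1 by have := ha0 _ CX; rewrite -XE evD a0e2 addr0.
have b0e2 : 0 < ev b0 e2 by have := hb0 _ CX; rewrite -XE evD b0e1 add0r.
have e20 : e2 != 0 by apply/eqP => h; move: b0e2; rewrite h ev0 ltxx.
have qE1 : q = prj e1 by rewrite qE /e1 prjZ// gt_eqF.
have fr : frame C e1 e2 ((ev a0 e1)^-1 *: a0) ((ev b0 e2)^-1 *: b0).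
  split => //; rewrite ?evZl ?a0e2 ?b0e1 ?mulr0 ?XE//.
  - by move=> x Cx; rewrite evZl mulr_gt0 ?invr_gt0// ha0.
  - by move=> x Cx; rewrite evZl mulr_gt0 ?invr_gt0// hb0.
  - by rewrite mulVf// gt_eqF.
  - by rewrite mulVf// gt_eqF.
clearbody e1 e2; have [sg sg2 hsg] := chart_sign hf.
have sn0 : sg != 0 by apply/eqP => h; move: sg2; rewrite h expr0n => /eqP; rewrite eq_sym oner_eq0.
have g1 := hsg _ e10 ce1; have g2 := hsg _ e20 ce2.
have X0 := cone_neq0 CX.
have fXE : ev f X = ev f e1 + ev f e2 by rewrite -XE evD.
have nz1 : ev f e1 != 0 by apply/eqP => h; move: g1; rewrite h mulr0 ltxx.
have nzX : ev f e1 + ev f e2 != 0.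
  by apply/eqP => h; have := addr_gt0 g1 g2; rewrite -mulrDr h mulr0 ltxx.
have seg s : 0 < s -> s <= 1 -> ray_lift c (e1 + s *: e2).
  move=> s0 s1; have Cs := frame_axis hC fr s0; split => //.
  have nzs : ev f e1 + s * ev f e2 != 0.
    apply/eqP => h; have := addr_gt0 g1 (mulr_gt0 s0 g2).
    by rewrite mulrCA -mulrDr h mulr0 ltxx.
  rewrite imE; split; first by apply/(chart_prj x0 f (cone_neq0 Cs)); rewrite evD evZ.
  exists (1 - s * (ev f e1 + ev f e2) / (ev f e1 + s * ev f e2)).
  rewrite pE qE1 !affpt_prj ?(cone_neq0 Cs)// fXE evD evZ -XE.
  have rE : s * (ev f e1 + ev f e2) / (ev f e1 + s * ev f e2) =
     s * (sg * ev f e1 + sg * ev f e2) / (sg * ev f e1 + s * (sg * ev f e2)).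
    by field; rewrite nzs /= (_ : _ + _ = sg * (ev f e1 + s * ev f e2)) ?mulf_neq0//; ring.
  split.
  - rewrite rE subr_ge0 ler_pdivrMr ?mul1r; last exact: (addr_gt0 g1 (mulr_gt0 s0 g2)).
    by rewrite mulrDr lerD2r ler_piMl// ltW.
  - rewrite rE ltrBlDr ltrDl divr_gt0//; first exact: (mulr_gt0 s0 (addr_gt0 g1 g2)).
    exact: (addr_gt0 g1 (mulr_gt0 s0 g2)).
  - by vec_field; rewrite nz1 nzX nzs.
have seg_inv x : C x -> ray_image c (prj x) ->
    exists k s, [/\ 0 < k, 0 < s, s <= 1 & x = k *: (e1 + s *: e2)].
  move=> Cx; rewrite imE => -[_ [r [r0 r1]]].
  have gx := hsg _ (cone_neq0 Cx) (clo_oc hC Cx).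
  rewrite pE qE1 !affpt_prj ?(cone_neq0 Cx)// fXE -XE => xE.
  have nzx : ev f x != 0 by apply/eqP => h; move: gx; rewrite h mulr0 ltxx.
  set F1 := sg * ev f e1 in g1; set F2 := sg * ev f e2 in g2; set Fx := sg * ev f x in gx.
  pose k1 := Fx * ((1 - r) / (F1 + F2) + r / F1); pose k2 := Fx * ((1 - r) / (F1 + F2)).
  have k20 : 0 < k2 by apply: mulr_gt0 => //; apply: divr_gt0; [rewrite subr_gt0|exact: addr_gt0].
  have k21 : k2 <= k1.
    by rewrite /k1 mulrDr lerDl; apply: mulr_ge0; [|apply: divr_ge0 => //]; exact: ltW.
  have k10 := lt_le_trans k20 k21.
  exists k1, (k2 / k1); split => //; first exact: divr_gt0.
    by rewrite ler_pdivrMr// mul1r.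
  have -> : k1 *: (e1 + (k2 / k1) *: e2) = k1 *: e1 + k2 *: e2.
    by rewrite scalerDr scalerA mulrC divfK// gt_eqF.
  have xx : x = ev f x *: ((ev f x)^-1 *: x) by rewrite scalerA mulfV// scale1r.
  rewrite {1}xx xE; apply/colP => i; rewrite !mxE /k1 /k2 /Fx /F1 /F2.
  by field; rewrite nz1 nzX sn0 -mulrDr mulf_neq0.
have ax : axis (ray_lift c) e1 e2.
  split=> [k x k0 [Cx rx]|x [Cx /(seg_inv _ Cx)[k [s [k0 s0 _ xE]]]]].
    by split; [exact: cone_scale|rewrite prjZ// gt_eqF].
  by exists k, s.
have height u : 0 <= u -> exists h, [/\ 0 < h, h <= 1 & c u = prj (e1 + h *: e2)].
  move=> u0; have [x Cx xE] := Omega_lift (cO _ u0).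
  have [k [s [k0 s0 s1 xE']]] := seg_inv _ Cx (ex_intro2 _ _ u u0 xE).
  by exists s; split => //; rewrite xE xE' prjZ// gt_eqF.
exists e1, e2, ((ev a0 e1)^-1 *: a0), ((ev b0 e2)^-1 *: b0); split => //.
have [h0 [h00 h01 c0E]] := height 0 (lexx _).
(* The unit speed only gives the distance from [c 0], whose height is [h0]. For times beyond this
   bound the point [c u] cannot be above [c 0]: its height would exceed 1. So it is below, and the
   formula holds. *)
exists (`|ln h0| + 1), h0; split => // u uT.
have lnn := normr_ge0 (ln h0); have lnl := ler_norm (- ln h0); rewrite normrN in lnl.
have u0 : 0 <= u by lra.
have [h [hp h1 cuE]] := height u u0.
have cd := cD 0 u (lexx _) u0; rewrite c0E cuE sub0r normrN ger0_norm// in cd.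
have [hh|/ltW hh] := leP h h0.
  have := axis_dist hC hD fr hp hh; rewrite (hl_sym hC hD) ?cd; try exact: (frame_axis hC fr).
  move=> lnE; have hE : h = h0 * expR (- (2 * u)).
    by rewrite lnE opprB expRD expRN !lnK ?posrE// mulrC divfK// gt_eqF.
  by rewrite -hE.
have := axis_dist hC hD fr h00 hh; rewrite cd => lnE.
have lnh : ln h <= 0 by rewrite ln_le0.
by have := le_log_contra lnE lnh lnl uT u0.
Qed.

(** A matrix preserving [Omega] maps each vector of the cone to the cone or to its opposite; one
    sign serves all vectors. *)
Lemma aut_lift (g : 'M[R]_d) : proj_aut Omega g -> exists sg : R, [/\ sg * sg = 1,
  (forall v, C v -> C (sg *: (g *m v))) & (forall v, C v -> C (sg *: (invmx g *m v)))].
Proof.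
move=> [gu gO]; have [X CX] := oc_inh hC.
have gn (v : V) : v != 0 -> g *m v != 0.
  by move=> v0; apply: contra v0 => /eqP h; rewrite -(mulKmx gu v) h mulmx0.
have fwd v : C v -> C (g *m v) \/ C (- (g *m v)).
  move=> Cv; have v0 := cone_neq0 Cv.
  apply/(Omega_prj (gn _ v0)); rewrite -pact_prj//.
  have : (pact g @` Omega) (pact g (prj v)) by exists (prj v) => //; case: Cv.
  by rewrite gO.
pose sg : R := if `[< C (g *m X) >] then 1 else -1.
have sg2 : sg * sg = 1 by rewrite /sg; case: ifP => _; rewrite ?mulr1// mulrNN mulr1.
have CgX : C (sg *: (g *m X)).
  rewrite /sg; case: ifPn => [/asboolP|/asboolPn n]; first by rewrite scale1r.
  by rewrite scaleN1r; case: (fwd _ CX).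
have fw v : C v -> C (sg *: (g *m v)).
  move=> Cv; have cases : C (sg *: (g *m v)) \/ C (- (sg *: (g *m v))).
    case: (fwd _ Cv) => h; rewrite /sg; case: ifP => _; rewrite ?scale1r ?scaleN1r ?opprK; tauto.
  case: cases => // Cn; exfalso.
  have p0 := oc_pos hC CgX; have n0 := oc_pos hC Cn.
  set p := ev f0 _ in p0; set n := ev f0 _ in n0.
  (* If [X] and [v] needed opposite signs, this combination would be in the cone while its image is
     in the kernel of [f0], so that neither the image nor its opposite would be in the cone. *)
  have Cu : C (n *: X + p *: v).
    by apply: (oc_comb hC) => //; [exact: (clo_oc hC)|exact: ltW].
  have fu : ev f0 (g *m (n *: X + p *: v)) = 0.
    have -> : g *m (n *: X + p *: v) = sg *: (n *: (sg *: (g *m X)) - p *: (- (sg *: (g *m v)))).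
      rewrite mulmxDr -!scalemxAr; move: (g *m X) (g *m v) => GX GV.
      by apply/colP => i; rewrite !mxE -[LHS]mul1r -sg2; ring.
    by rewrite evZ evB !(evZ _ n) (evZ _ p) -/p -/n; ring.
  by case: (fwd _ Cu) => /(oc_pos hC); rewrite ?evN fu ?oppr0 ltxx.
exists sg; split => // v Cv.
have [y Oy yv] : (pact g @` Omega) (prj v) by rewrite gO; case: Cv.
have [u Cu yE] := Omega_lift Oy.
have u0 := cone_neq0 Cu; have v0 := cone_neq0 Cv.
move: yv; rewrite yE pact_prj// => /(prj_eq x0 (gn _ u0) v0)[k k0 vE].
have sk : 0 < sg * k.
  have := oc_pos hC Cv; have := oc_pos hC (fw _ Cu); rewrite vE !evZ => h1 h2.
  have := mulr_gt0 h1 h2; rewrite mulrACA pmulr_lgt0//.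
  rewrite -expr2 exprn_even_gt0//=; apply/eqP => h.
  by move: h2; rewrite h mulr0 ltxx.
have -> : sg *: (invmx g *m v) = (sg * k) *: u by rewrite vE -scalemxAr mulKmx// scalerA.
exact: cone_scale.
Qed.

Lemma tracking_distortion r : exists c K, [/\ 0 < c, 0 < K & forall g X, proj_aut Omega g -> C X ->
  hilbert Omega x0 (pact (invmx g) (prj X)) < r ->
  exists kap, @distortion R d C c K kap g X].
Proof.
have [X0 CX0 x0E] := Omega_lift Ox0.
have [K0 K00 hK] := clo_bnd hC; have [e e0 he] := oc_open hC CX0.
have f00 := oc_pos hC CX0; set m := ev f0 X0 in f00.
(* By tracking, [Y] dominates [l *: X0] with [l] at least [expR (- (2 * r)) * ev f0 Y / m], and [X0]
   is the center of a ball of radius [e] in the cone. The scale [kap] is [ev f0 Y]. *)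
pose c := e / 2 * expR (- (2 * r)) / m.
have c0 : 0 < c by rewrite !mulr_gt0 ?invr_gt0// expR_gt0.
exists c, (d%:R * K0 + 1); split => //; first by rewrite ltr_wpDl// mulr_ge0// ltW.
move=> g X ag CX; have [gu gO] := ag; have [sg [sg2 fw bw]] := aut_lift ag.
have sn : sg != 0 by apply/eqP => h; move: sg2; rewrite h mulr0 => /eqP; rewrite eq_sym oner_eq0.
have X0n := cone_neq0 CX.
rewrite pact_prj ?unitmx_inv// -(prjZ x0 (invmx g *m X) sn).
set Y := sg *: (invmx g *m X) => dr; have CY : C Y := bw _ CX.
have gY : sg *: (g *m Y) = X.
  by rewrite /Y -scalemxAr mulKVmx// scalerA sg2 scale1r.
rewrite [x0 in hilbert _ x0 _]x0E in dr.
have [k [l [k0 l0 h1 h2 kl]]] := hl_eq hC hD CX0 CY.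
have kap0 := oc_pos hC CY; set kap := ev f0 Y in kap0.
have klr : expR (- (2 * r)) <= k * l by rewrite kl ler_expR lerN2 ler_pM2l// ltW.
have km : k * kap <= m by have := clo_f0 hC h1; rewrite evB evZ -/m -/kap subr_ge0.
have lb : expR (- (2 * r)) * kap / m <= l.
  rewrite ler_pdivrMr//; apply: le_trans (_ : k * l * kap <= _); first by rewrite ler_pM2r.
  by rewrite mulrAC mulrC ler_pM2l.
have inv v : clo C v -> clo C (sg *: (invmx g *m v)).
  move=> cv x Cx; have := bw _ (cv _ (fw _ Cx)); congr C.
  rewrite mulmxDr scalerDr; congr (_ + _).
  by rewrite -scalemxAr mulKmx// scalerA sg2 scale1r.
exists kap; split => //.
- by rewrite ltr_wpDl// mulr_ge0// ltW.
- move=> z /inv i1 /inv i2.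
  have e1 : sg *: (invmx g *m (X + g *m z)) = Y + sg *: z.
    by rewrite mulmxDr mulKmx// scalerDr.
  have e2 : sg *: (invmx g *m (X - g *m z)) = Y - sg *: z.
    by rewrite mulmxBr mulKmx// scalerBr.
  rewrite e1 in i1; rewrite e2 in i2.
  have n1 := hK _ i1; have n2 := hK _ i2; rewrite evD -/kap in n1; rewrite evB -/kap in n2.
  have zn : `|z| <= K0 * kap.
    have sgn : `|sg| = 1.
      by apply/eqP; rewrite -sqrp_eq1 ?normr_ge0// real_normK ?num_real// expr2 sg2.
    have : `|2 *: (sg *: z)| <= `|Y + sg *: z| + `|Y - sg *: z|.
      rewrite (_ : 2 *: _ = (Y + sg *: z) - (Y - sg *: z)); first exact: ler_normB.
      by vec_ring.
    rewrite !normrZ sgn ger0_norm// mul1r; lra.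
  apply: (le_trans (enorm_le_norm _)); have := ler_wpM2l (ler0n R d) zn; lra.
- move=> z zc.
  have Cpm w : enorm w <= c * kap -> C (Y + w).
    move=> wc; have -> : Y + w = (Y - l *: X0) + l *: (X0 + l^-1 *: w).
      by vec_field; rewrite gt_eqF.
    apply: h2; apply: cone_scale => //; apply: he.
    rewrite normrZ gtr0_norm ?invr_gt0// mulrC ltr_pdivrMr//.
    apply: (le_lt_trans (norm_le_enorm _)); apply: (le_lt_trans wc).
    have : e / 2 * (expR (- (2 * r)) * kap / m) <= e / 2 * l by rewrite ler_wpM2l// divr_ge0// ltW.
    rewrite /c => h; apply: (@le_lt_trans _ _ (e / 2 * l)); first lra.
    by rewrite ltr_pM2r// ltr_pdivrMr// ltr_pMr// ltr1n.
  have sgn w : enorm (sg *: w) = enorm w.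
    rewrite enormZ (_ : `|sg| = 1) ?mul1r//.
    by apply/eqP; rewrite -sqrp_eq1 ?normr_ge0// real_normK ?num_real// expr2 sg2.
  split; apply: (clo_oc hC).
    have -> : X + g *m z = sg *: (g *m (Y + sg *: z)).
      by rewrite mulmxDr scalerDr gY -scalemxAr scalerA sg2 scale1r.
    by apply: fw; apply: Cpm; rewrite sgn.
  have -> : X - g *m z = sg *: (g *m (Y + - (sg *: z))).
    by rewrite mulmxDr mulmxN scalerDr scalerN gY -scalemxAr scalerA sg2 scale1r.
  by apply: fw; apply: Cpm; rewrite enormN sgn.
Qed.

(** * Local comparisons at the end point of the ray *)

Context {e1 e2 : V} {a b : 'rV[R]_d} (fr : frame C e1 e2 a b).
Context {f : 'rV[R]_d} {g : 'M[R]_d} (hf : closure Omega `<=` chart f) (gu : g \in unitmx).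

Lemma mulmx_ebound m (h : 'M[R]_(m, d)) : exists2 K, 0 < K & forall v : V, enorm (h *m v) <= K * enorm v.
Proof.
have [K K0 hK] := mulmx_bound h; exists (m%:R * K + 1); first by rewrite ltr_wpDl// mulr_ge0// ltW.
move=> v; apply: (le_trans (enorm_le_norm _)); rewrite mulrDl mul1r.
have h1 := ler_wpM2l (ler0n R m) (hK v).
have h2 : m%:R * (K * `|v|) <= m%:R * (K * enorm v).
  by rewrite ler_wpM2l// ler_wpM2l ?norm_le_enorm// ltW.
have := enorm_ge0 v; lra.
Qed.

Lemma nbhs_frame (U : set P) : nbhs (prj e1) U -> exists2 rho, 0 < rho &
  forall w s, enorm w < rho -> `|s| < rho -> e1 + w + s *: e2 != 0 /\ U (prj (e1 + w + s *: e2)).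
Proof.
move=> /(prj_nbhs (frame_neq1 fr))[e e0 he]; have n2 := enorm_gt0 (frame_neq2 fr).
have D0 : 0 < 1 + enorm e2 by rewrite addr_gt0.
exists (e / (1 + enorm e2)); first by rewrite divr_gt0.
move=> w s wr sr; rewrite -addrA; apply: he.
apply: (le_lt_trans (norm_le_enorm _)); apply: (le_lt_trans (enormD _ _)); rewrite enormZ.
rewrite ltr_pdivlMr// in wr; rewrite ltr_pdivlMr// in sr.
have h : enorm w * (1 + enorm e2) + `|s| * (1 + enorm e2) * enorm e2 < e * (1 + enorm e2).
  have := ltr_pM2r n2 (`|s| * (1 + enorm e2)) e; rewrite sr => sr2.
  lra.
by rewrite -(ltr_pM2r D0); lra.
Qed.

(** The coordinates [w] and [s] are read on the representative with [ev a v = 1]. The neighborhood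
    [A] is written homogeneously, so that it does not depend on the representative. *)
Lemma frame_nbhs rho : 0 < rho -> exists2 U, nbhs (prj e1) U & forall y, U y -> closure Omega y ->
  exists w s, [/\ ev a w = 0, ev b w = 0, enorm w < rho, 0 <= s < rho &
    clo C (e1 + w + s *: e2) /\ y = prj (e1 + w + s *: e2)].
Proof.
move=> rho0; have [Ka Ka0 hKa] := ev_ebound a; have [Kb Kb0 hKb] := ev_ebound b.
have n1 := enorm_gt0 (frame_neq1 fr); have n2 := enorm_gt0 (frame_neq2 fr).
pose D := 1 + Kb + Kb * enorm e2.
have Ke : 0 < Kb * enorm e2 by rewrite mulr_gt0.
have D0 : 0 < D by rewrite /D; lra.
pose r := rho / D; have r0 : 0 < r by rewrite divr_gt0.
have rD : r * D = rho by rewrite divfK// gt_eqF.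
clearbody r.
pose A := [set v : V | enorm (v - ev a v *: e1) < r * `|ev a v|].
have Ak k v : k != 0 -> A v -> A (k *: v).
  move=> k0; rewrite /A /= evZ -scalerA -scalerBr enormZ normrM mulrCA.
  by rewrite ltr_pM2l// normr_gt0.
have Ao v : v != 0 -> A v -> exists2 e, 0 < e & forall u, `|u| < e -> A (v + u).
  move=> _ Av.
  have [k1 k10 hk1] := ev_bound a.
  have dp : 0 <= d%:R :> R by [].
  pose L := d%:R * (1 + k1 * enorm e1) + r * k1 + d%:R * 0 + k1 * enorm e1 + 1.
  have t1 : 0 < k1 * enorm e1 by rewrite mulr_gt0.
  have t2 : 0 < r * k1 by rewrite mulr_gt0.
  have L0 : 0 < L.
    have : 0 <= d%:R * (1 + k1 * enorm e1) by rewrite mulr_ge0//; lra.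
    by rewrite /L; lra.
  exists ((r * `|ev a v| - enorm (v - ev a v *: e1)) / L); first by rewrite divr_gt0// subr_gt0.
  move=> u; rewrite ltr_pdivlMr// => uL; rewrite /A /=.
  have -> : v + u - ev a (v + u) *: e1 = (v - ev a v *: e1) + (u - ev a u *: e1).
    by rewrite evD; vec_ring.
  have i1 := enormD (v - ev a v *: e1) (u - ev a u *: e1).
  have i2 : enorm (u - ev a u *: e1) <= d%:R * `|u| + k1 * `|u| * enorm e1.
    apply: (le_trans (enormB _ _)); rewrite enormZ lerD ?enorm_le_norm//.
    by rewrite ler_wpM2r// ltW.
  have i3 : `|ev a v| <= `|ev a (v + u)| + k1 * `|u|.
    have := hk1 u; have : `|ev a v| <= `|ev a (v + u)| + `|ev a u|.
      by rewrite evD; have := ler_normB (ev a v + ev a u) (ev a u); rewrite addrK.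
    lra.
  have i4 := ler_wpM2l (ltW r0) i3.
  have u0 := normr_ge0 u.
  have i5 : 0 <= d%:R * (k1 * enorm e1) * `|u| by rewrite !mulr_ge0// ltW.
  have i6 : 0 <= r * k1 * `|u| by rewrite !mulr_ge0// ltW.
  rewrite /L in uL; lra.
have oA := open_prj Ak Ao.
exists [set y : P | A (homog y)].
  apply: open_nbhs_nbhs; split => //=; have [k k0 ->] := homog_prj x0 (frame_neq1 fr).
  by apply: Ak => //; rewrite /A /= (fra1 fr) scale1r subrr enorm0 normr1 mulr1.
move=> y /= Ay cy; set u := homog y in Ay.
have au : ev a u != 0.
  by apply: contraTneq Ay => ->; rewrite normr0 mulr0 -leNgt enorm_ge0.
pose v := (ev a u)^-1 *: u.
have av : ev a v = 1 by rewrite evZ mulVf.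
have ai : (ev a u)^-1 != 0 by rewrite invr_eq0.
have vr : enorm (v - e1) < r.
  by have := Ak _ _ ai Ay; rewrite -/v /A /= av scale1r normr1 mulr1.
have yv : y = prj v by rewrite /v prjZ// prjK.
have v0 : v != 0 by apply: (@ev_neq0 a); rewrite av oner_neq0.
have cv : clo C v.
  rewrite yv in cy; have [//|cN] := (closure_prj v0).1 cy.
  have : 0 <= ev a (- v) by apply: (clo_ge0 hC) cN => x /(fra fr)/ltW.
  by rewrite evN av oppr_ge0 ler10.
clearbody v.
have s0 : 0 <= ev b v by apply: (clo_ge0 hC) cv => x /(frb fr)/ltW.
have sb : ev b v <= Kb * enorm (v - e1).
  by have := hKb (v - e1); rewrite evB (frb1 fr) subr0 ger0_norm.
have vE : e1 + (v - e1 - ev b v *: e2) + ev b v *: e2 = v.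
  by vec_ring.
have bs : Kb * enorm (v - e1) < Kb * r by rewrite ltr_pM2l.
exists (v - e1 - ev b v *: e2), (ev b v); rewrite vE; split => //.
- by rewrite !evB evZ av (fra1 fr) (fra2 fr); ring.
- by rewrite !evB evZ (frb1 fr) (frb2 fr); ring.
- apply: (le_lt_trans (enormB _ _)); rewrite enormZ ger0_norm//.
  have g1 := ler_wpM2r (ltW n2) sb.
  have g2 : Kb * enorm (v - e1) * enorm e2 <= Kb * r * enorm e2 by rewrite ler_wpM2r ?ltW.
  have g3 : 0 < Kb * r by rewrite mulr_gt0.
  rewrite /D in rD; lra.
- rewrite s0 /=; have g3 : 0 < Kb * r * enorm e2 by rewrite !mulr_gt0.
  rewrite /D in rD; lra.
Qed.

Lemma f_near : exists F rho, [/\ 0 < F, 0 < rho & forall w s, clo C (e1 + w + s *: e2) ->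
  e1 + w + s *: e2 != 0 -> enorm w <= rho -> `|s| <= rho ->
  F / 2 <= `|ev f (e1 + w + s *: e2)| /\ `|ev f (e1 + w + s *: e2)| <= 2 * F].
Proof.
have [sg sg2 hsg] := chart_sign hf.
have n2 := enorm_gt0 (frame_neq2 fr).
have fe1 : ev f e1 != 0.
  by apply/eqP => h; have := hsg _ (frame_neq1 fr) (fr1 fr); rewrite h mulr0 ltxx.
have [K K0 hK] := ev_ebound f.
have F0 : 0 < `|ev f e1| by rewrite normr_gt0.
set F := `|ev f e1| in F0.
have D0 : 0 < 2 * (K * (1 + enorm e2)) by rewrite !mulr_gt0// addr_gt0.
exists F, (F / (2 * (K * (1 + enorm e2)))); split => //; first by rewrite divr_gt0.
move=> w s _ _; rewrite !ler_pdivlMr// => wr sr.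
have df : `|ev f (w + s *: e2)| <= F / 2.
  apply: (le_trans (hK _)); have := enormD w (s *: e2); rewrite enormZ => h.
  have h1 := ler_wpM2l (ltW K0) h.
  have D1 : 0 < 1 + enorm e2 by rewrite addr_gt0.
  rewrite -(ler_pM2r D1).
  have h2 := ler_wpM2r (ltW D1) h1.
  have h3 := ler_wpM2r (ltW n2) sr.
  lra.
have -> : e1 + w + s *: e2 = e1 + (w + s *: e2) by rewrite addrA.
rewrite evD; split.
  have := lerB_normD (ev f e1) (ev f (w + s *: e2)); rewrite -/F; lra.
have := ler_normD (ev f e1) (ev f (w + s *: e2)); rewrite -/F; lra.
Qed.

Lemma frame_vec_neq0 w s : ev a w = 0 -> e1 + w + s *: e2 != 0.
Proof.
move=> aw; apply: (@ev_neq0 a).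
by rewrite !evE (fra1 fr) (fra2 fr) aw mulr0 !addr0 oner_neq0.
Qed.

Lemma f_e1_neq0 : ev f e1 != 0.
Proof.
have [sg sg2 hsg] := chart_sign hf.
by apply/eqP => h; have := hsg _ (frame_neq1 fr) (fr1 fr); rewrite h mulr0 ltxx.
Qed.

Lemma g_lower : exists2 K, 0 < K & forall v, enorm v <= K * enorm (g *m v).
Proof.
have [K K0 hK] := mulmx_ebound (invmx g); exists K => // v.
by have := hK (g *m v); rewrite mulKmx.
Qed.

Lemma edist_prj u v : u != 0 -> v != 0 ->
  Defs.edist f g (prj u) (prj v) = enorm (g *m ((ev f u)^-1 *: u - (ev f v)^-1 *: v)).
Proof. by move=> u0 v0; rewrite /Defs.edist !affpt_prj. Qed.

(** Passing from the normalization [a = 1] to [f = 1] is bi-Lipschitz near [e1], where [f] is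
    bounded and bounded away from 0. The inverse is explicit: [w] and [s] are recovered from the
    difference [x] by means of [a] and [b]. *)
Lemma edist_near : exists m1 m2 rho, [/\ 0 < m1, 0 < m2, 0 < rho & forall w s,
  ev a w = 0 -> ev b w = 0 -> clo C (e1 + w + s *: e2) -> enorm w <= rho -> 0 <= s <= rho ->
  m1 * (enorm w + s) <= Defs.edist f g (prj (e1 + w + s *: e2)) (prj e1) /\
  Defs.edist f g (prj (e1 + w + s *: e2)) (prj e1) <= m2 * (enorm w + s)].
Proof.
have [F [rho [F0 rho0 hF]]] := f_near.
have [Ka Ka0 hKa] := ev_ebound a; have [Kb Kb0 hKb] := ev_ebound b.
have [Kf Kf0 hKf] := ev_ebound f.
have [Kg Kg0 hKg] := mulmx_ebound g; have [Kh Kh0 hKh] := g_lower.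
have n1 := enorm_gt0 (frame_neq1 fr); have n2 := enorm_gt0 (frame_neq2 fr).
have f1 := f_e1_neq0; set f1v := ev f e1 in f1.
have f1p : 0 < `|f1v| by rewrite normr_gt0.
pose L := 1 + Ka * enorm e1 + Kb * enorm e2 + Kb.
have q1 : 0 < Ka * enorm e1 by rewrite mulr_gt0.
have q2 : 0 < Kb * enorm e2 by rewrite mulr_gt0.
have L0 : 0 < L by rewrite /L; lra.
pose N := (1 + enorm e2) * (1 + Kf * enorm e1 / `|f1v|).
have q3 : 0 < Kf * enorm e1 / `|f1v| by rewrite divr_gt0// mulr_gt0.
have N0 : 0 < N by rewrite mulr_gt0 ?addr_gt0.
exists (2 * F * L * Kh)^-1, (Kg * (2 / F * N)), rho; split => //.
- by rewrite invr_gt0 !mulr_gt0.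
- by rewrite mulr_gt0// mulr_gt0// divr_gt0.
move=> w s aw bw cv wr /andP[s0 sr].
have v0 := frame_vec_neq0 s aw.
have [fl fu] : F / 2 <= `|ev f (e1 + w + s *: e2)| /\ `|ev f (e1 + w + s *: e2)| <= 2 * F.
  by apply: hF => //; rewrite ger0_norm.
rewrite edist_prj ?(frame_neq1 fr)// -/f1v; set v := e1 + w + s *: e2 in cv v0 fl fu *.
have av : ev a v = 1 by rewrite !evE aw (fra1 fr) (fra2 fr); ring.
have bv : ev b v = s by rewrite !evE bw (frb1 fr) (frb2 fr); ring.
set fv := ev f v in fl fu *; have fvp : 0 < `|fv| by apply: lt_le_trans fl; rewrite divr_gt0.
have fvn : fv != 0 by rewrite -normr_gt0.
set x := fv^-1 *: v - f1v^-1 *: e1.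
split.
  have bx : ev b x = s / fv by rewrite evB !evZ bv (frb1 fr) mulr0 subr0 mulrC.
  have ax : ev a x = fv^-1 - f1v^-1 by rewrite evB !evZ av (fra1 fr) !mulr1.
  have wx : w = fv *: (x - ev a x *: e1 - ev b x *: e2).
    rewrite ax bx /x /v; vec_field.
    by rewrite fvn f1.
  have nx := enorm_ge0 x.
  have h1 : s <= 2 * F * (Kb * enorm x).
    have -> : s = `|fv| * `|ev b x|.
      by rewrite -normrM bx mulrC divfK// ger0_norm.
    by apply: ler_pM => //; exact: hKb.
  have h2 : enorm w <= 2 * F * ((1 + Ka * enorm e1 + Kb * enorm e2) * enorm x).
    rewrite wx enormZ; apply: ler_pM => //; first exact: enorm_ge0.
    apply: (le_trans (enormB _ _)); rewrite enormZ.
    have i1 := enormB x (ev a x *: e1); rewrite enormZ in i1.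
    have i2 := ler_wpM2r (ltW n1) (hKa x).
    have i3 := ler_wpM2r (ltW n2) (hKb x).
    lra.
  rewrite ler_pdivrMl ?mulr_gt0//.
  have h3 := hKh x.
  have h4 : enorm w + s <= 2 * F * L * enorm x by rewrite /L; lra.
  have FL : 0 < 2 * F * L by rewrite mulr_gt0// mulr_gt0.
  by apply: (le_trans h4); rewrite -[leRHS]mulrA ler_pM2l.
have xE : x = fv^-1 *: ((w + s *: e2) - (ev f (w + s *: e2) / f1v) *: e1).
  have fvE : fv = f1v + ev f (w + s *: e2) by rewrite /fv /v -addrA [LHS]evD.
  rewrite /x /v; have -> : ev f (w + s *: e2) = fv - f1v by rewrite fvE; ring.
  by vec_field; rewrite fvn f1.
have nu : enorm (w + s *: e2) <= (1 + enorm e2) * (enorm w + s).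
  apply: (le_trans (enormD _ _)); rewrite enormZ ger0_norm//.
  by have := enorm_ge0 w; nra.
have h5 : enorm (w + s *: e2 - (ev f (w + s *: e2) / f1v) *: e1) <= N * (enorm w + s).
  apply: (le_trans (enormB _ _)); rewrite enormZ normrM normfV.
  have i1 : `|ev f (w + s *: e2)| / `|f1v| * enorm e1 <= Kf * enorm (w + s *: e2) / `|f1v| * enorm e1.
    by rewrite ler_wpM2r ?(ltW n1)// ler_wpM2r ?invr_ge0// hKf.
  have i2 : 0 <= 1 + Kf * enorm e1 / `|f1v| by lra.
  by have := ler_wpM2r i2 nu; rewrite /N; lra.
apply: (le_trans (hKg _)); rewrite -[leRHS]mulrA ler_pM2l// xE enormZ.
rewrite -[leRHS]mulrA; apply: ler_pM => //; first exact: enorm_ge0.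
by rewrite normfV -[2 / F]invf_div lef_pV2 ?posrE// divr_gt0.
Qed.

Lemma edist_to_near : exists m3 m4 rho, [/\ 0 < m3, 0 < m4, 0 < rho & forall w s,
  ev a w = 0 -> ev b w = 0 -> clo C (e1 + w + s *: e2) -> enorm w <= rho -> 0 <= s <= rho ->
  m3 * s <= edist_to f g (prj (e1 + w + s *: e2)) [set x | linval b x = 0] /\
  edist_to f g (prj (e1 + w + s *: e2)) [set x | linval b x = 0] <= m4 * s].
Proof.
have [F [rho [F0 rho0 hF]]] := f_near.
have [Kb Kb0 hKb] := ev_ebound b; have [Kh Kh0 hKh] := g_lower.
have f1 := f_e1_neq0.
pose k := e2 - (ev f e2 / ev f e1) *: e1.
have fk : ev f k = 0 by rewrite evB evZ divfK// subrr.
have bk : ev b k = 1 by rewrite evB evZ (frb1 fr) (frb2 fr) mulr0 subr0.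
exists (2 * F * Kb * Kh)^-1, (2 / F * enorm (g *m k) + 1), rho; split => //.
- by rewrite invr_gt0 !mulr_gt0.
- by rewrite ltr_wpDl// mulr_ge0 ?enorm_ge0// divr_ge0// ltW.
move=> w s aw bw cv wr /andP[s0 sr].
have v0 := frame_vec_neq0 s aw.
have [fl fu] : F / 2 <= `|ev f (e1 + w + s *: e2)| /\ `|ev f (e1 + w + s *: e2)| <= 2 * F.
  by apply: hF => //; rewrite ger0_norm.
set v := e1 + w + s *: e2 in cv v0 fl fu *.
have bv : ev b v = s by rewrite !evE bw (frb1 fr) (frb2 fr); ring.
set fv := ev f v in fl fu *; have fvp : 0 < `|fv| by apply: lt_le_trans fl; rewrite divr_gt0.
have fvn : fv != 0 by rewrite -normr_gt0.
have low z : [set x | linval b x = 0] z -> chart f z ->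
    (2 * F * Kb * Kh)^-1 * s <= Defs.edist f g (prj v) z.
  move=> /= bz cz; rewrite -(prjK x0 z) edist_prj ?homog_neq0//.
  set u := homog z; have bu : ev b u = 0 := bz.
  set x := _ - _.
  have bx : ev b x = s / fv by rewrite evB !evZ bv bu mulr0 subr0 mulrC.
  have h1 : s <= 2 * F * (Kb * enorm x).
    have -> : s = `|fv| * `|ev b x| by rewrite -normrM bx mulrC divfK// ger0_norm.
    by apply: ler_pM => //; exact: hKb.
  rewrite ler_pdivrMl ?mulr_gt0//; apply: (le_trans h1).
  rewrite -!mulrA ler_pM2l// ler_pM2l// ler_pM2l//; exact: hKh.
have lb z : [set Defs.edist f g (prj v) z | z in [set x | linval b x = 0] `&` chart f] z ->
    (2 * F * Kb * Kh)^-1 * s <= z.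
  by move=> [y [by0 cy] <-]; exact: low.
(* The projection of the point to the hyperplane [b = 0] along [k], a direction of the chart since
   [ev f k = 0]. It witnesses the upper bound. *)
pose zv := fv^-1 *: v - (s / fv) *: k.
have fz : ev f zv = 1 by rewrite evB !evZ fk mulr0 subr0 mulVf.
have bz : ev b zv = 0 by rewrite evB !evZ bv bk mulr1 mulrC subrr.
have z0 : zv != 0 by apply: (@ev_neq0 f); rewrite fz oner_neq0.
have inz : [set Defs.edist f g (prj v) z | z in [set x | linval b x = 0] `&` chart f]
    (Defs.edist f g (prj v) (prj zv)).
  exists (prj zv) => //; split; last by apply/(chart_prj x0 f z0); rewrite fz oner_neq0.
  by rewrite /= linvalE; have [c c0 ->] := homog_prj x0 z0; rewrite evZ bz mulr0.
split.
  by apply: lb_le_inf => [|z]; [exists (Defs.edist f g (prj v) (prj zv))|exact: lb].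
apply: le_trans (_ : Defs.edist f g (prj v) (prj zv) <= _).
  by apply: ge_inf => //; exists ((2 * F * Kb * Kh)^-1 * s) => z; exact: lb.
rewrite edist_prj// fz invr1 scale1r -/fv.
have -> : fv^-1 *: v - zv = (s / fv) *: k by rewrite opprB addrC subrK.
rewrite -scalemxAr enormZ normrM (ger0_norm s0) normfV.
have : `|fv|^-1 <= 2 / F by rewrite -[2 / F]invf_div lef_pV2 ?posrE// divr_gt0.
move=> /(ler_wpM2l s0) /(ler_wpM2r (enorm_ge0 (g *m k))); lra.
Qed.

Context (hd : (3 <= d)%N).
Local Notation q := (prj e1).
Local Notation Hb := [set x : P | linval b x = 0].

(* The slice of the cone at height s contains, up to a constant, the ball of
   radius s^(1/al), resp. is contained in the ball of radius s^(1/be). *)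
Definition inner_exp (al : R) := exists c s1, [/\ 0 < c, 0 < s1, s1 <= 1 &
  forall s w, 0 < s -> s <= s1 -> ev a w = 0 -> ev b w = 0 -> ~ C (e1 + w + s *: e2) ->
    c * s `^ al^-1 <= enorm w].
Definition outer_exp (be : R) := exists K s1, [/\ 0 < K, 0 < s1, s1 <= 1 &
  forall s w, 0 < s -> s <= s1 -> ev a w = 0 -> ev b w = 0 -> C (e1 + w + s *: e2) ->
    enorm w <= K * s `^ be^-1].

Lemma e1_notin : ~ C e1.
Proof. by move=> /(frb fr); rewrite (frb1 fr) ltxx. Qed.

Lemma q_bdry : bdry Omega q.
Proof. exact/(bdry_prj (frame_neq1 fr) (fr1 fr))/e1_notin. Qed.

Lemma linval_prj F v : v != 0 -> linval F (prj v) = 0 <-> ev F v = 0.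
Proof.
move=> v0; rewrite linvalE; have [k k0 ->] := homog_prj x0 v0; rewrite evZ.
by split => [/eqP|->]; rewrite ?mulr0// mulf_eq0 (negbTE k0) => /eqP.
Qed.

Lemma Hb_supporting : supporting Omega Hb /\ Hb q.
Proof.
have qH : Hb q by apply/(linval_prj b (frame_neq1 fr)); rewrite (frb1 fr).
have b0 : b != 0.
  by apply/eqP => h; have := frb2 fr; rewrite h /ev mul0mx mxE => /eqP; rewrite eq_sym oner_eq0.
split => //; split; first by exists b.
  by exists q; split => //; case: q_bdry.
apply/seteqP; split => // x [xH Ox]; have [v Cv xE] := Omega_lift Ox.
have := xH; rewrite xE /= => /(linval_prj b (cone_neq0 Cv)) bv.
by have := frb fr Cv; rewrite bv ltxx.
Qed.

Lemma split_vec (v : V) : exists w, [/\ ev a w = 0, ev b w = 0 &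
  v = ev a v *: e1 + w + ev b v *: e2].
Proof.
exists (v - ev a v *: e1 - ev b v *: e2); split.
- by rewrite !evB !evZ (fra1 fr) (fra2 fr); ring.
- by rewrite !evB !evZ (frb1 fr) (frb2 fr); ring.
- by vec_ring.
Qed.

Lemma inner_exp_ball al : inner_exp al -> exists c s1, [/\ 0 < c, 0 < s1, s1 <= 1 &
  forall s w, 0 < s -> s <= s1 -> ev a w = 0 -> ev b w = 0 -> enorm w < c * s `^ al^-1 ->
    C (e1 + w + s *: e2)].
Proof.
move=> [c [s1 [c0 s10 s11 h]]]; exists c, s1; split => // s w s0 ss aw bw wc.
by apply: contrapT => /(h s w s0 ss aw bw); rewrite leNgt wc.
Qed.

Lemma supporting_unique al H : 1 < al -> inner_exp al -> supporting Omega H -> H q -> H = Hb.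
Proof.
move=> al1 /inner_exp_ball[c [s1 [c0 s10 s11 hin]]] [[h h0 HE] _ HO] Hq.
have he1 : ev h e1 = 0 by apply/(linval_prj h (frame_neq1 fr)); move: Hq; rewrite HE.
have hn0 v : C v -> ev h v != 0.
  move=> Cv; apply/eqP => hv; have : (H `&` Omega) (prj v).
    by split; [rewrite HE /=; apply/(linval_prj h (cone_neq0 Cv))|case: Cv].
  by rewrite HO.
have C12 := fr12 fr.
have he2 : ev h e2 != 0 by have := hn0 _ C12; rewrite evD he1 add0r.
(* If h w <> 0, the zero of h on the line e1 + R w + s e2 is at distance O(s)
   of the axis, hence inside the slice, which has size s^(1/al). *)
have hw w : ev a w = 0 -> ev b w = 0 -> ev h w = 0.
  move=> aw bw; apply/eqP; rewrite -normr_eq0 eq_le normr_ge0 andbT leNgt; apply/negP => hw0.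
  have w0 : w != 0 by apply/eqP => w0; move: hw0; rewrite w0 ev0 normr0 ltxx.
  have nw := enorm_gt0 w0.
  have p0 : 0 < al^-1 by rewrite invr_gt0 (lt_trans ltr01).
  have p1 : al^-1 < 1 by rewrite invf_lt1// (lt_trans ltr01).
  have h2p : 0 < `|ev h e2| by rewrite normr_gt0.
  pose k := c / 2 / enorm w * `|ev h w| / `|ev h e2|.
  have k0 : 0 < k by rewrite !mulr_gt0 ?invr_gt0.
  have [x1 x10 hx] := small_le_powR p0 p1 k0.
  pose s := Num.min s1 x1; have s0 : 0 < s by rewrite lt_min s10.
  have ss1 : s <= s1 by rewrite ge_min lexx.
  have sx1 : s <= x1 by rewrite ge_min lexx orbT.
  have hs := hx _ s0 sx1.
  pose t := - (s * ev h e2) / ev h w.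
  have hwn : ev h w != 0 by rewrite -normr_gt0.
  have Ct : C (e1 + t *: w + s *: e2).
    apply: hin => //; rewrite ?evZ ?aw ?bw ?mulr0//.
    rewrite enormZ /t normrM normfV normrN normrM (gtr0_norm s0).
    have hs2 : s * `|ev h e2| / `|ev h w| * enorm w <= c / 2 * s `^ al^-1.
      have : s * (`|ev h e2| / `|ev h w| * enorm w) <= k * s `^ al^-1 * (`|ev h e2| / `|ev h w| * enorm w).
        by rewrite ler_wpM2r// mulr_ge0 ?divr_ge0// ltW.
      rewrite /k; set X := `|ev h e2| in h2p *; set Y := `|ev h w| in hw0 *; set S := s `^ _.
      have -> : c / 2 / enorm w * Y / X * S * (X / Y * enorm w) = c / 2 * S.
        by field; rewrite !gt_eqF.
      by move=> hh; apply: le_trans hh; rewrite !mulrA.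
    apply: (le_lt_trans hs2); rewrite ltr_pM2r ?powR_gt0//; lra.
  have := hn0 _ Ct; rewrite !evD !evZ he1 /t divfK// add0r addNr eqxx//.
have hE v : ev h v = ev b v * ev h e2.
  have [w [aw bw vE]] := split_vec v.
  by rewrite {1}vE !evD !evZ he1 hw// mulr0 !add0r.
rewrite HE; apply/seteqP; split => x /=; rewrite !linvalE hE.
  by move=> /eqP; rewrite mulf_eq0 (negbTE he2) orbF => /eqP.
by move=> ->; rewrite mul0r.
Qed.

Lemma inner_C1 al : 1 < al -> inner_exp al -> C1_point Omega q.
Proof.
move=> al1 hin; split; first exact: q_bdry.
exists Hb; split; first exact: Hb_supporting.
by move=> H [sH Hq]; symmetry; exact: supporting_unique hin sH Hq.
Qed.

Lemma inner_C_point al : 1 < al -> inner_exp al -> C_point f g Omega al q.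
Proof.
move=> al1 hin; split; first exact: q_bdry.
have [c [s1 [c0 s10 s11 hs]]] := hin.
have al0 : 0 < al := lt_trans ltr01 al1.
have [m1 [m2 [r1 [m10 m20 r10 h1]]]] := edist_near.
have [m3 [m4 [r2 [m30 m40 r20 h2]]]] := edist_to_near.
pose r := Num.min s1 (Num.min r1 r2).
have r0 : 0 < r by rewrite !lt_min s10 r10.
have [U hU hUy] := frame_nbhs r0.
have ml0 : 0 < m1 `^ al by apply: powR_gt0.
have cl0 : 0 < c `^ al by apply: powR_gt0.
exists U, (m4 / (c `^ al * m1 `^ al)); split => //.
  by rewrite divr_gt0// mulr_gt0.
move=> H y sH Hq Uy [cy ny]; rewrite (supporting_unique al1 hin sH Hq).
have [w [s [aw bw wr /andP[s0 sr] [cv yE]]]] := hUy _ Uy cy.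
move: wr sr; rewrite !lt_min => /and3P[ws1 wr1 wr2] /and3P[ss1 sr1 sr2].
have v0 := frame_vec_neq0 s aw.
have nC : ~ C (e1 + w + s *: e2).
  by apply/(bdry_prj v0 cv); rewrite -yE.
have [_ d2] := h2 w s aw bw cv (ltW wr2) (introT andP (conj s0 (ltW sr2))).
have [d1 _] := h1 w s aw bw cv (ltW wr1) (introT andP (conj s0 (ltW sr1))).
rewrite -yE in d1 d2; apply: (le_trans d2).
have sw : s * c `^ al <= enorm w `^ al.
  move: s0; rewrite le_eqVlt => /predU1P[<-|s0]; first by rewrite mul0r powR_ge0.
  have := hs s w s0 (ltW ss1) aw bw nC => h.
  have := le_powR (ltW al0) (mulr_ge0 (ltW c0) (powR_ge0 _ _)) h.
  by rewrite powRM ?powR_ge0 ?(ltW c0)// powRVK ?(ltW s0)// mulrC.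
have we : enorm w `^ al * m1 `^ al <= Defs.edist f g y q `^ al.
  rewrite -(powRM _ (enorm_ge0 w) (ltW m10)); apply: le_powR; first exact: ltW.
    by rewrite mulr_ge0 ?enorm_ge0// ltW.
  by apply: le_trans d1; rewrite mulrC ler_pM2l// lerDl.
move: (c `^ al) (m1 `^ al) (enorm w `^ al) (Defs.edist f g y q `^ al) cl0 ml0 sw we.
move=> cA mA wA eA cA0 mA0 sw we; rewrite mulrAC ler_pdivlMr ?mulr_gt0// -mulrA ler_pM2l//.
by rewrite mulrA (le_trans _ we)// ler_pM2r.
Qed.

(** From the axis towards [w] the boundary is met over some [t *: w] with [t <= 1]. The hypothesis
    there bounds [s^(1/al)] by a multiple of [enorm (t *: w) + s], and [s] is negligible since
    [al > 1]. If [w] is too long for the neighborhood, there is nothing to estimate. *)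
Lemma C_point_inner al : 1 < al -> C_point f g Omega al q -> inner_exp al.
Proof.
move=> al1 [_ [U [K [hU K0 hK]]]].
have al0 : 0 < al := lt_trans ltr01 al1.
have p0 : 0 < al^-1 by rewrite invr_gt0.
have p1 : al^-1 < 1 by rewrite invf_lt1.
have [m1 [m2 [r1 [m10 m20 r10 h1]]]] := edist_near.
have [m3 [m4 [r2 [m30 m40 r20 h2]]]] := edist_to_near.
have [rU rU0 hrU] := nbhs_frame hU.
pose r := Num.min rU (Num.min r1 r2).
have r0 : 0 < r by rewrite !lt_min rU0 r10.
have k0 : 0 < K * m2 `^ al / m3 by rewrite divr_gt0// mulr_gt0// powR_gt0.
set k := K * m2 `^ al / m3 in k0.
pose c2 := (k^-1) `^ al^-1; have c20 : 0 < c2 by rewrite powR_gt0// invr_gt0.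
have c22 : 0 < c2 / 2 by rewrite divr_gt0.
have [x1 x10 hx] := small_le_powR p0 p1 c22.
have rh0 : 0 < r / 2 by rewrite divr_gt0.
have c0 : 0 < Num.min (c2 / 2) r by rewrite lt_min c22.
exists (Num.min (c2 / 2) r), (Num.min 1 (Num.min x1 (r / 2))); split => //.
- by rewrite !lt_min ltr01 x10.
- by rewrite ge_min lexx.
move=> s w s0; rewrite !le_min => /and3P[s1 sx sr] aw bw nC.
have sp : s `^ al^-1 <= 1.
  by have := le_powR (ltW p0) (ltW s0) s1; rewrite powR1.
have [wr|wr] := leP r (enorm w).
  apply: le_trans wr; apply: (@le_trans _ _ (r * s `^ al^-1)).
    by rewrite ler_wpM2r ?powR_ge0// ge_min lexx orbT.
  by rewrite ger_pMr.
have CA := frame_axis hC fr s0.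
have ncw : ~ clo C w by move=> /(_ _ CA) cw; apply: nC; rewrite -addrA addrCA.
have [t [t0 ct nt hlt]] := oc_exit hC CA ncw.
have t1 : t <= 1.
  rewrite leNgt; apply/negP => t1; apply: nC; have := hlt 1 ler01 t1.
  by rewrite scale1r addrAC.
rewrite addrAC in ct nt.
have tw : enorm (t *: w) <= enorm w by rewrite enormZ gtr0_norm// ler_piMl// enorm_ge0.
have atw : ev a (t *: w) = 0 by rewrite evZ aw mulr0.
have btw : ev b (t *: w) = 0 by rewrite evZ bw mulr0.
have twr := le_lt_trans tw wr.
have srr : s < r by lra.
move: (twr) (srr); rewrite !lt_min => /and3P[u1 u2 u3] /and3P[u4 u5 u6].
have [v0 Uv] : e1 + t *: w + s *: e2 != 0 /\ U (prj (e1 + t *: w + s *: e2)).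
  by apply: hrU => //; rewrite gtr0_norm.
have bv : bdry Omega (prj (e1 + t *: w + s *: e2)).
  by apply/(bdry_prj v0 ct).
have s00 : 0 <= s by exact: ltW.
have [_ d1] := h1 _ s atw btw ct (ltW u2) (introT andP (conj s00 (ltW u5))).
have [d2 _] := h2 _ s atw btw ct (ltW u3) (introT andP (conj s00 (ltW u6))).
have [sH Hq] := Hb_supporting.
have hh := le_trans d2 (hK _ _ sH Hq Uv bv).
have e0 : 0 <= Defs.edist f g (prj (e1 + t *: w + s *: e2)) q by exact: enorm_ge0.
have := le_powR (ltW al0) e0 d1; rewrite powRM ?(ltW m20) ?addr_ge0 ?enorm_ge0// => hp.
have hk : s <= k * (enorm (t *: w) + s) `^ al.
  rewrite /k mulrAC ler_pdivlMr// mulrC; apply: (le_trans hh).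
  by rewrite -mulrA ler_pM2l.
have : c2 * s `^ al^-1 <= enorm (t *: w) + s.
  have sk : s / k <= (enorm (t *: w) + s) `^ al by rewrite ler_pdivrMr// mulrC.
  have sk0 : 0 <= s / k by rewrite divr_ge0// ltW.
  have := le_powR (ltW p0) sk0 sk.
  by rewrite powRK ?addr_ge0 ?enorm_ge0// powRM ?invr_ge0 ?(ltW k0)// mulrC.
have := hx _ s0 sx.
have : Num.min (c2 / 2) r * s `^ al^-1 <= c2 / 2 * s `^ al^-1.
  by rewrite ler_wpM2r ?powR_ge0// ge_min lexx.
by lra.
Qed.

Lemma outer_convex_point al be : 1 < al -> inner_exp al -> 1 <= be -> outer_exp be ->
  convex_point f g Omega be q.
Proof.
move=> al1 hin be1 [K [s1 [K0 s10 s11 hs]]]; split; first exact: inner_C1 hin.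
have be0 : 0 < be := lt_le_trans ltr01 be1.
have p0 : 0 < be^-1 by rewrite invr_gt0.
have p1 : be^-1 <= 1 by rewrite invf_le1.
have [m1 [m2 [r1 [m10 m20 r10 h1]]]] := edist_near.
have [m3 [m4 [r2 [m30 m40 r20 h2]]]] := edist_to_near.
pose r := Num.min s1 (Num.min r1 r2).
have r0 : 0 < r by rewrite !lt_min s10 r10.
have [U hU hUy] := frame_nbhs r0.
have N0 : 0 < m2 * (2 * K + 1) by rewrite mulr_gt0// addr_gt0// mulr_gt0.
exists U, (m3 / (m2 * (2 * K + 1)) `^ be); split => //.
  by rewrite divr_gt0// powR_gt0.
move=> H y sH Hq Uy [cy ny]; rewrite (supporting_unique al1 hin sH Hq).
have [w [s [aw bw wr /andP[s0 sr] [cv yE]]]] := hUy _ Uy cy.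
move: wr sr; rewrite !lt_min => /and3P[ws1 wr1 wr2] /and3P[ss1 sr1 sr2].
have [d2 _] := h2 w s aw bw cv (ltW wr2) (introT andP (conj s0 (ltW sr2))).
have [_ d1] := h1 w s aw bw cv (ltW wr1) (introT andP (conj s0 (ltW sr1))).
rewrite -yE in d1 d2; apply: le_trans d2.
have half t : 0 < t -> s <= t -> t <= s1 -> enorm w <= 2 * K * t `^ be^-1.
  move=> t0 st t1; have Ct := frame_axis hC fr t0.
  have := hs t (2^-1 *: w) t0 t1; rewrite !evZ aw bw mulr0 => /(_ erefl erefl).
  rewrite enormZ gtr0_norm ?invr_gt0// => h.
  have : C (e1 + 2^-1 *: w + t *: e2).
    rewrite (_ : _ + _ = (1 / 2) *: (e1 + t *: e2) + 1 *: ((1 / 2) *: (e1 + w + s *: e2) + (0 *: e1 + ((t - s) / 2) *: e2))).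
      apply: (oc_comb hC) => //; apply: (clo_frame hC fr) => //; first by lra.
      by apply: (cloZ hC).
    by vec_field.
  move=> /h; lra.
have e0 : 0 <= Defs.edist f g y q by exact: enorm_ge0.
(* A boundary point at height 0 has no slice of its own. Comparison with the slices at all small
   heights [t > 0] forces [w = 0], so that the point is the end point of the ray itself. *)
move: s0; rewrite le_eqVlt => /predU1P[s0|s0]; last first.
  have hw := half s s0 (lexx _) (ltW ss1).
  have sp : s <= s `^ be^-1 by apply: ger1_powR => //; rewrite s0 (le_trans (ltW ss1)).
  have hd' : Defs.edist f g y q <= m2 * (2 * K + 1) * s `^ be^-1.
    apply: (le_trans d1); rewrite -mulrA ler_pM2l//; lra.
  have := le_powR (ltW be0) e0 hd'.
  rewrite powRM ?powR_ge0 ?(ltW N0)// powRVK ?(ltW s0)// => h.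
  by rewrite mulrAC ler_pdivrMr ?powR_gt0// -mulrA ler_pM2l// mulrC.
have w0 : enorm w = 0.
  apply/eqP; rewrite eq_le enorm_ge0 andbT leNgt; apply/negP => w0.
  have c0 : 0 < enorm w / (4 * K) by rewrite divr_gt0// mulr_gt0.
  have [x1 x10 hx] := small_powR p0 c0.
  pose t := Num.min s1 x1; have t0 : 0 < t by rewrite lt_min s10.
  have := half t t0; rewrite -s0 (ltW t0) => /(_ isT); rewrite ge_min lexx => /(_ isT).
  have := hx t (ltW t0); rewrite ge_min lexx orbT => /(_ isT).
  rewrite ler_pdivlMr ?mulr_gt0// => i1 i2; nra.
have -> : Defs.edist f g y q = 0.
  by apply/eqP; rewrite eq_le e0 andbT (le_trans d1)// w0 -s0 addr0 mulr0.
by rewrite -s0 powR0 ?gt_eqF// !mulr0.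
Qed.

(** From a point of the slice the path down along [- e2] meets the boundary at a smaller height,
    where the hypothesis applies. Here [be] is an arbitrary real; it is at least 1 because the slice
    at height [s] contains a transverse vector of size of order [s]. *)
Lemma convex_point_outer be : convex_point f g Omega be q -> 1 <= be /\ outer_exp be.
Proof.
move=> [_ [U [K [hU K0 hK]]]].
have [m1 [m2 [r1 [m10 m20 r10 h1]]]] := edist_near.
have [m3 [m4 [r2 [m30 m40 r20 h2]]]] := edist_to_near.
have [rU rU0 hrU] := nbhs_frame hU.
pose r := Num.min rU (Num.min r1 r2).
have r0 : 0 < r by rewrite !lt_min rU0 r10.
have n2 : ~ clo C (- e2).
  move=> h; have := clo_anti hC (fr2 fr) h; apply/eqP; exact: frame_neq2 fr.
have down s w : 0 < s -> s < r -> ev a w = 0 -> ev b w = 0 -> C (e1 + w + s *: e2) ->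
    enorm w < r -> exists t, [/\ 0 <= t, t <= s &
      exists2 D, K * D `^ be <= m4 * s & m1 * (enorm w + t) <= D /\ D <= m2 * (enorm w + t)].
  move=> s0 sr aw bw Cv wr; have [t [t0 ct nt _]] := oc_exit hC Cv n2.
  have vE : e1 + w + s *: e2 + t *: - e2 = e1 + w + (s - t) *: e2.
    by vec_ring.
  rewrite vE in ct nt.
  have st : 0 <= s - t.
    have : 0 <= ev b (e1 + w + (s - t) *: e2) by apply: (clo_ge0 hC) ct => x /(frb fr)/ltW.
    by rewrite !evE bw (frb1 fr) (frb2 fr) !add0r mulr1.
  have ts : s - t <= s by lra.
  have sr' := le_lt_trans ts sr.
  move: (wr) (sr'); rewrite !lt_min => /and3P[u1 u2 u3] /and3P[u4 u5 u6].
  have [v0 Uv] : e1 + w + (s - t) *: e2 != 0 /\ U (prj (e1 + w + (s - t) *: e2)).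
    by apply: hrU => //; rewrite ger0_norm.
  have bv : bdry Omega (prj (e1 + w + (s - t) *: e2)).
    by apply/(bdry_prj v0 ct).
  have [sH Hq] := Hb_supporting.
  have d1 := h1 _ _ aw bw ct (ltW u2) (introT andP (conj st (ltW u5))).
  have [_ d2] := h2 _ _ aw bw ct (ltW u3) (introT andP (conj st (ltW u6))).
  exists (s - t); split => //.
  exists (Defs.edist f g (prj (e1 + w + (s - t) *: e2)) q) => //.
  apply: (le_trans (hK _ _ sH Hq Uv bv)); apply: (le_trans d2).
  by rewrite ler_pM2l.
have be1 : 1 <= be.
  rewrite leNgt; apply/negP => be1; have p0 : 0 < 1 - be by rewrite subr_gt0.
  have [w0 [w0n aw0 bw0 Cw0]] := frame_transverse hd hC fr.
  have nw0 := enorm_gt0 w0n.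
  pose k := K * (m1 * enorm w0) / (2 * m4).
  have k0 : 0 < k by rewrite divr_gt0 ?mulr_gt0.
  have [x1 x10 hx] := small_powR p0 k0.
  pose N := enorm w0 + 1; have N0 : 0 < N by rewrite addr_gt0.
  pose s := Num.min (1 / 2) (Num.min (r / (2 * N)) (x1 / (m2 * N))).
  have s0 : 0 < s by rewrite !lt_min !divr_gt0 ?mulr_gt0.
  have : s <= s by []; rewrite {2}/s !le_min => /and3P[s1 sr sx].
  rewrite ler_pdivlMr ?mulr_gt0// in sr; rewrite ler_pdivlMr ?mulr_gt0// in sx.
  clearbody s.
  have sw0 : 0 < s * enorm w0 by rewrite mulr_gt0.
  have Cw : C (e1 + s *: w0 + s *: e2) by apply: Cw0 => //; lra.
  have swE : enorm (s *: w0) = s * enorm w0 by rewrite enormZ gtr0_norm.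
  have srr : s < r by rewrite /N in sr; nra.
  have aw : ev a (s *: w0) = 0 by rewrite evZ aw0 mulr0.
  have bw : ev b (s *: w0) = 0 by rewrite evZ bw0 mulr0.
  have wr : enorm (s *: w0) < r by rewrite swE; rewrite /N in sr; lra.
  have [t [t0 ts [D D1 [D2 D3]]]] := down s (s *: w0) s0 srr aw bw Cw wr.
  rewrite swE in D2 D3.
  have D0 : 0 < D.
    by apply: lt_le_trans D2; rewrite mulr_gt0// ltr_pwDl.
  have Dx : D <= x1.
    rewrite (le_trans D3)// (le_trans _ sx)// mulrCA ler_pM2l//.
    by rewrite /N mulrDr mulr1 lerD2l.
  have := hx D (ltW D0) Dx => Dk.
  have DE : D = D `^ (1 - be) * D `^ be.
    rewrite -powRD ?subrK ?powRr1 ?(ltW D0)//.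
    by apply/implyP => _; rewrite gt_eqF.
  have Db : 0 < D `^ be by apply: powR_gt0.
  have i1 : m1 * (s * enorm w0) <= D.
    by apply: le_trans D2; rewrite ler_pM2l// lerDl.
  have i2 : D <= k * D `^ be by rewrite {1}DE ler_pM2r.
  have i3 : k * (K * D `^ be) <= k * (m4 * s) by rewrite ler_pM2l.
  have i4 : k * (m4 * s) = K * (m1 * enorm w0) * s / 2.
    by rewrite /k; field; rewrite gt_eqF.
  have i5 : K * (m1 * (s * enorm w0)) <= K * D by rewrite ler_pM2l.
  have i6 : K * D <= K * (k * D `^ be) by rewrite ler_pM2l.
  have i7 : 0 < K * (m1 * enorm w0) * s by rewrite !mulr_gt0.
  by lra.
split => //.
have be0 : 0 < be := lt_le_trans ltr01 be1.
have p0 : 0 < be^-1 by rewrite invr_gt0.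
have mb0 : 0 < m1 `^ be by apply: powR_gt0.
pose k := m4 / (K * m1 `^ be).
have k0 : 0 < k by rewrite divr_gt0// mulr_gt0.
have key s w : 0 < s -> s < r -> ev a w = 0 -> ev b w = 0 -> C (e1 + w + s *: e2) ->
    enorm w < r -> enorm w `^ be <= k * s.
  move=> s0 sr aw bw Cw wr; have [t [t0 ts [D D1 [D2 D3]]]] := down s w s0 sr aw bw Cw wr.
  have : m1 `^ be * enorm w `^ be <= D `^ be.
    rewrite -powRM ?enorm_ge0 ?(ltW m10)//; apply: le_powR; first exact: ltW.
      by rewrite mulr_ge0 ?enorm_ge0// ltW.
    by apply: le_trans D2; rewrite ler_pM2l// lerDl.
  move=> /(ler_wpM2l (ltW K0)) h.
  by rewrite /k mulrAC ler_pdivlMr ?mulr_gt0//; lra.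
pose c := (r / 2) `^ be / (2 * k).
have rh0 : 0 < r / 2 by rewrite divr_gt0.
have c0 : 0 < c by rewrite divr_gt0 ?powR_gt0// mulr_gt0.
exists (k `^ be^-1), (Num.min 1 (Num.min (r / 2) c)); split.
- exact: powR_gt0.
- by rewrite !lt_min ltr01 rh0.
- by rewrite ge_min lexx.
move=> s w s0; rewrite !le_min => /and3P[s1 sr sc] aw bw Cw.
have srr : s < r by lra.
have [wr|wr] := ltP (enorm w) r.
  have := le_powR (ltW p0) (powR_ge0 _ _) (key s w s0 srr aw bw Cw wr).
  by rewrite powRK ?enorm_ge0// powRM ?(ltW k0)// ltW.
(* A long [w] is shrunk towards [e1] to norm [r / 2]. The height only decreases, and [key]
   contradicts the choice of [c], which makes [k * s] at most half of the power of [r / 2]. *)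
exfalso; have w0 : 0 < enorm w := lt_le_trans r0 wr.
pose t := r / 2 / enorm w; have t0 : 0 < t by rewrite divr_gt0.
have t1 : t <= 1 by rewrite ler_pdivrMr// mul1r; lra.
have Ct : C (e1 + t *: w + (t * s) *: e2).
  rewrite (_ : _ + _ = t *: (e1 + w + s *: e2) + (1 - t) *: e1).
    by apply: (oc_comb hC) => //; [exact: (fr1 fr)|rewrite subr_ge0].
  by vec_ring.
have ts : t * s <= s by rewrite ler_piMl// ltW.
have twE : enorm (t *: w) = r / 2 by rewrite enormZ gtr0_norm// divfK// gt_eqF.
have := key (t * s) (t *: w) (mulr_gt0 t0 s0) (le_lt_trans ts srr).
rewrite !evZ aw bw mulr0 twE => /(_ erefl erefl Ct) h.
have rr : r / 2 < r by rewrite ltr_pdivrMr// ltr_pMr// ltr1n.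
have {h} := h rr; have cE : c * (2 * k) = (r / 2) `^ be by rewrite divfK// gt_eqF// mulr_gt0.
have i1 : k * (t * s) <= k * s by rewrite ler_pM2l.
have i2 : k * s <= k * c by rewrite ler_pM2l.
have i3 : 0 < k * c by rewrite mulr_gt0.
by lra.
Qed.

End Domain.

(** * Exponents of a Morse ray *)

Section MorseExponents.
Context {R : realType}.
Implicit Types dl m : R.

(** The factor 1/2 makes [expR (2 * m) ^+ 2 * morse_ratio m] equal to 1/2, which leaves the strict
    inequality needed as [dlM]. *)
Definition morse_ratio m : R := expR (- (4 * m)) / 2.
Definition morse_alpha dl : R := ln 2 / (ln 2 - ln (1 + dl / 20)).
Definition morse_beta dl : R := ln 2 / ln (1 + dl / 20).

Lemma morse_ratio_bounds m : 0 <= m ->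
  [/\ 0 < morse_ratio m, morse_ratio m <= 1 & expR (2 * m) ^+ 2 * morse_ratio m < 1].
Proof.
move=> m0; have E0 := expR_gt0 (- (4 * m)); rewrite /morse_ratio; split.
- by rewrite divr_gt0.
- have : expR (- (4 * m)) <= 1 by rewrite -[leRHS]expR0 ler_expR; lra.
  lra.
- rewrite expr2 -expRD mulrA -expRD (_ : _ + _ = 0) ?expR0; last by ring.
  lra.
Qed.

Section Bounds.
Context (dl : R) (dl0 : 0 < dl) (dl1 : dl <= 1).

Let lnb : 0 < ln (1 + dl / 20) /\ ln (1 + dl / 20) < ln 2.
Proof.
have h0 := dl0; have h1 := dl1.
by split; [apply: ln_gt0; lra|rewrite ltr_ln ?posrE; lra].
Qed.

Lemma morse_alpha_gt1 : 1 < morse_alpha dl.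
Proof. by have [h1 h2] := lnb; rewrite ltr_pdivlMr ?mul1r; lra. Qed.

Lemma morse_beta_gt1 : 1 < morse_beta dl.
Proof. by have [h1 h2] := lnb; rewrite ltr_pdivlMr ?mul1r; lra. Qed.

Lemma powR2_alpha : 2 `^ (morse_alpha dl)^-1 = 2 / (1 + dl / 20) :> R.
Proof.
have [h1 h2] := lnb; have h0 := dl0.
rewrite /powR gt_eqF// /morse_alpha invf_div divfK ?gt_eqF//; last by apply: ln_gt0; lra.
by rewrite expRB !lnK ?posrE//; lra.
Qed.

Lemma powR2_beta : 2 `^ (morse_beta dl)^-1 = 1 + dl / 20 :> R.
Proof.
have [h1 h2] := lnb; have h0 := dl0.
rewrite /powR gt_eqF// /morse_beta invf_div divfK ?gt_eqF//; last by apply: ln_gt0; lra.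
by rewrite lnK ?posrE//; lra.
Qed.

End Bounds.

Lemma half_power s : 0 < s -> exists k, (2 ^- k : R) <= s.
Proof.
move=> s0; exists (Num.trunc s^-1).+1; have h := truncnS_gt s^-1.
rewrite invf_ple ?posrE ?exprn_gt0//.
apply: ltW; apply: (lt_le_trans h).
by rewrite -natrX ler_nat ltnW// ltn_expl.
Qed.

End MorseExponents.

Section MorseCone.
Context {R : realType} {d : nat} (hd : (3 <= d)%N).
Local Notation V := 'cV[R]_d.
Context {Omega : set (projspace R d)} {x0 : projspace R d} {f0 : 'rV[R]_d}.
Local Notation C := (@cone R d Omega x0 f0).
Context (hC : open_cone C f0) {D : V -> V -> R} (hD : hilbert_like C D)
  {M : R -> R -> R} {ell : set V} (hM : cone_morse C D M ell) (M0 : 0 <= M 5 1).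
Context {e1 e2 : V} {a b : 'rV[R]_d} (fr : frame C e1 e2 a b) (ax : axis ell e1 e2)
  (hell : forall s, 0 < s -> s <= 1 -> ell (e1 + s *: e2)).
Local Notation dl := (morse_ratio (M 5 1)).

Lemma cone_round s w : 0 < s -> s <= 1 -> ev a w = 0 -> ev b w = 0 ->
  C (e1 + w + s *: e2) -> clo C (e1 - (dl / 2) *: w + s *: e2).
Proof.
move=> s0 s1 aw bw Cw; have [dl0 dl1 dlM] := morse_ratio_bounds M0.
apply: (clo_oc hC).
have -> : (dl / 2) *: w = dl *: (2^-1 *: w) by rewrite scalerA.
apply: (morse_round hC hD hM dl0 dl1 dlM fr ax) => //.
- by rewrite evZ aw mulr0.
- by rewrite evZ bw mulr0.
- exact: hell.
- by apply: hell; [rewrite mulr_gt0|rewrite mulr_ile1// ltW].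
- by apply: (clo_oc hC); rewrite scalerA mulfV ?scale1r.
Qed.

Lemma morse_inner_exp : @inner_exp R d Omega x0 f0 e1 e2 a b (morse_alpha dl).
Proof.
have [dl0 dl1 dlM] := morse_ratio_bounds M0.
have [c1 c10 hball] := frame_ball hC fr.
have al1 := morse_alpha_gt1 dl0 dl1; have p2 := powR2_alpha dl0 dl1.
set p := (morse_alpha dl)^-1 in p2 *.
have p0 : 0 <= p by rewrite invr_ge0 (le_trans ler01)// ltW.
have d20 : 0 < 1 + dl / 20 by have := dl0; lra.
have c20 : 0 < c1 / 2 by rewrite divr_gt0.
have base s w : 2^-1 <= s -> s <= 1 -> enorm w <= c1 / 2 * s `^ p -> C (e1 + w + s *: e2).
  move=> sh s1 hw; have s0 : 0 < s by apply: lt_le_trans sh.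
  have sp : s `^ p <= 1 by have := le_powR p0 (ltW s0) s1; rewrite powR1.
  rewrite addrAC; apply: hball => //; apply: (le_trans hw).
  by rewrite -mulrA ler_pM2l// (le_trans _ sh)// ger_pMr.
(* Induction over dyadic heights. The step from [2 * s] to [s] multiplies [w] by
   [(1 + dl / 20) / 2], which is exactly the factor by which the [p]-th power of the height
   decreases. *)
have ind k : forall s w, 2 ^- k <= s -> s <= 1 -> ev a w = 0 -> ev b w = 0 ->
    enorm w <= c1 / 2 * s `^ p -> C (e1 + w + s *: e2).
  elim: k => [|k IH] s w sk s1 aw bw hw.
    by apply: base => //; apply: le_trans sk; rewrite expr0 invr1 invf_le1// ler1n.
  have [/base|s2] := leP 2^-1 s; first exact.
  have s0 : 0 < s by apply: lt_le_trans sk; rewrite invr_gt0 exprn_gt0.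
  have s20 : 0 < 2 * s by rewrite mulr_gt0.
  have s21 : 2 * s <= 1 by rewrite mulrC -ler_pdivlMr// div1r ltW.
  have sE : s = 2 * s / 2 by rewrite mulrAC mulfV// mul1r.
  have Dn : (1 + dl / 20) / 2 != 0 by rewrite gt_eqF// divr_gt0.
  have wE : w = ((1 + dl / 20) / 2) *: (((1 + dl / 20) / 2)^-1 *: w).
    by rewrite scalerA mulfV ?scale1r.
  rewrite wE {1}sE; apply: (morse_C1 hC hD hM dl0 dl1 dlM M0 fr ax) => //.
  - by rewrite evZ aw mulr0.
  - by rewrite evZ bw mulr0.
  - move=> t t1 t2; apply: hell; last by apply: le_trans s21.
    by apply: lt_le_trans t1; apply: mulr_gt0 => //; exact: divr_gt0.
  - apply: IH => //.
    + by rewrite -ler_pdivrMl// -invfM -exprS.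
    + by rewrite evZ aw mulr0.
    + by rewrite evZ bw mulr0.
    + rewrite enormZ gtr0_norm ?invr_gt0 ?divr_gt0// powRM ?(ltW s0)// p2 invf_div.
      by rewrite mulrCA ler_pM2l// divr_gt0.
exists (c1 / 2), 1; split => // s w s0 s1 aw bw nC; rewrite leNgt; apply/negP => hw.
by have [k hk] := half_power s0; apply: nC; apply: (ind k) => //; exact: ltW.
Qed.

Lemma morse_outer_exp : @outer_exp R d Omega x0 f0 e1 e2 a b (morse_beta dl).
Proof.
have [dl0 dl1 dlM] := morse_ratio_bounds M0.
have be1 := morse_beta_gt1 dl0 dl1; have p2 := powR2_beta dl0 dl1.
set p := (morse_beta dl)^-1 in p2 *.
have p0 : 0 <= p by rewrite invr_ge0 (le_trans ler01)// ltW.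
have d20 : 0 < 1 + dl / 20 by have := dl0; lra.
have h20 : 0 < dl / 2 by rewrite divr_gt0.
have h21 : dl / 2 <= 1 by have := dl1; lra.
have [W W0 hW] := slice_bounded hd hC fr h20 h21.
(* [morse_convex] at height [s] uses the axis up to height [s * (4 / dl)], and the ray only provides
   heights up to 1. *)
pose s1 := dl / 4; have s10 : 0 < s1 by rewrite divr_gt0.
have s11 : s1 <= 1 by rewrite /s1; have := dl1; lra.
have s1p : 0 < (s1 / 2) `^ p by rewrite powR_gt0// divr_gt0.
pose K := W / (s1 / 2) `^ p; have K0 : 0 < K by rewrite divr_gt0.
have base s w : s1 / 2 <= s -> s <= s1 -> ev a w = 0 -> ev b w = 0 ->
    C (e1 + w + s *: e2) -> enorm w <= K * s `^ p.
  move=> sh ss aw bw Cw; have s0 : 0 < s by apply: lt_le_trans sh; rewrite divr_gt0.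
  have h := le_powR p0 (ltW (divr_gt0 s10 (ltr0n R 2))) sh.
  have s1' := le_trans ss s11.
  apply: (@le_trans _ _ W); first by apply: (hW s w) => //; [exact: (clo_oc hC)|exact: cone_round].
  by rewrite -[leLHS](divfK (lt0r_neq0 s1p)) ler_pM2l.
have ind k : forall s w, 2 ^- k <= s -> s <= s1 -> ev a w = 0 -> ev b w = 0 ->
    C (e1 + w + s *: e2) -> enorm w <= K * s `^ p.
  elim: k => [|k IH] s w sk ss aw bw Cw.
    by apply: base => //; apply: le_trans sk; rewrite expr0 invr1; lra.
  have [/base|s2] := leP (s1 / 2) s; first exact.
  have s0 : 0 < s by apply: lt_le_trans sk; rewrite invr_gt0 exprn_gt0.
  have s20 : 2 * s <= s1 by lra.
  have Cn : C (e1 + (1 + dl / 20) *: w + (2 * s) *: e2).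
    apply: (morse_convex hC hD hM dl0 dl1 dlM M0 fr ax) => // t t1 t2.
    apply: hell; first exact: lt_le_trans t1.
    apply: (le_trans t2); rewrite mulrA ler_pdivrMr// mul1r; rewrite /s1 in ss; lra.
  have := IH (2 * s) ((1 + dl / 20) *: w); rewrite !evZ aw bw mulr0 enormZ gtr0_norm//.
  rewrite powRM ?(ltW s0)// p2 mulrCA ler_pM2l//; apply => //.
  by rewrite -ler_pdivrMl// -invfM -exprS.
exists K, s1; split => // s w s0 ss aw bw Cw.
by have [k hk] := half_power s0; apply: (ind k).
Qed.

End MorseCone.

(** * Growth of the singular values *)

Section LogQuotient.
Context {R : realType}.
Implicit Types A B t k x y : R.

(** The scale [k], which is unknown for each element of the sequence, cancels in the quotient of two
    singular values. *)
Lemma ln_quot_le A B t k x y : 0 < A -> 0 < B -> 0 < t -> 0 < k -> 0 < x ->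
  x <= A / k -> B * t / k <= y -> ln (x / y) <= - ln t + (ln A - ln B).
Proof.
move=> A0 B0 t0 k0 x0 xA By; have By0 : 0 < B * t / k by rewrite divr_gt0// mulr_gt0.
have y0 := lt_le_trans By0 By.
have h1 : ln x <= ln A - ln k by rewrite -ln_div ?posrE// ler_ln ?posrE// divr_gt0.
have h2 : ln B + ln t - ln k <= ln y.
  by rewrite -lnM ?posrE// -ln_div ?posrE ?mulr_gt0// ler_ln ?posrE.
by rewrite ln_div ?posrE//; lra.
Qed.

Lemma ln_quot_ge A B t k x y : 0 < A -> 0 < B -> 0 < t -> 0 < k -> 0 < y ->
  A / k <= x -> y <= B * t / k -> - ln t + (ln A - ln B) <= ln (x / y).
Proof.
move=> A0 B0 t0 k0 y0 Ax yB; have Ak0 : 0 < A / k by rewrite divr_gt0.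
have x0 := lt_le_trans Ak0 Ax.
have h1 : ln A - ln k <= ln x by rewrite -ln_div ?posrE// ler_ln ?posrE// divr_gt0.
have h2 : ln y <= ln B + ln t - ln k.
  by rewrite -lnM ?posrE// -ln_div ?posrE ?mulr_gt0// ler_ln ?posrE// divr_gt0// mulr_gt0.
by rewrite ln_div ?posrE//; lra.
Qed.

Lemma common_bound (s : seq R) : exists k, forall x, x \in s -> - k <= x <= k.
Proof.
exists (\sum_(x <- s) `|x|) => x xs.
by rewrite -ler_norml (big_rem x)//= lerDl sumr_ge0.
Qed.

End LogQuotient.

Section SingularAsymptotics.
Context {R : realType} {d : nat} (hd : (3 <= d)%N).
Local Notation V := 'cV[R]_d.
Context {C : set V} {f0 : 'rV[R]_d} (hC : open_cone C f0).
Context {e1 e2 : V} {a b : 'rV[R]_d} (fr : frame C e1 e2 a b).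
Context {dl : R} (dl0 : 0 < dl) (dl1 : dl <= 1)
  (hround : forall s w, 0 < s -> s <= 1 -> ev a w = 0 -> ev b w = 0 ->
    C (e1 + w + s *: e2) -> clo C (e1 - dl *: w + s *: e2)).

Lemma mu_bounds c K : 0 < c -> 0 < K -> exists k, forall s g kap, 0 < s -> s <= 1 ->
  @distortion R d C c K kap g (e1 + s *: e2) ->
  [/\ - ln s - k <= mu 1 d g <= - ln s + k,
    forall w, ev a w = 0 -> ev b w = 0 -> ~ C (e1 + w + s *: e2) ->
      - ln (enorm w) - k <= mu 1 d.-1 g,
    forall rho, 0 < rho -> rho <= 1 ->
      (forall w, ev a w = 0 -> ev b w = 0 -> enorm w <= rho -> clo C (e1 + w + s *: e2)) ->
      mu 1 d.-1 g <= - ln rho + k,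
    forall w, ev a w = 0 -> ev b w = 0 -> w != 0 -> C (e1 + w + s *: e2) ->
      mu 1 2 g <= - ln (enorm w) + k &
    forall rho, (forall w, ev a w = 0 -> ev b w = 0 -> C (e1 + w + s *: e2) -> enorm w <= rho) ->
      - ln rho - k <= mu 1 2 g].
Proof.
move=> c0 K0; have [A1 A10 h1] := sigma1_lower hC fr c K0.
have [A2 A20 h2] := sigma1_upper hd hC fr K c0.
have [A3 A30 h3] := sigmad_lower hd hC fr c K0.
have [A4 A40 h4] := sigmad_upper hd hC fr K c0.
have [A5 A50 h5] := sigma_dm1_upper hd hC fr K c0.
have [A6 A60 h6] := sigma_dm1_lower hd hC fr c K0.
have [A7 A70 h7] := sigma2_lower hd hC fr c K0 dl0 dl1.
have [A8 A80 h8] := sigma2_upper hd hC fr K c0.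
have [c1 c10 hball] := frame_ball hC fr.
have [w0 [w0n aw0 bw0 Cw0]] := frame_transverse hd hC fr.
have n0 := enorm_gt0 w0n.
have [k hk] := common_bound [:: ln A1 - ln A4; ln A2 - ln A3; ln A1 - ln A5;
  ln A2 - ln A6; ln A2 - ln A7; ln A1 - ln A8].
have /andP[b14 _] := hk _ (mem_head _ _).
have /andP[_ b23] : - k <= ln A2 - ln A3 <= k by apply: hk; rewrite !inE eqxx !orbT.
have /andP[b15 _] : - k <= ln A1 - ln A5 <= k by apply: hk; rewrite !inE eqxx !orbT.
have /andP[_ b26] : - k <= ln A2 - ln A6 <= k by apply: hk; rewrite !inE eqxx !orbT.
have /andP[_ b27] : - k <= ln A2 - ln A7 <= k by apply: hk; rewrite !inE eqxx !orbT.
have /andP[b18 _] : - k <= ln A1 - ln A8 <= k by apply: hk; rewrite !inE eqxx !orbT.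
exists k => s g kap s0 s1 ds; have k0 := ds_kap ds.
have [g1 g2 g3 g4] := And4 (h1 s g kap s0 s1 ds) (h2 s g kap s0 s1 ds)
   (h3 s g kap s0 s1 ds) (h4 s g kap s0 s1 ds).
have g5 := h5 s g kap s0 s1 ds; have g6 := h6 s g kap s0 s1 ds.
have g7 := h7 s g kap s0 s1 ds; have g8 := h8 s g kap s0 s1 ds.
have p1 : 0 < sigma 1 g by apply: lt_le_trans g1; rewrite divr_gt0.
have pd : 0 < sigma d g by apply: lt_le_trans g3; rewrite divr_gt0// mulr_gt0.
have Csw := Cw0 s s0 s1.
have asw : ev a (s *: w0) = 0 by rewrite evZ aw0 mulr0.
have bsw : ev b (s *: w0) = 0 by rewrite evZ bw0 mulr0.
have nsw : 0 < enorm (s *: w0) by rewrite enormZ mulr_gt0// normr_gt0 gt_eqF.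
(* The middle singular values must be positive before logarithms are taken; the transverse vector
   [s *: w0] and a small ball in the slice show this. *)
have p2 : 0 < sigma 2 g.
  apply: lt_le_trans (g7 _ asw bsw Csw (hround s0 s1 asw bsw Csw)).
  by rewrite divr_gt0// mulr_gt0.
have pm : 0 < sigma d.-1 g.
  pose rho := Num.min 1 (c1 * s).
  have r0 : 0 < rho by rewrite lt_min ltr01 mulr_gt0.
  have r1 : rho <= 1 by rewrite ge_min lexx.
  apply: lt_le_trans (g6 rho r0 r1 _); first by rewrite divr_gt0// mulr_gt0.
  move=> w aw bw; rewrite le_min => /andP[_ wr].
  by apply: (clo_oc hC); rewrite addrAC; exact: hball.
rewrite /mu; split.
- by rewrite (le_trans _ (ln_quot_ge A10 A40 s0 k0 pd g1 g4)) ?lerD2l//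
    (le_trans (ln_quot_le A20 A30 s0 k0 p1 g2 g3))// lerD2l.
- move=> w aw bw nC; have w0' : w != 0.
    by apply/eqP => w_0; apply: nC; rewrite w_0 addr0; exact: (frame_axis hC fr s0).
  apply: le_trans (ln_quot_ge A10 A50 (enorm_gt0 w0') k0 pm g1 (g5 w aw bw nC)).
  by rewrite lerD2l.
- move=> rho r0 r1 hr.
  by apply: (le_trans (ln_quot_le A20 A60 r0 k0 p1 g2 (g6 rho r0 r1 hr))); rewrite lerD2l.
- move=> w aw bw w_0 Cw; apply: (le_trans (ln_quot_le A20 A70 (enorm_gt0 w_0) k0 p1 g2
    (g7 w aw bw Cw (hround s0 s1 aw bw Cw)))).
  by rewrite lerD2l.
- move=> rho hr; have r0 : 0 < rho := lt_le_trans nsw (hr _ asw bsw Csw).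
  by apply: le_trans (ln_quot_ge A10 A80 r0 k0 p2 g1 (g8 rho hr)); rewrite lerD2l.
Qed.

Lemma slice_mono s t w : ev a w = 0 -> ev b w = 0 -> s <= t -> C (e1 + w + s *: e2) ->
  C (e1 + w + t *: e2).
Proof.
move=> aw bw st Cw.
rewrite (_ : _ + _ = 1 *: (e1 + w + s *: e2) + (t - s) *: e2).
  by apply: (oc_comb hC) => //; [exact: (fr2 fr)|rewrite subr_ge0].
by vec_ring.
Qed.

End SingularAsymptotics.

Section Heights.
Context {R : realType} (h : R).

Definition height (n : nat) : R := h * expR (- (2 * n%:R)).

Context (h0 : 0 < h).

Lemma height_gt0 n : 0 < height n.
Proof. by rewrite mulr_gt0// expR_gt0. Qed.

Lemma ln_height n : ln (height n) = ln h - 2 * n%:R.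
Proof. by rewrite lnM ?posrE ?expR_gt0// expRK. Qed.

(** Consecutive heights differ by the factor [expR 2]. Passing from integer times to an arbitrary
    height [s] therefore costs only an additive constant in logarithms, visible as the terms
    [2 * al^-1] and [2 * be^-1] below. *)
Lemma height_bracket N s : 0 < s -> s <= height N ->
  exists n, [/\ (N <= n)%N, height n.+1 <= s & s <= height n].
Proof.
move=> s0 sN; pose x := (ln h - ln s) / 2.
have xN : N%:R <= x.
  have : ln s <= ln (height N) by rewrite ler_ln ?posrE ?height_gt0.
  by rewrite ln_height /x; lra.
have x0 : 0 <= x := le_trans (ler0n R N) xN.
have [t1 t2] : (Num.trunc x)%:R <= x /\ x < (Num.trunc x).+1%:R.
  by have /andP[] := truncn_itv x0.
exists (Num.trunc x); split.
- by rewrite -ltnS -(ltr_nat R); exact: le_lt_trans t2.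
- by rewrite -ler_ln ?posrE ?height_gt0// ln_height; rewrite /x in t2; lra.
- by rewrite -ler_ln ?posrE ?height_gt0// ln_height; rewrite /x in t1; lra.
Qed.

Lemma height_le e : 0 < e -> exists N, forall n, (N <= n)%N -> height n <= e.
Proof.
move=> e0; pose x := (ln h - ln e) / 2; exists (Num.trunc x).+1 => n nN.
rewrite -ler_ln ?posrE ?height_gt0// ln_height.
have := truncnS_gt x; have : (Num.trunc x).+1%:R <= n%:R :> R by rewrite ler_nat.
by rewrite /x; lra.
Qed.

End Heights.

Section GrowthRates.
Context {R : realType} {d : nat} (hd : (3 <= d)%N).
Local Notation V := 'cV[R]_d.
Context {Omega : set (projspace R d)} {x0 : projspace R d} {f0 : 'rV[R]_d}.
Local Notation C := (@cone R d Omega x0 f0).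
Context (hC : open_cone C f0).
Context {e1 e2 : V} {a b : 'rV[R]_d} (fr : frame C e1 e2 a b).
Context {dl : R} (dl0 : 0 < dl) (dl1 : dl <= 1)
  (hround : forall s w, 0 < s -> s <= 1 -> ev a w = 0 -> ev b w = 0 ->
    C (e1 + w + s *: e2) -> clo C (e1 - dl *: w + s *: e2)).
Context {h c K : R} {G : nat -> 'M[R]_d} (c0 : 0 < c) (K0 : 0 < K) (h0 : 0 < h)
  (hG : exists N, forall n, (N <= n)%N -> height h n <= 1 /\
    exists kap, @distortion R d C c K kap (G n) (e1 + height h n *: e2)).
Local Notation inner_exp := (@inner_exp R d Omega x0 f0 e1 e2 a b).
Local Notation outer_exp := (@outer_exp R d Omega x0 f0 e1 e2 a b).
Local Notation Z n := (mu 1 d (G n)).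
Local Notation X n := (mu 1 d.-1 (G n)).
Local Notation Y n := (mu 1 2 (G n)).

Let bounds := mu_bounds hd hC fr dl0 dl1 hround c0 K0.

Let ln_powR_scale (A p s : R) : 0 < A -> 0 < s -> ln (A * s `^ p) = ln A + p * ln s.
Proof. by move=> A0 s0; rewrite lnM ?posrE ?powR_gt0// ln_powR. Qed.

Lemma inner_exp_growth al : 0 < al -> inner_exp al ->
  exists k N, forall n, (N <= n)%N -> X n <= al^-1 * Z n + k.
Proof.
move=> al0 [c1 [s1 [c10 s10 s11 hin]]]; have [k hk] := bounds; have [N hN] := hG.
have p0 : 0 < al^-1 by rewrite invr_gt0.
have [N' hN'] := height_le h0 s10.
pose A := Num.min 1 (c1 / 2); have A0 : 0 < A by rewrite lt_min ltr01 divr_gt0.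
exists (- ln A + al^-1 * k + k), (maxn N N') => n; rewrite geq_max => /andP[/hN[sn1 [kap ds]] /hN' sn].
have sn0 := height_gt0 h0 n.
have [/andP[z1 z2] _ hX _ _] := hk _ _ _ sn0 sn1 ds.
have r0 : 0 < A * height h n `^ al^-1 by rewrite mulr_gt0// powR_gt0.
have r1 : A * height h n `^ al^-1 <= 1.
  rewrite mulr_ile1 ?powR_ge0 ?(ltW A0)//; first by rewrite ge_min lexx.
  by have := le_powR (ltW p0) (ltW sn0) sn1; rewrite powR1.
have := hX _ r0 r1; rewrite ln_powR_scale// => hX'.
have : X n <= - (ln A + al^-1 * ln (height h n)) + k.
  apply: hX' => w aw bw wr; apply: (clo_oc hC); apply: contrapT => /(hin _ _ sn0 sn aw bw).
  move=> /le_trans/(_ wr); rewrite ler_pM2r ?powR_gt0// le_min => /andP[_]; lra.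
move=> hx; have : al^-1 * - ln (height h n) <= al^-1 * (Z n + k) by rewrite ler_pM2l//; lra.
lra.
Qed.

(** Slices grow with the height, so a vector outside the slice at [s] is also outside the slice at
    the next lower sampled height, where the growth hypothesis applies. *)
Lemma growth_inner_exp al k N : 0 < al ->
  (forall n, (N <= n)%N -> X n <= al^-1 * Z n + k) -> inner_exp al.
Proof.
move=> al0 hgr; have [k1 hk] := bounds; have [N1 hN] := hG.
have p0 : 0 < al^-1 by rewrite invr_gt0.
pose N' := maxn N N1; have NN : (N <= N')%N by rewrite leq_maxl.
have NN1 : (N1 <= N')%N by rewrite leq_maxr.
exists (expR (- k1 - k - al^-1 * k1 - 2 * al^-1)), (height h N'); split.
- exact: expR_gt0.
- exact: height_gt0.
- by have [] := hN _ NN1.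
move=> s w s0 sN aw bw nC; have [n [nN s1 s2]] := height_bracket h0 s0 sN.
have [sn1 [kap ds]] := hN n.+1 (leq_trans NN1 (leqW nN)).
have sn0 := height_gt0 h0 n.+1.
have [/andP[z1 z2] hX _ _ _] := hk _ _ _ sn0 sn1 ds.
have nC' : ~ C (e1 + w + height h n.+1 *: e2) by move=> /(slice_mono hC fr aw bw s1).
have w0 : w != 0.
  by apply/eqP => w_0; apply: nC; rewrite w_0 addr0; exact: (frame_axis hC fr s0).
have hx := hX w aw bw nC'; have hg := hgr n.+1 (leq_trans NN (leqW nN)).
rewrite -ler_ln ?posrE ?enorm_gt0// ?mulr_gt0 ?expR_gt0 ?powR_gt0//.
rewrite ln_powR_scale ?expR_gt0// expRK.
have l1 : ln s - 2 <= ln (height h n.+1).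
  have : ln s <= ln (height h n) by rewrite ler_ln ?posrE ?height_gt0.
  by rewrite !ln_height// -natr1; lra.
have : al^-1 * Z n.+1 <= al^-1 * (- ln s + 2 + k1) by rewrite ler_pM2l//; lra.
lra.
Qed.

(** The second inequality comes from a transverse vector twice as long as the slice allows, hence
    outside it. It makes [mu 1 d.-1] unbounded, as the limits of quotients require. *)
Lemma outer_exp_growth be : 0 < be -> outer_exp be ->
  exists k N, forall n, (N <= n)%N ->
    be^-1 * Z n - k <= Y n /\ be^-1 * Z n - k <= X n.
Proof.
move=> be0 [A [s1 [A0 s10 s11 hout]]]; have [k hk] := bounds; have [N hN] := hG.
have p0 : 0 < be^-1 by rewrite invr_gt0.
have [N' hN'] := height_le h0 s10.
have [w0 [w0n aw0 bw0 _]] := frame_transverse hd hC fr.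
have n0 := enorm_gt0 w0n; have A20 : 0 < 2 * A by rewrite mulr_gt0.
exists (ln (2 * A) + be^-1 * k + k), (maxn N N') => n.
rewrite geq_max => /andP[/hN[sn1 [kap ds]] /hN' sn].
have sn0 := height_gt0 h0 n.
have [/andP[z1 z2] hX _ _ hY] := hk _ _ _ sn0 sn1 ds.
have lA : ln A <= ln (2 * A) by rewrite ler_ln ?posrE//; have := A0; lra.
have hz : be^-1 * (Z n - k) <= be^-1 * - ln (height h n) by rewrite ler_pM2l//; lra.
split.
  have := hY (A * height h n `^ be^-1); rewrite ln_powR_scale// => hY'.
  have : - (ln A + be^-1 * ln (height h n)) - k <= Y n.
    by apply: hY' => w aw bw; exact: hout.
  lra.
pose t := 2 * A * height h n `^ be^-1 / enorm w0.
have t0 : 0 < t by rewrite divr_gt0// mulr_gt0// powR_gt0.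
have tE : enorm (t *: w0) = 2 * A * height h n `^ be^-1.
  by rewrite enormZ gtr0_norm// divfK// gt_eqF.
have aw : ev a (t *: w0) = 0 by rewrite evZ aw0 mulr0.
have bw : ev b (t *: w0) = 0 by rewrite evZ bw0 mulr0.
have nC : ~ C (e1 + t *: w0 + height h n *: e2).
  move=> /(hout _ _ sn0 sn aw bw); rewrite tE ler_pM2r ?powR_gt0//.
  by apply/negP; rewrite -ltNge; have := A0; lra.
have := hX _ aw bw nC; rewrite tE ln_powR_scale//; lra.
Qed.

Lemma growth_outer_exp be k N : 0 < be ->
  (forall n, (N <= n)%N -> be^-1 * Z n - k <= Y n) -> outer_exp be.
Proof.
move=> be0 hgr; have [k1 hk] := bounds; have [N1 hN] := hG.
have p0 : 0 < be^-1 by rewrite invr_gt0.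
pose N' := maxn N N1; have NN : (N <= N')%N by rewrite leq_maxl.
have NN1 : (N1 <= N')%N by rewrite leq_maxr.
exists (expR (k1 + k + be^-1 * k1 + 2 * be^-1)), (height h N'); split.
- exact: expR_gt0.
- exact: height_gt0.
- by have [] := hN _ NN1.
move=> s w s0 sN aw bw Cw; have [n [nN s1 s2]] := height_bracket h0 s0 sN.
have [sn1 [kap ds]] := hN n (leq_trans NN1 nN).
have sn0 := height_gt0 h0 n.
have [/andP[z1 z2] _ _ hY _] := hk _ _ _ sn0 sn1 ds.
have [->|w0] := eqVneq w 0; first by rewrite enorm0 mulr_ge0 ?expR_ge0 ?powR_ge0.
have hy := hY w aw bw w0 (slice_mono hC fr aw bw s2 Cw).
have hg := hgr n (leq_trans NN nN).
rewrite -ler_ln ?posrE ?enorm_gt0// ?mulr_gt0 ?expR_gt0 ?powR_gt0//.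
rewrite ln_powR_scale ?expR_gt0// expRK.
have l1 : ln (height h n) <= ln s + 2.
  have : ln (height h n.+1) <= ln s by rewrite ler_ln ?posrE ?height_gt0.
  by rewrite !ln_height// -natr1; lra.
have : be^-1 * (- ln s - 2 - k1) <= be^-1 * Z n by rewrite ler_pM2l//; lra.
lra.
Qed.

Lemma outer_exp_ge1 be : 0 < be -> outer_exp be -> 1 <= be.
Proof.
move=> be0 [A [s1 [A0 s10 s11 hout]]]; rewrite leNgt; apply/negP => be1.
have p1 : 0 < be^-1 - 1 by rewrite subr_gt0 invf_gt1.
have [w0 [w0n aw0 bw0 Cw0]] := frame_transverse hd hC fr; have n0 := enorm_gt0 w0n.
have [x1 x10 hx] := small_powR p1 (divr_gt0 n0 (mulr_gt0 (ltr0n R 2) A0)).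
pose s := Num.min s1 x1; have s0 : 0 < s by rewrite lt_min s10.
have ss1 : s <= s1 by rewrite ge_min lexx.
have sx : s <= x1 by rewrite ge_min lexx orbT.
have Cw := Cw0 s s0 (le_trans ss1 s11).
have := hout s (s *: w0) s0 ss1; rewrite !evZ aw0 bw0 mulr0 enormZ gtr0_norm//.
move=> /(_ erefl erefl Cw).
have -> : s `^ be^-1 = s `^ (be^-1 - 1) * s.
  transitivity (s `^ (be^-1 - 1) * s `^ 1); last by rewrite powRr1 ?ltW.
  by rewrite -powRD ?subrK//; apply/implyP => _; rewrite gt_eqF.
rewrite mulrA [leRHS]mulrC ler_pM2l// => h1.
have := hx s (ltW s0) sx; rewrite ler_pdivlMr ?mulr_gt0// => h2; lra.
Qed.

Lemma mu1d_unbounded A : exists N, forall n, (N <= n)%N -> A <= Z n.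
Proof.
have [k hk] := bounds; have [N hN] := hG.
have [N' hN'] := height_le h0 (expR_gt0 (- (A + k))).
exists (maxn N N') => n; rewrite geq_max => /andP[/hN[sn1 [kap ds]] /hN' sn].
have sn0 := height_gt0 h0 n.
have [/andP[z1 z2] _ _ _ _] := hk _ _ _ sn0 sn1 ds.
have : ln (height h n) <= - (A + k).
  by rewrite -[leRHS]expRK ler_ln ?posrE ?expR_gt0.
lra.
Qed.

End GrowthRates.

(** * Lower and upper limits of quotients *)

Section LimitInequalities.
Context {R : realType}.
Implicit Types (u : (\bar R)^nat) (l x y : \bar R).

Lemma limn_esup_le u l : (exists N, forall n, (N <= n)%N -> (u n <= l)%E) -> (limn_esup u <= l)%E.
Proof.
move=> [N hN]; apply: (@le_trans _ _ (ereal_sup [set u n | n in [set n | (N <= n)%N]])).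
  by apply: ereal_inf_lbound; exists [set n | (N <= n)%N] => //; exists N.
by apply: ge_ereal_sup => _ [n nN <-]; exact: hN.
Qed.

Lemma limn_esup_lt u l : (limn_esup u < l)%E -> exists N, forall n, (N <= n)%N -> (u n < l)%E.
Proof.
move=> /ereal_inf_lt[_ [V [N _ hN] <-] hl]; exists N => n nN.
by apply: le_lt_trans hl; apply: ereal_sup_ubound; exists n => //; exact: hN.
Qed.

Lemma limn_einf_ge u l : (exists N, forall n, (N <= n)%N -> (l <= u n)%E) -> (l <= limn_einf u)%E.
Proof.
move=> [N hN]; rewrite leeNr; apply: limn_esup_le; exists N => n nN.
by rewrite leeN2 hN.
Qed.

Lemma limn_einf_gt u l : (l < limn_einf u)%E -> exists N, forall n, (N <= n)%N -> (l < u n)%E.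
Proof.
rewrite lteNr => /limn_esup_lt[N hN]; exists N => n nN.
by rewrite -lteN2 hN.
Qed.

Lemma ereal_between x y : (x < y)%E -> exists r : R, (x < r%:E)%E /\ (r%:E < y)%E.
Proof.
case: x y => [x||] [y||]//.
- by rewrite lte_fin => xy; exists ((x + y) / 2); rewrite !lte_fin; split; lra.
- by move=> _; exists (x + 1); rewrite lte_fin ltry; split => //; lra.
- by move=> _; exists (y - 1); rewrite lte_fin ltNyr; split => //; lra.
- by move=> _; exists 0; rewrite ltNyr ltry.
Qed.

End LimitInequalities.

Section QuotientLimits.
Context {R : realType} (Z W : nat -> R)
  (hW : forall A, exists N, forall n, (N <= n)%N -> A <= W n).
Local Notation Q := (fun n => equot (Z n) (W n)).

Let equotE n : 0 < W n -> Q n = (Z n / W n)%:E.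
Proof. by move=> w; rewrite /equot gt_eqF. Qed.

(** As the denominator tends to infinity, the additive constant [k] contributes less than any [e] to
    the quotient, and the conventions of [equot] for a zero denominator are eventually
    irrelevant. *)
Lemma einf_equot_ge al k N : 0 < al -> (forall n, (N <= n)%N -> W n <= al^-1 * Z n + k) ->
  (al%:E <= limn_einf Q)%E.
Proof.
move=> al0 hgr; apply/lee_subgt0Pr => e e0; apply: limn_einf_ge.
have [N' hN'] := hW (Num.max 1 (al * k / e)).
exists (maxn N N') => n; rewrite geq_max => /andP[/hgr h1 /hN'].
rewrite ge_max => /andP[w1 w2]; have w0 : 0 < W n by apply: lt_le_trans w1.
rewrite equotE// -EFinB lee_fin ler_pdivlMr//.
rewrite ler_pdivrMr// in w2.
have := ler_wpM2l (ltW al0) h1; rewrite mulrDr mulrA mulfV ?gt_eqF// mul1r; lra.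
Qed.

Lemma einf_equot_gt al : 0 < al -> (al%:E < limn_einf Q)%E ->
  exists N, forall n, (N <= n)%N -> W n <= al^-1 * Z n.
Proof.
move=> al0 /limn_einf_gt[N hN]; have [N' hN'] := hW 1.
exists (maxn N N') => n; rewrite geq_max => /andP[/hN h1 /hN' w1].
have w0 : 0 < W n by apply: lt_le_trans w1.
move: h1; rewrite equotE// lte_fin ltr_pdivlMr// => h1.
by rewrite ler_pdivlMl// ltW.
Qed.

Lemma esup_equot_le be k N : 0 < be -> (forall n, (N <= n)%N -> be^-1 * Z n - k <= W n) ->
  (limn_esup Q <= be%:E)%E.
Proof.
move=> be0 hgr; apply/lee_addgt0Pr => e e0; apply: limn_esup_le.
have [N' hN'] := hW (Num.max 1 (be * k / e)).
exists (maxn N N') => n; rewrite geq_max => /andP[/hgr h1 /hN'].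
rewrite ge_max => /andP[w1 w2]; have w0 : 0 < W n by apply: lt_le_trans w1.
rewrite equotE// -EFinD lee_fin ler_pdivrMr//.
rewrite ler_pdivrMr// in w2.
have := ler_wpM2l (ltW be0) h1; rewrite mulrBr mulrA mulfV ?gt_eqF// mul1r; lra.
Qed.

Lemma esup_equot_lt be : 0 < be -> (limn_esup Q < be%:E)%E ->
  exists N, forall n, (N <= n)%N -> be^-1 * Z n <= W n.
Proof.
move=> be0 /limn_esup_lt[N hN]; have [N' hN'] := hW 1.
exists (maxn N N') => n; rewrite geq_max => /andP[/hN h1 /hN' w1].
have w0 : 0 < W n by apply: lt_le_trans w1.
move: h1; rewrite equotE// lte_fin ltr_pdivrMr// => h1.
by rewrite ler_pdivrMl// ltW.
Qed.

End QuotientLimits.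

Theorem corollary1p14 (R : realType) (d : nat) (hd : (3 <= d)%N)
    (Omega : set (projspace R d)) (hOmega : properly_convex Omega)
    (M : R -> R -> R) (hM : morse_gauge M) (r : R)
    (x0 : projspace R d) (hx0 : Omega x0) :
  exists alpha beta : R, 1 < alpha /\
  forall (gamma : nat -> 'M[R]_d) (c : R -> projspace R d) (q : projspace R d),
    (forall n, proj_aut Omega (gamma n)) ->
    projective_geodesic_ray Omega c q ->
    tracks Omega r x0 gamma c ->
    morse Omega M (ray_image c) ->
  forall (f : 'rV[R]_d) (g : 'M[R]_d), euclidean_chart Omega f g ->
  let liminf := limn_einf (fun n => equot (mu 1 d (gamma n))
                                          (mu 1 d.-1 (gamma n))) in
  let limsup := limn_esup (fun n => equot (mu 1 d (gamma n))
                                          (mu 1 2 (gamma n))) in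
  [/\ C_point f g Omega alpha q,
      convex_point f g Omega beta q,
      alpha_exp f g Omega q = liminf /\ (1 < liminf)%E &
      beta_exp f g Omega q = limsup /\ (limsup < +oo)%E].
Proof.
have M0 : 0 <= M 5 1 by apply: hM.
have [dl0 dl1 _] := morse_ratio_bounds M0.
set dl := morse_ratio (M 5 1) in dl0 dl1.
exists (morse_alpha dl), (morse_beta dl).
have al1 := morse_alpha_gt1 dl0 dl1; have be1 := morse_beta_gt1 dl0 dl1.
split=> // G c q hG hc htr hm f g [hf gu] liminf limsup.
case: hOmega => _ oO [f0 [hch hcv _ hbd]].
have hC := cone_open_cone (x0 := x0) hx0 oO hch hcv hbd.
have hD := cone_hilbert_like (x0 := x0) hx0 oO hch hcv hbd.
have [e1 [e2 [a [b [fr ax -> hell [T [h0 [h00 hT]]]]]]]] :=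
  ray_frame (x0 := x0) hx0 oO hch hcv hbd hc.
have hmc := ray_lift_morse (x0 := x0) hch (let: And3 h _ _ := hc in h) hm.
have hin := morse_inner_exp hC hD hmc M0 fr ax hell.
have hout := morse_outer_exp hd hC hD hmc M0 fr ax hell.
have hround := cone_round hC hD hmc M0 fr ax hell.
have [k [K [k0 K0 hdis]]] := tracking_distortion (x0 := x0) hx0 oO hch hcv hbd r.
have hGd : exists N, forall n, (N <= n)%N -> height h0 n <= 1 /\
    exists kap, @distortion R d (@cone R d Omega x0 f0) k K kap (G n) (e1 + height h0 n *: e2).
  have [N1 hN1] := height_le h00 ltr01; pose N2 := (Num.trunc T).+1.
  exists (maxn N1 N2) => n; rewrite geq_max => /andP[/hN1 s1 nN]; split => //.
  apply: hdis; [exact: hG|exact: (frame_axis hC fr (height_gt0 h00 n))|].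
  rewrite /height -hT; first exact: htr.
  by apply: (le_trans (ltW (truncnS_gt T))); rewrite ler_nat.
have d20 : 0 < dl / 2 by rewrite divr_gt0.
have d21 : dl / 2 <= 1 by lra.
have inner_gr := inner_exp_growth hd hC fr d20 d21 hround k0 K0 h00 hGd.
have gr_inner := growth_inner_exp hd hC fr d20 d21 hround k0 K0 h00 hGd.
have outer_gr := outer_exp_growth hd hC fr d20 d21 hround k0 K0 h00 hGd.
have gr_outer := growth_outer_exp hd hC fr d20 d21 hround k0 K0 h00 hGd.
have hZ := mu1d_unbounded hd hC fr d20 d21 hround k0 K0 h00 hGd.
have be0 : 0 < morse_beta dl by apply: lt_trans be1.
have al0 : 0 < morse_alpha dl by apply: lt_trans al1.
have [kb [Nb hb]] := outer_gr _ be0 hout.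
(* The outer exponent bounds both denominators below by a multiple of [mu 1 d], up to a constant, so
   both tend to infinity with it. *)
have unb (W : nat -> R) : (forall n, (Nb <= n)%N -> (morse_beta dl)^-1 * mu 1 d (G n) - kb <= W n) ->
    forall A, exists N, forall n, (N <= n)%N -> A <= W n.
  move=> hW A; have [N hN] := hZ (morse_beta dl * (A + kb)); exists (maxn N Nb) => n.
  rewrite geq_max => /andP[/hN h1 /hW]; apply: le_trans.
  by rewrite lerBrDr ler_pdivlMl.
have hX := unb _ (fun n nN => (hb n nN).2).
have hY := unb _ (fun n nN => (hb n nN).1).
have C_inner := C_point_inner hx0 oO hch hcv hbd fr hf gu.
have inner_C := inner_C_point hx0 oO hch hcv hbd fr hf gu.
have conv_outer := convex_point_outer hx0 oO hch hcv hbd fr hf gu hd.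
have outer_conv := outer_convex_point hx0 oO hch hcv hbd fr hf gu al1 hin.
have liminf_ge al : 1 < al -> C_point f g Omega al (prj x0 e1) -> (al%:E <= liminf)%E.
  move=> a1 /(C_inner _ a1) ha; have a0 : 0 < al by apply: lt_trans a1.
  by have [k1 [N1 h1]] := inner_gr _ a0 ha; exact: einf_equot_ge h1.
have limsup_le be : convex_point f g Omega be (prj x0 e1) -> (limsup <= be%:E)%E.
  move=> /conv_outer[b1 ho]; have b0 : 0 < be by apply: lt_le_trans b1.
  have [k1 [N1 h1]] := outer_gr _ b0 ho.
  exact: (esup_equot_le hY b0 (fun n nN => (h1 n nN).1)).
have Cal : C_point f g Omega (morse_alpha dl) (prj x0 e1) by apply: inner_C.
have Cbe : convex_point f g Omega (morse_beta dl) (prj x0 e1) by apply: outer_conv => //; exact: ltW.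
split => //; split.
- apply/eqP; rewrite /alpha_exp ifT; last by apply/asboolP; exists (morse_alpha dl).
  rewrite eq_le; apply/andP; split.
    by apply: ge_ereal_sup => _ [al [a1 ha] <-]; exact: liminf_ge.
  (* A real [s] strictly between the supremum and the lower limit would be an admissible exponent,
     by growth of [mu 1 d.-1], and so could not exceed the supremum. *)
  rewrite leNgt; apply/negP => /ereal_between[s [s1 s2]].
  have als : morse_alpha dl < s.
    rewrite -lte_fin; apply: le_lt_trans s1; apply: ereal_sup_ubound.
    by exists (morse_alpha dl).
  have s1' : 1 < s by apply: lt_trans als.
  have s0 : 0 < s by apply: lt_trans s1'.
  have [N hN] := einf_equot_gt hX s0 s2.
  have hs : C_point f g Omega s (prj x0 e1).
    by apply: inner_C => //; apply: (gr_inner s 0 N s0) => n /hN; rewrite addr0.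
  move: s1; rewrite ltNge => /negP; apply; apply: ereal_sup_ubound.
  by exists s.
- by apply: lt_le_trans (liminf_ge _ al1 Cal); rewrite lte_fin.
- apply/eqP; rewrite /beta_exp eq_le; apply/andP; split; last first.
    by apply: le_ereal_inf_tmp => _ [be hbe <-]; exact: limsup_le.
  rewrite leNgt; apply/negP => /ereal_between[s [s1 s2]].
  (* The growth lemmas need a positive exponent, which [s] is not yet known to be. Once [t] is an
     outer exponent it is at least 1, so it cannot be 1/2 and equals [s]. *)
  pose t := Num.max s (1 / 2); have t0 : 0 < t by rewrite lt_max divr_gt0// orbT.
  have st : (limsup < t%:E)%E by apply: (lt_le_trans s1); rewrite lee_fin le_max lexx.
  have [N hN] := esup_equot_lt hY t0 st.
  have /(gr_outer t 0 N t0) ho n : (N <= n)%N -> t^-1 * mu 1 d (G n) - 0 <= mu 1 2 (G n).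
    by move=> /hN; rewrite subr0.
  have t1 := outer_exp_ge1 hd hC fr t0 ho.
  have ts : t = s by move: t1; rewrite /t; case: (leP s (1 / 2)) => //; lra.
  rewrite ts in t1 ho.
  move: s2; rewrite ltNge => /negP; apply; apply: ereal_inf_lbound.
  by exists s => //; exact: outer_conv.
- by apply: le_lt_trans (limsup_le _ Cbe) _; rewrite ltry.
Qed.
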